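(* Let $(D,y)$ be a left Kan pseudomonad on a 2-category $\mathcal K$, with Kleisli 2-category $\mathcal K_D$ and canonical pseudofunctor $J_D:\mathcal K\to\mathcal K_D$. Let $\mathcal L$ be a 2-category and let $G:\mathcal K_D\to\mathcal L$ and $H:\mathcal L\to\mathcal K$ be pseudofunctors such that there is a biadjunction in which $G\circ J_D:\mathcal K\to\mathcal L$ is left biadjoint to $H$. Then there is an induced colax adjunction in which $G:\mathcal K_D\to\mathcal L$ is left colax adjoint to $J_D\circ H:\mathcal L\to\mathcal K_D$.
   Context: Left Kan pseudomonads. A left Kan pseudomonad $(D,y)$ on a 2-category $\mathcal K$ (equivalently, a lax-idempotent pseudomonad) consists of: a function $D$ on objects of $\mathcal K$; 1-cells $y_A:A\to DA$; and for each 1-cell $f:A\to DB$ a 1-cell $f^{\mathbb D}:DA\to DB$ and an invertible 2-cell $\mathbb D_f:f\Rightarrow f^{\mathbb D}y_A$ exhibiting $f^{\mathbb D}$ as a left Kan extension of $f$ along $y_A$; such that (i) the identity 2-cell on $y_A$ exhibits $1_{DA}$ as a left Kan extension of $y_A$ along $y_A$; (ii) for all $g:B\to DC$ and $f:A\to DB$, $g^{\mathbb D}$ preserves the left Kan extension $(f^{\mathbb D},\mathbb D_f)$. A pseudo-$D$-algebra is an object $C$ with, for each $f:B\to C$, a 1-cell $f^{\mathbb C}:DB\to C$ and an invertible 2-cell $\mathbb C_f:f\Rightarrow f^{\mathbb C}y_B$ exhibiting $f^{\mathbb C}$ as a left Kan extension of $f$ along $y_B$, such that for all $g:B\to C$ and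 $f:A\to DB$, $g^{\mathbb C}$ preserves $(f^{\mathbb D},\mathbb D_f)$. A $D$-pseudomorphism $h:C\to X$ is a 1-cell preserving the left Kan extensions $(f^{\mathbb C},\mathbb C_f)$. These, with all 2-cells of $\mathcal K$ between pseudomorphisms, form the 2-category $\text{Ps-}D\text{-Alg}$. The Kleisli 2-category $\mathcal K_D$ is its full sub-2-category on the free algebras $(DA,(-)^{\mathbb D})$. The pseudofunctor $J_D:\mathcal K\to\mathcal K_D$ sends $A\mapsto DA$ and $f:A\to B$ to $(y_Bf)^{\mathbb D}$ (with the evident action on 2-cells and canonical coherence isomorphisms). Colax adjunctions. For a pseudofunctor $K$ the structure isomorphisms are $\gamma:K(gf)\Rightarrow Kg\circ Kf$ and $\iota:K1_A\Rightarrow 1_{KA}$. A colax natural transformation $\alpha:K\Rightarrow K'$ consists of 1-cells $\alpha_A:KA\to K'A$ and 2-cells $\alpha_f:\alpha_B\circ Kf\Rightarrow K'f\circ\alpha_A$ for $f:A\to B$, subject to the usual unit, composition and local naturality axioms; it is pseudonatural if all $\alpha_f$ are invertible. A colax adjunction exhibiting $F:\mathcal X\to\mathcal Y$ as left colax adjoint to $U:\mathcal Y\to\mathcal X$ consists of pseudofunctors $F,U$, colax natural transformations $\eta:1_{\mathcal X}\Rightarrow UF$, $\epsilon:FU\Rightarrow 1_{\mathcal Y}$ and modifications $\Psi:\epsilon F\circ F\eta\to 1_F$, $\Phi:1_U\to U\epsilon\circ\eta U$ such that for all $A\in\mathcal X$, $B\in\mathcal Y$ the following composites are identities: $$\eta_A\xrightarrow{\Phi_{FA}\eta_A}U\epsilon_{FA}\,\eta_{UFA}\,\eta_A\xrightarrow{U\epsilon_{FA}\,\eta_{\eta_A}}U\epsilon_{FA}\,UF\eta_A\,\eta_A\xrightarrow{(U\Psi)_A\eta_A}\eta_A,$$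 $$\epsilon_B\xrightarrow{\epsilon_B(F\Phi)_B}\epsilon_B\,FU\epsilon_B\,F\eta_{UB}\xrightarrow{\epsilon_{\epsilon_B}F\eta_{UB}}\epsilon_B\,\epsilon_{FUB}\,F\eta_{UB}\xrightarrow{\epsilon_B\Psi_{UB}}\epsilon_B,$$ where $(U\Psi)_A=\iota\circ U\Psi_A\circ\gamma^{-1}$ and $(F\Phi)_B=\gamma\circ F\Phi_B\circ\iota^{-1}$. A biadjunction is a colax adjunction in which $\eta,\epsilon$ are pseudonatural and $\Psi,\Phi$ are invertible. *)

(* Defs.v *)
From Corelib Require Import ssreflect.
From Stdlib Require Import Classical_Prop ClassicalEpsilon.

Set Implicit Arguments.
Unset Strict Implicit.
Unset Printing Implicit Defensive.

(* 1-cells compose in applicative order: [g ∘ f] is "f, then g".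
   2-cells compose vertically in diagrammatic order: [α ⨾ β] is "α, then β",
   so that a pasting composite reads from left to right.  [g ◁ α] and [β ▷ f]
   are the whiskerings of a 2-cell by a 1-cell.

   A 2-category is a bicategory whose associators and unitors are identities,
   that is, are the casts of identity 2-cells along equalities of 1-cells
   ([strict], [TwoCat] below).  Keeping the constraint cells in the syntax makes
   every pasting composite well typed. *)

Declare Scope bicat_scope.
Open Scope bicat_scope.

Reserved Notation "f ⇒ g" (at level 70, no associativity).
Reserved Notation "g ∘ f" (at level 40, left associativity).
Reserved Notation "g ◁ α" (at level 44, no associativity).
Reserved Notation "β ▷ f" (at level 44, no associativity).
Reserved Notation "α ⨾ β" (at level 52, right associativity).

Record Bicat := {
  ob :> Type;
  hom : ob -> ob -> Type;
  cell : forall {A B}, hom A B -> hom A B -> Type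
    where "f ⇒ g" := (cell f g);
  id1 : forall A, hom A A;
  comp1 : forall {A B C}, hom B C -> hom A B -> hom A C
    where "g ∘ f" := (comp1 g f);
  id2 : forall {A B} (f : hom A B), f ⇒ f;
  vcomp : forall {A B} {f g h : hom A B}, f ⇒ g -> g ⇒ h -> f ⇒ h
    where "α ⨾ β" := (vcomp α β);
  lwhisk : forall {A B C} (g : hom B C) {f f' : hom A B},
    f ⇒ f' -> g ∘ f ⇒ g ∘ f'
    where "g ◁ α" := (lwhisk g α);
  rwhisk : forall {A B C} {g g' : hom B C},
    g ⇒ g' -> forall f : hom A B, g ∘ f ⇒ g' ∘ f
    where "β ▷ f" := (rwhisk β f);
  assoc : forall {A B C E} (h : hom C E) (g : hom B C) (f : hom A B),
    h ∘ (g ∘ f) ⇒ (h ∘ g) ∘ f;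
  ainv : forall {A B C E} (h : hom C E) (g : hom B C) (f : hom A B),
    (h ∘ g) ∘ f ⇒ h ∘ (g ∘ f);
  lunit : forall {A B} (f : hom A B), id1 B ∘ f ⇒ f;
  linv : forall {A B} (f : hom A B), f ⇒ id1 B ∘ f;
  runit : forall {A B} (f : hom A B), f ∘ id1 A ⇒ f;
  rinv : forall {A B} (f : hom A B), f ⇒ f ∘ id1 A;

  vcomp_id_l : forall A B (f g : hom A B) (α : f ⇒ g), id2 f ⨾ α = α;
  vcomp_id_r : forall A B (f g : hom A B) (α : f ⇒ g), α ⨾ id2 g = α;
  vcomp_assoc : forall A B (f g h k : hom A B) (α : f ⇒ g) (β : g ⇒ h) (γ : h ⇒ k),
    (α ⨾ β) ⨾ γ = α ⨾ (β ⨾ γ);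
  lwhisk_id : forall A B C (g : hom B C) (f : hom A B), g ◁ id2 f = id2 (g ∘ f);
  lwhisk_vcomp : forall A B C (g : hom B C) (f f' f'' : hom A B)
    (α : f ⇒ f') (β : f' ⇒ f''), g ◁ (α ⨾ β) = (g ◁ α) ⨾ (g ◁ β);
  rwhisk_id : forall A B C (g : hom B C) (f : hom A B), id2 g ▷ f = id2 (g ∘ f);
  rwhisk_vcomp : forall A B C (g g' g'' : hom B C) (α : g ⇒ g') (β : g' ⇒ g'')
    (f : hom A B), (α ⨾ β) ▷ f = (α ▷ f) ⨾ (β ▷ f);
  interchange : forall A B C (g g' : hom B C) (f f' : hom A B)
    (β : g ⇒ g') (α : f ⇒ f'), (β ▷ f) ⨾ (g' ◁ α) = (g ◁ α) ⨾ (β ▷ f');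

  assoc_ainv : forall A B C E (h : hom C E) (g : hom B C) (f : hom A B),
    assoc h g f ⨾ ainv h g f = id2 _;
  ainv_assoc : forall A B C E (h : hom C E) (g : hom B C) (f : hom A B),
    ainv h g f ⨾ assoc h g f = id2 _;
  lunit_linv : forall A B (f : hom A B), lunit f ⨾ linv f = id2 _;
  linv_lunit : forall A B (f : hom A B), linv f ⨾ lunit f = id2 _;
  runit_rinv : forall A B (f : hom A B), runit f ⨾ rinv f = id2 _;
  rinv_runit : forall A B (f : hom A B), rinv f ⨾ runit f = id2 _;

  lunit_nat : forall A B (f f' : hom A B) (α : f ⇒ f'),
    (id1 B ◁ α) ⨾ lunit f' = lunit f ⨾ α;
  runit_nat : forall A B (f f' : hom A B) (α : f ⇒ f'),
    (α ▷ id1 A) ⨾ runit f' = runit f ⨾ α;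
  assoc_nat_r : forall A B C E (h : hom C E) (g : hom B C) (f f' : hom A B)
    (α : f ⇒ f'), (h ◁ (g ◁ α)) ⨾ assoc h g f' = assoc h g f ⨾ ((h ∘ g) ◁ α);
  assoc_nat_m : forall A B C E (h : hom C E) (g g' : hom B C) (β : g ⇒ g')
    (f : hom A B), (h ◁ (β ▷ f)) ⨾ assoc h g' f = assoc h g f ⨾ ((h ◁ β) ▷ f);
  assoc_nat_l : forall A B C E (h h' : hom C E) (χ : h ⇒ h') (g : hom B C)
    (f : hom A B), (χ ▷ (g ∘ f)) ⨾ assoc h' g f = assoc h g f ⨾ ((χ ▷ g) ▷ f);
  triangle : forall A B C (g : hom B C) (f : hom A B),
    assoc g (id1 B) f ⨾ (runit g ▷ f) = g ◁ lunit f;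
  pentagon : forall A B C E Z (k : hom E Z) (h : hom C E) (g : hom B C) (f : hom A B),
    assoc k h (g ∘ f) ⨾ assoc (k ∘ h) g f
    = (k ◁ assoc h g f) ⨾ assoc k (h ∘ g) f ⨾ (assoc k h g ▷ f)
}.

Arguments hom {b} A B.
Arguments cell {b A B} f g.
Arguments id1 {b} A.
Arguments comp1 {b A B C} g f.
Arguments id2 {b A B} f.
Arguments vcomp {b A B f g h} α β.
Arguments lwhisk {b A B C} g {f f'} α.
Arguments rwhisk {b A B C g g'} β f.
Arguments assoc {b A B C E} h g f.
Arguments ainv {b A B C E} h g f.
Arguments lunit {b A B} f.
Arguments linv {b A B} f.
Arguments runit {b A B} f.
Arguments rinv {b A B} f.

Notation "f ⇒ g" := (cell f g) : bicat_scope.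
Notation "g ∘ f" := (comp1 g f) : bicat_scope.
Notation "α ⨾ β" := (vcomp α β) : bicat_scope.
Notation "g ◁ α" := (lwhisk g α) : bicat_scope.
Notation "β ▷ f" := (rwhisk β f) : bicat_scope.

Definition cell_of_eq (K : Bicat) (A B : K) (f g : hom A B) (e : f = g) : f ⇒ g :=
  match e with eq_refl => id2 f end.

Record strict (K : Bicat) : Prop := {
  strict_lunit : forall (A B : K) (f : hom A B),
    exists e : id1 B ∘ f = f, lunit f = cell_of_eq e;
  strict_runit : forall (A B : K) (f : hom A B),
    exists e : f ∘ id1 A = f, runit f = cell_of_eq e;
  strict_assoc : forall (A B C E : K) (h : hom C E) (g : hom B C) (f : hom A B),
    exists e : h ∘ (g ∘ f) = (h ∘ g) ∘ f, assoc h g f = cell_of_eq e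
}.

Record TwoCat := {
  twocat_bicat :> Bicat;
  twocat_strict : strict twocat_bicat
}.

Record invcell (K : Bicat) (A B : K) (f g : hom A B) := {
  fwd :> f ⇒ g;
  bwd : g ⇒ f;
  fwd_bwd : fwd ⨾ bwd = id2 f;
  bwd_fwd : bwd ⨾ fwd = id2 g
}.
Arguments fwd {K A B f g} i.
Arguments bwd {K A B f g} i.

Definition is_invertible (K : Bicat) (A B : K) (f g : hom A B) (α : f ⇒ g) : Prop :=
  exists β : g ⇒ f, α ⨾ β = id2 f /\ β ⨾ α = id2 g.

Section FullSub.
Variables (K : Bicat) (I : Type) (F : I -> K).

Definition full_sub_bicat : Bicat.
Proof.
refine {|
  ob := I;
  hom := fun A B => @hom K (F A) (F B);
  cell := fun A B f g => @cell K _ _ f g;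
  id1 := fun A => id1 (F A);
  comp1 := fun A B C g f => g ∘ f;
  id2 := fun A B f => id2 f;
  vcomp := fun A B f g h α β => α ⨾ β;
  lwhisk := fun A B C g f f' α => g ◁ α;
  rwhisk := fun A B C g g' β f => β ▷ f;
  assoc := fun A B C E h g f => assoc h g f;
  ainv := fun A B C E h g f => ainv h g f;
  lunit := fun A B f => lunit f;
  linv := fun A B f => linv f;
  runit := fun A B f => runit f;
  rinv := fun A B f => rinv f |}; intros.
- exact: vcomp_id_l.
- exact: vcomp_id_r.
- exact: vcomp_assoc.
- exact: lwhisk_id.
- exact: lwhisk_vcomp.
- exact: rwhisk_id.
- exact: rwhisk_vcomp.
- exact: interchange.
- exact: assoc_ainv.
- exact: ainv_assoc.
- exact: lunit_linv.
- exact: linv_lunit.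
- exact: runit_rinv.
- exact: rinv_runit.
- exact: lunit_nat.
- exact: runit_nat.
- exact: assoc_nat_r.
- exact: assoc_nat_m.
- exact: assoc_nat_l.
- exact: triangle.
- exact: pentagon.
Defined.
End FullSub.

Lemma full_sub_strict (K : TwoCat) (I : Type) (F : I -> K) : strict (full_sub_bicat F).
Proof.
split; intros.
- exact: (strict_lunit (twocat_strict K) f).
- exact: (strict_runit (twocat_strict K) f).
- exact: (strict_assoc (twocat_strict K) h g f).
Qed.

Definition full_sub (K : TwoCat) (I : Type) (F : I -> K) : TwoCat :=
  {| twocat_strict := full_sub_strict F |}.

Section Calculus.
Variable K : Bicat.

Lemma vcompE (A B : K) (f g h k : hom A B) (α : f ⇒ g) (β : g ⇒ h) (γ : f ⇒ h)
  (e : α ⨾ β = γ) (δ : h ⇒ k) : α ⨾ β ⨾ δ = γ ⨾ δ.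
Proof. by rewrite -e vcomp_assoc. Qed.

Lemma vcompE3 (A B : K) (f g h k m : hom A B) (α : f ⇒ g) (β : g ⇒ h) (γ : h ⇒ k)
  (δ : f ⇒ k) (e : α ⨾ β ⨾ γ = δ) (ε : k ⇒ m) : α ⨾ β ⨾ γ ⨾ ε = δ ⨾ ε.
Proof. by rewrite -e !vcomp_assoc. Qed.

Lemma inv_cancel_l (A B : K) (f g h : hom A B) (φ : f ⇒ g) (ψ : g ⇒ f)
  (e : ψ ⨾ φ = id2 g) (α β : g ⇒ h) : φ ⨾ α = φ ⨾ β -> α = β.
Proof.
move=> E; rewrite -(vcomp_id_l α) -(vcomp_id_l β) -e !vcomp_assoc.
by rewrite E.
Qed.

Lemma inv_cancel_r (A B : K) (f g h : hom A B) (φ : g ⇒ h) (ψ : h ⇒ g)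
  (e : φ ⨾ ψ = id2 g) (α β : f ⇒ g) : α ⨾ φ = β ⨾ φ -> α = β.
Proof.
move=> E; rewrite -(vcomp_id_r α) -(vcomp_id_r β) -e -!vcomp_assoc.
by rewrite E.
Qed.

Lemma ainv_nat_r (A B C E : K) (h : hom C E) (g : hom B C) (f f' : hom A B)
  (α : f ⇒ f') : ainv h g f ⨾ (h ◁ (g ◁ α)) = ((h ∘ g) ◁ α) ⨾ ainv h g f'.
Proof.
apply: (inv_cancel_r (assoc_ainv h g f')).
by rewrite !vcomp_assoc ainv_assoc assoc_nat_r (vcompE (ainv_assoc _ _ _))
  vcomp_id_l vcomp_id_r.
Qed.

Lemma ainv_nat_m (A B C E : K) (h : hom C E) (g g' : hom B C) (β : g ⇒ g')
  (f : hom A B) : ainv h g f ⨾ (h ◁ (β ▷ f)) = ((h ◁ β) ▷ f) ⨾ ainv h g' f.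
Proof.
apply: (inv_cancel_r (assoc_ainv h g' f)).
by rewrite !vcomp_assoc ainv_assoc assoc_nat_m (vcompE (ainv_assoc _ _ _))
  vcomp_id_l vcomp_id_r.
Qed.

Lemma ainv_nat_l (A B C E : K) (h h' : hom C E) (χ : h ⇒ h') (g : hom B C)
  (f : hom A B) : ainv h g f ⨾ (χ ▷ (g ∘ f)) = ((χ ▷ g) ▷ f) ⨾ ainv h' g f.
Proof.
apply: (inv_cancel_r (assoc_ainv h' g f)).
by rewrite !vcomp_assoc ainv_assoc assoc_nat_l (vcompE (ainv_assoc _ _ _))
  vcomp_id_l vcomp_id_r.
Qed.

Lemma linv_nat (A B : K) (f f' : hom A B) (α : f ⇒ f') :
  linv f ⨾ (id1 B ◁ α) = α ⨾ linv f'.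
Proof.
apply: (inv_cancel_r (lunit_linv f')).
by rewrite !vcomp_assoc linv_lunit lunit_nat (vcompE (linv_lunit _))
  vcomp_id_l vcomp_id_r.
Qed.

Lemma lwhisk_id1_inj (A B : K) (f g : hom A B) (α β : f ⇒ g) :
  id1 B ◁ α = id1 B ◁ β -> α = β.
Proof.
move=> e; apply: (inv_cancel_l (linv_lunit f)).
by rewrite -!lunit_nat e.
Qed.

Lemma rwhisk_id1_inj (A B : K) (f g : hom A B) (α β : f ⇒ g) :
  α ▷ id1 A = β ▷ id1 A -> α = β.
Proof.
move=> e; apply: (inv_cancel_l (rinv_runit f)).
by rewrite -!runit_nat e.
Qed.

Lemma lunit_comp (A B C : K) (g : hom B C) (f : hom A B) :
  assoc (id1 C) g f ⨾ (lunit g ▷ f) = lunit (g ∘ f).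
Proof.
apply: lwhisk_id1_inj; rewrite lwhisk_vcomp -triangle.
apply: (inv_cancel_r (assoc_ainv (id1 C) g f)).
rewrite !vcomp_assoc assoc_nat_m -triangle rwhisk_vcomp assoc_nat_l.
rewrite (vcompE (pentagon _ _ _ _)) !vcomp_assoc; congr vcomp.
Qed.

Lemma runit_comp (A B C : K) (g : hom B C) (f : hom A B) :
  assoc g f (id1 A) ⨾ runit (g ∘ f) = g ◁ runit f.
Proof.
apply: rwhisk_id1_inj.
apply: (inv_cancel_l (ainv_assoc g (f ∘ id1 A) (id1 A))).
rewrite -assoc_nat_m rwhisk_vcomp.
apply: (@inv_cancel_l _ _ _ _ _ (g ◁ assoc f (id1 A) (id1 A)) (g ◁ ainv f (id1 A) (id1 A))).
  by rewrite -lwhisk_vcomp ainv_assoc lwhisk_id.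
rewrite (vcompE (eq_sym (lwhisk_vcomp _ _ _))) triangle.
rewrite assoc_nat_r -triangle.
rewrite (vcompE (pentagon _ _ _ _)) !vcomp_assoc //.
Qed.

Lemma pentagon_ainv_rwhisk (A B C E Z : K) (k : hom E Z) (h : hom C E) (g : hom B C)
  (f : hom A B) :
  assoc (k ∘ h) g f ⨾ (ainv k h g ▷ f)
  = ainv k h (g ∘ f) ⨾ (k ◁ assoc h g f) ⨾ assoc k (h ∘ g) f.
Proof.
apply: (inv_cancel_l (ainv_assoc k h (g ∘ f))).
rewrite (vcompE (pentagon _ _ _ _)) (vcompE (assoc_ainv _ _ _)) vcomp_id_l.
by rewrite !vcomp_assoc -rwhisk_vcomp assoc_ainv rwhisk_id vcomp_id_r.
Qed.

Lemma pentagon_ainv_lwhisk (A B C E Z : K) (k : hom E Z) (h : hom C E) (g : hom B C)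
  (f : hom A B) :
  assoc k (h ∘ g) f ⨾ (assoc k h g ▷ f) ⨾ ainv (k ∘ h) g f
  = (k ◁ ainv h g f) ⨾ assoc k h (g ∘ f).
Proof.
apply: (@inv_cancel_l _ _ _ _ _ (k ◁ assoc h g f) (k ◁ ainv h g f)).
  by rewrite -lwhisk_vcomp ainv_assoc lwhisk_id.
rewrite -!vcomp_assoc (vcomp_assoc _ _ (assoc k h g ▷ f)) -pentagon.
rewrite !vcomp_assoc assoc_ainv vcomp_id_r.
by rewrite (vcompE (eq_sym (lwhisk_vcomp _ _ _))) assoc_ainv lwhisk_id vcomp_id_l.
Qed.

End Calculus.

Reserved Notation "F ·₁ f" (at level 35, no associativity).
Reserved Notation "F ·₂ α" (at level 35, no associativity).

(* The part of a pseudofunctor that acts on objects and 1-cells.  The data of a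
   colax transformation only mentions this part, so indexing [ColaxData] by it,
   with definitional eta, makes F(UF) and (FU)F, or F1 and F, interchangeable
   as sources and targets. *)
#[projections(primitive)]
Record prefunctor (X Y : Bicat) := {
  map0 :> X -> Y;
  map1 : forall A B : X, hom A B -> hom (map0 A) (map0 B)
}.
Notation "F ·₁ f" := (map1 F f) : bicat_scope.

Definition pre_id (X : Bicat) : prefunctor X X :=
  {| map0 := fun A => A; map1 := fun A B f => f |}.
Definition pre_comp (X Y Z : Bicat) (G : prefunctor Y Z) (F : prefunctor X Y) :
  prefunctor X Z :=
  {| map0 := fun A => G (F A); map1 := fun A B f => G ·₁ (F ·₁ f) |}.

Record Pseudofunctor (X Y : Bicat) := {
  pf_pre :> prefunctor X Y;
  map2 : forall (A B : X) (f g : hom A B), f ⇒ g -> pf_pre ·₁ f ⇒ pf_pre ·₁ g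
    where "F ·₂ α" := (map2 α) (only parsing);
  pf_gamma : forall (A B C : X) (g : hom B C) (f : hom A B),
    invcell (pf_pre ·₁ (g ∘ f)) (pf_pre ·₁ g ∘ pf_pre ·₁ f);
  pf_iota : forall A : X, invcell (pf_pre ·₁ id1 A) (id1 (pf_pre A));
  map2_id : forall (A B : X) (f : hom A B), map2 (id2 f) = id2 (pf_pre ·₁ f);
  map2_vcomp : forall (A B : X) (f g h : hom A B) (α : f ⇒ g) (β : g ⇒ h),
    map2 (α ⨾ β) = map2 α ⨾ map2 β;
  pf_gamma_nat_l : forall (A B C : X) (g g' : hom B C) (β : g ⇒ g') (f : hom A B),
    map2 (β ▷ f) ⨾ pf_gamma g' f = pf_gamma g f ⨾ (map2 β ▷ pf_pre ·₁ f);
  pf_gamma_nat_r : forall (A B C : X) (g : hom B C) (f f' : hom A B) (α : f ⇒ f'),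
    map2 (g ◁ α) ⨾ pf_gamma g f' = pf_gamma g f ⨾ (pf_pre ·₁ g ◁ map2 α);
  pf_assoc : forall (A B C E : X) (h : hom C E) (g : hom B C) (f : hom A B),
    map2 (assoc h g f) ⨾ pf_gamma (h ∘ g) f ⨾ (pf_gamma h g ▷ pf_pre ·₁ f)
    = pf_gamma h (g ∘ f) ⨾ (pf_pre ·₁ h ◁ pf_gamma g f)
      ⨾ assoc (pf_pre ·₁ h) (pf_pre ·₁ g) (pf_pre ·₁ f);
  pf_lunit : forall (A B : X) (f : hom A B),
    map2 (lunit f)
    = pf_gamma (id1 B) f ⨾ (pf_iota B ▷ pf_pre ·₁ f) ⨾ lunit (pf_pre ·₁ f);
  pf_runit : forall (A B : X) (f : hom A B),
    map2 (runit f)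
    = pf_gamma f (id1 A) ⨾ (pf_pre ·₁ f ◁ pf_iota A) ⨾ runit (pf_pre ·₁ f)
}.
Arguments map2 {X Y} p {A B f g} α.
Arguments pf_gamma {X Y} p {A B C} g f.
Arguments pf_iota {X Y} p A.
Notation "F ·₂ α" := (map2 F α) : bicat_scope.

Definition inv_id (K : Bicat) (A B : K) (f : hom A B) : invcell f f :=
  {| fwd := id2 f; bwd := id2 f;
     fwd_bwd := vcomp_id_l (id2 f); bwd_fwd := vcomp_id_l (id2 f) |}.

Definition inv_comp (K : Bicat) (A B : K) (f g h : hom A B)
  (φ : invcell f g) (ψ : invcell g h) : invcell f h.
Proof.
refine {| fwd := φ ⨾ ψ; bwd := bwd ψ ⨾ bwd φ |}.
- by rewrite vcomp_assoc (vcompE (fwd_bwd ψ)) vcomp_id_l fwd_bwd.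
- by rewrite vcomp_assoc (vcompE (bwd_fwd φ)) vcomp_id_l bwd_fwd.
Defined.

Definition inv_map (X Y : Bicat) (F : Pseudofunctor X Y) (A B : X) (f g : hom A B)
  (φ : invcell f g) : invcell (F ·₁ f) (F ·₁ g).
Proof.
refine {| fwd := F ·₂ φ; bwd := F ·₂ bwd φ |}.
- by rewrite -map2_vcomp fwd_bwd map2_id.
- by rewrite -map2_vcomp bwd_fwd map2_id.
Defined.

Definition pf_id (X : Bicat) : Pseudofunctor X X.
Proof.
refine {| pf_pre := pre_id X; map2 := fun A B f g α => α;
  pf_gamma := fun A B C g f => inv_id (g ∘ f);
  pf_iota := fun A => inv_id (id1 A) |}; intros; cbn.
- by [].
- by [].
- by rewrite vcomp_id_l vcomp_id_r.
- by rewrite vcomp_id_l vcomp_id_r.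
- by rewrite rwhisk_id lwhisk_id !vcomp_id_l vcomp_id_r.
- by rewrite rwhisk_id !vcomp_id_l.
- by rewrite lwhisk_id !vcomp_id_l.
Defined.

Definition pf_comp (X Y Z : Bicat) (G : Pseudofunctor Y Z) (F : Pseudofunctor X Y) :
  Pseudofunctor X Z.
Proof.
refine {| pf_pre := pre_comp G F; map2 := fun A B f g α => G ·₂ (F ·₂ α);
  pf_gamma := fun A B C g f =>
    inv_comp (inv_map G (pf_gamma F g f)) (pf_gamma G (F ·₁ g) (F ·₁ f));
  pf_iota := fun A => inv_comp (inv_map G (pf_iota F A)) (pf_iota G (F A)) |};
  intros; cbn.
- by rewrite !map2_id.
- by rewrite !map2_vcomp.
- rewrite vcomp_assoc -(pf_gamma_nat_l G) -!vcomp_assoc -!map2_vcomp.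
  by rewrite pf_gamma_nat_l.
- rewrite vcomp_assoc -(pf_gamma_nat_r G) -!vcomp_assoc -!map2_vcomp.
  by rewrite pf_gamma_nat_r.
- rewrite rwhisk_vcomp lwhisk_vcomp !vcomp_assoc.
  rewrite (vcompE (eq_sym (pf_gamma_nat_l G _ _))).
  rewrite (vcompE (eq_sym (pf_gamma_nat_r G _ _))).
  rewrite !vcomp_assoc -(pf_assoc G) -!vcomp_assoc -!map2_vcomp.
  by rewrite !vcomp_assoc pf_assoc.
- rewrite (pf_lunit F) !map2_vcomp (pf_lunit G) rwhisk_vcomp !vcomp_assoc.
  by rewrite (vcompE (pf_gamma_nat_l G _ _)) !vcomp_assoc.
- rewrite (pf_runit F) !map2_vcomp (pf_runit G) lwhisk_vcomp !vcomp_assoc.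
  by rewrite (vcompE (pf_gamma_nat_r G _ _)) !vcomp_assoc.
Defined.

#[projections(primitive)]
Record ColaxData (X Y : Bicat) (K K' : prefunctor X Y) := {
  cx :> forall A : X, hom (K A) (K' A);
  cx_cell : forall (A B : X) (f : hom A B), cx B ∘ K ·₁ f ⇒ K' ·₁ f ∘ cx A
}.
Arguments cx_cell {X Y K K'} c {A B} f.

Record ColaxTrans (X Y : Bicat) (K K' : Pseudofunctor X Y) := {
  cx_data :> ColaxData K K';
  cx_nat : forall (A B : X) (f g : hom A B) (σ : f ⇒ g),
    (cx_data B ◁ K ·₂ σ) ⨾ cx_cell cx_data g
    = cx_cell cx_data f ⨾ (K' ·₂ σ ▷ cx_data A);
  cx_unit : forall A : X,
    cx_cell cx_data (id1 A) ⨾ (pf_iota K' A ▷ cx_data A)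
    = (cx_data A ◁ pf_iota K A) ⨾ runit (cx_data A) ⨾ linv (cx_data A);
  cx_comp : forall (A B C : X) (g : hom B C) (f : hom A B),
    cx_cell cx_data (g ∘ f) ⨾ (pf_gamma K' g f ▷ cx_data A)
    = (cx_data C ◁ pf_gamma K g f)
      ⨾ assoc (cx_data C) (K ·₁ g) (K ·₁ f)
      ⨾ (cx_cell cx_data g ▷ K ·₁ f)
      ⨾ ainv (K' ·₁ g) (cx_data B) (K ·₁ f)
      ⨾ (K' ·₁ g ◁ cx_cell cx_data f)
      ⨾ assoc (K' ·₁ g) (K' ·₁ f) (cx_data A)
}.

Definition is_pseudonatural (X Y : Bicat) (K K' : prefunctor X Y)
  (α : ColaxData K K') : Prop :=
  forall (A B : X) (f : hom A B), is_invertible (cx_cell α f).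

Definition cx_id (X Y : Bicat) (K : prefunctor X Y) : ColaxData K K :=
  {| cx := fun A => id1 (K A);
     cx_cell := fun A B f => lunit (K ·₁ f) ⨾ rinv (K ·₁ f) |}.

Definition cx_vcomp (X Y : Bicat) (K K' K'' : prefunctor X Y)
  (β : ColaxData K' K'') (α : ColaxData K K') : ColaxData K K'' :=
  {| cx := fun A => β A ∘ α A;
     cx_cell := fun A B f =>
       ainv (β B) (α B) (K ·₁ f)
       ⨾ (β B ◁ cx_cell α f)
       ⨾ assoc (β B) (K' ·₁ f) (α A)
       ⨾ (cx_cell β f ▷ α A)
       ⨾ ainv (K'' ·₁ f) (β A) (α A) |}.

Definition cx_lwhisk (X Y Z : Bicat) (F : Pseudofunctor Y Z) (K K' : prefunctor X Y)
  (α : ColaxData K K') : ColaxData (pre_comp F K) (pre_comp F K') :=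
  {| cx := fun A => F ·₁ α A : hom (pre_comp F K A) (pre_comp F K' A);
     cx_cell := fun A B f =>
       bwd (pf_gamma F (α B) (K ·₁ f))
       ⨾ F ·₂ cx_cell α f
       ⨾ pf_gamma F (K' ·₁ f) (α A) |}.

Definition cx_rwhisk (X Y Z : Bicat) (K K' : prefunctor Y Z) (α : ColaxData K K')
  (F : prefunctor X Y) : ColaxData (pre_comp K F) (pre_comp K' F) :=
  {| cx := fun A => α (F A) : hom (pre_comp K F A) (pre_comp K' F A);
     cx_cell := fun A B f => cx_cell α (F ·₁ f) |}.

Record Modification (X Y : Bicat) (K K' : prefunctor X Y) (α β : ColaxData K K') := {
  md :> forall A : X, α A ⇒ β A;
  md_nat : forall (A B : X) (f : hom A B),
    cx_cell α f ⨾ (K' ·₁ f ◁ md A) = (md B ▷ K ·₁ f) ⨾ cx_cell β f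
}.

Record ColaxAdjunction (X Y : Bicat) (F : Pseudofunctor X Y) (U : Pseudofunctor Y X) := {
  ca_unit : ColaxTrans (pf_id X) (pf_comp U F);
  ca_counit : ColaxTrans (pf_comp F U) (pf_id Y);
  ca_Psi : @Modification X Y F F
    (cx_vcomp (cx_rwhisk ca_counit F) (cx_lwhisk F ca_unit)) (cx_id F);
  ca_Phi : @Modification Y X U U
    (cx_id U) (cx_vcomp (cx_lwhisk U ca_counit) (cx_rwhisk ca_unit U));
  ca_swallowtail_unit : forall A : X,
    let η := ca_unit in let ε := ca_counit in
    let UΨ_A : U ·₁ ε (F A) ∘ U ·₁ (F ·₁ η A) ⇒ id1 (U (F A)) :=
      bwd (pf_gamma U (ε (F A)) (F ·₁ η A)) ⨾ U ·₂ ca_Psi A ⨾ pf_iota U (F A) in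
    linv (η A)
    ⨾ (ca_Phi (F A) ▷ η A)
    ⨾ ainv (U ·₁ ε (F A)) (η (U (F A))) (η A)
    ⨾ (U ·₁ ε (F A) ◁ cx_cell η (η A))
    ⨾ assoc (U ·₁ ε (F A)) (U ·₁ (F ·₁ η A)) (η A)
    ⨾ (UΨ_A ▷ η A)
    ⨾ lunit (η A)
    = id2 (η A);
  ca_swallowtail_counit : forall B : Y,
    let η := ca_unit in let ε := ca_counit in
    let FΦ_B : id1 (F (U B)) ⇒ F ·₁ (U ·₁ ε B) ∘ F ·₁ η (U B) :=
      bwd (pf_iota F (U B)) ⨾ F ·₂ ca_Phi B ⨾ pf_gamma F (U ·₁ ε B) (η (U B)) in
    rinv (ε B)
    ⨾ (ε B ◁ FΦ_B)
    ⨾ assoc (ε B) (F ·₁ (U ·₁ ε B)) (F ·₁ η (U B))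
    ⨾ (cx_cell ε (ε B) ▷ F ·₁ η (U B))
    ⨾ ainv (ε B) (ε (F (U B))) (F ·₁ η (U B))
    ⨾ (ε B ◁ ca_Psi (U B))
    ⨾ runit (ε B)
    = id2 (ε B)
}.

Record Biadjunction (X Y : Bicat) (F : Pseudofunctor X Y) (U : Pseudofunctor Y X) := {
  ba_adj :> ColaxAdjunction F U;
  ba_unit_pseudo : is_pseudonatural (ca_unit ba_adj);
  ba_counit_pseudo : is_pseudonatural (ca_counit ba_adj);
  ba_Psi_inv : forall A : X, is_invertible (ca_Psi ba_adj A);
  ba_Phi_inv : forall B : Y, is_invertible (ca_Phi ba_adj B)
}.

Section LeftKan.
Variable K : Bicat.

Definition is_lan (A B C : K) (y : hom A B) (f : hom A C) (l : hom B C)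
  (η : f ⇒ l ∘ y) : Prop :=
  forall (k : hom B C) (θ : f ⇒ k ∘ y), exists! σ : l ⇒ k, η ⨾ (σ ▷ y) = θ.

Definition preserves_lan (A B C E : K) (g : hom C E) (y : hom A B) (f : hom A C)
  (l : hom B C) (η : f ⇒ l ∘ y) : Prop :=
  @is_lan A B E y (g ∘ f) (g ∘ l) ((g ◁ η) ⨾ assoc g l y).

Definition lan_desc (A B C : K) (y : hom A B) (f : hom A C) (l : hom B C)
  (η : f ⇒ l ∘ y) (H : is_lan η) (k : hom B C) (θ : f ⇒ k ∘ y) : l ⇒ k :=
  proj1_sig (constructive_indefinite_description _ (H k θ)).

Lemma lan_descE (A B C : K) (y : hom A B) (f : hom A C) (l : hom B C)
  (η : f ⇒ l ∘ y) (H : is_lan η) (k : hom B C) (θ : f ⇒ k ∘ y) :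
  η ⨾ (lan_desc H θ ▷ y) = θ.
Proof.
by rewrite /lan_desc; case: constructive_indefinite_description => σ [].
Qed.

Lemma lan_eq (A B C : K) (y : hom A B) (f : hom A C) (l : hom B C)
  (η : f ⇒ l ∘ y) (H : is_lan η) (k : hom B C) (σ τ : l ⇒ k) :
  η ⨾ (σ ▷ y) = η ⨾ (τ ▷ y) -> σ = τ.
Proof.
move=> e; case: (H k (η ⨾ (τ ▷ y))) => ρ [_ u].
by rewrite -(u σ e) -(u τ (eq_refl _)).
Qed.

Lemma lan_precomp (A B C : K) (y : hom A B) (f f' : hom A C) (l : hom B C)
  (η : f ⇒ l ∘ y) (φ : invcell f' f) : is_lan η -> is_lan (φ ⨾ η).
Proof.
move=> H k θ; exists (lan_desc H (bwd φ ⨾ θ)); split.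
- by rewrite vcomp_assoc lan_descE (vcompE (fwd_bwd φ)) vcomp_id_l.
- move=> τ e; apply: (lan_eq H).
  by rewrite lan_descE -e !vcomp_assoc (vcompE (bwd_fwd φ)) vcomp_id_l.
Qed.

Lemma lan_postcomp (A B C : K) (y : hom A B) (f : hom A C) (l l' : hom B C)
  (η : f ⇒ l ∘ y) (ψ : invcell l l') : is_lan η -> is_lan (η ⨾ (ψ ▷ y)).
Proof.
move=> H k θ; exists (bwd ψ ⨾ lan_desc H θ); split.
- rewrite vcomp_assoc -rwhisk_vcomp.
  by rewrite -vcomp_assoc fwd_bwd vcomp_id_l lan_descE.
- move=> τ e; apply: (inv_cancel_l (bwd_fwd ψ)); apply: (lan_eq H).
  rewrite -vcomp_assoc fwd_bwd vcomp_id_l lan_descE -e.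
  by rewrite rwhisk_vcomp vcomp_assoc.
Qed.

Definition lan_iso (A B C : K) (y : hom A B) (f : hom A C) (l l' : hom B C)
  (η : f ⇒ l ∘ y) (H : is_lan η) (η' : f ⇒ l' ∘ y) (H' : is_lan η') : invcell l l'.
Proof.
refine {| fwd := lan_desc H η'; bwd := lan_desc H' η |}.
- apply: (lan_eq H).
  by rewrite rwhisk_vcomp (vcompE (lan_descE _ _)) lan_descE rwhisk_id vcomp_id_r.
- apply: (lan_eq H').
  by rewrite rwhisk_vcomp (vcompE (lan_descE _ _)) lan_descE rwhisk_id vcomp_id_r.
Defined.

Lemma id_preserves_lan (A B C : K) (y : hom A B) (f : hom A C) (l : hom B C)
  (η : f ⇒ l ∘ y) : is_lan η -> preserves_lan (id1 C) η.
Proof.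
move=> H.
have e : (id1 C ◁ η) ⨾ assoc (id1 C) l y = (lunit f ⨾ η) ⨾ (linv l ▷ y).
  rewrite -lunit_nat -lunit_comp !vcomp_assoc -rwhisk_vcomp lunit_linv.
  by rewrite rwhisk_id vcomp_id_r.
rewrite /preserves_lan e.
pose φ := Build_invcell (lunit_linv f) (linv_lunit f).
pose ψ := Build_invcell (linv_lunit l) (lunit_linv l).
exact: (lan_postcomp ψ (lan_precomp φ H)).
Qed.

(* [ζ] is an auxiliary left Kan extension of [h ∘ f] that [k] preserves. *)
Lemma comp_preserves_lan (A B C E Z : K) (k : hom E Z) (h : hom C E)
  (y : hom A B) (f : hom A C) (l : hom B C) (η : f ⇒ l ∘ y)
  (m : hom B E) (ζ : h ∘ f ⇒ m ∘ y) :
  is_lan ζ -> preserves_lan h η -> preserves_lan k ζ -> preserves_lan (k ∘ h) η.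
Proof.
move=> Hζ Hh Hk.
pose ρ := lan_iso Hζ Hh.
have eρ : ζ ⨾ (ρ ▷ y) = (h ◁ η) ⨾ assoc h l y by exact: lan_descE.
pose φ := Build_invcell (ainv_assoc k h f) (assoc_ainv k h f).
have [kr1 kr2] : (k ◁ ρ) ⨾ (k ◁ bwd ρ) = id2 _ /\ (k ◁ bwd ρ) ⨾ (k ◁ ρ) = id2 _.
  by rewrite -!lwhisk_vcomp fwd_bwd bwd_fwd !lwhisk_id.
pose ψ := inv_comp (Build_invcell kr1 kr2)
            (Build_invcell (assoc_ainv k h l) (ainv_assoc k h l)).
have e : ((k ∘ h) ◁ η) ⨾ assoc (k ∘ h) l y
         = (φ ⨾ (k ◁ ζ) ⨾ assoc k m y) ⨾ (ψ ▷ y).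
  rewrite /= rwhisk_vcomp !vcomp_assoc.
  rewrite (vcompE (eq_sym (assoc_nat_m _ _ _))) !vcomp_assoc.
  rewrite (vcompE (eq_sym (lwhisk_vcomp _ _ _))) eρ lwhisk_vcomp !vcomp_assoc.
  rewrite -pentagon (vcompE (assoc_nat_r _ _ _)) !vcomp_assoc.
  by rewrite (vcompE (ainv_assoc _ _ _)) vcomp_id_l.
rewrite /preserves_lan e.
exact: (lan_postcomp ψ (lan_precomp φ Hk)).
Qed.

End LeftKan.

Record LeftKanPseudomonad (K : TwoCat) := {
  mon_ob :> K -> K;
  mon_y : forall A : K, hom A (mon_ob A);
  mon_ext : forall (A B : K) (f : hom A (mon_ob B)), hom (mon_ob A) (mon_ob B);
  mon_cell : forall (A B : K) (f : hom A (mon_ob B)), invcell f (mon_ext f ∘ mon_y A);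
  mon_lan : forall (A B : K) (f : hom A (mon_ob B)), is_lan (mon_cell f);
  (* [linv (y_A)] : y_A ⇒ 1 ∘ y_A is the identity 2-cell. *)
  mon_lan_y : forall A : K, is_lan (linv (mon_y A));
  mon_preserves : forall (A B C : K) (g : hom B (mon_ob C)) (f : hom A (mon_ob B)),
    preserves_lan (mon_ext g) (mon_cell f)
}.
Arguments mon_y {K} l A.
Arguments mon_lan_y {K} l A.
Arguments mon_ext {K} l {A B} f.
Arguments mon_cell {K} l {A B} f.
Arguments mon_lan {K} l {A B} f.
Arguments mon_preserves {K} l {A B C} g f.

Section Algebras.
Variables (K : TwoCat) (D : LeftKanPseudomonad K).

Record PsAlgebra := {
  alg_ob :> K;
  alg_ext : forall B : K, hom B alg_ob -> hom (D B) alg_ob;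
  alg_cell : forall (B : K) (f : hom B alg_ob), invcell f (alg_ext f ∘ mon_y D B);
  alg_lan : forall (B : K) (f : hom B alg_ob), is_lan (alg_cell f);
  alg_preserves : forall (A B : K) (g : hom B alg_ob) (f : hom A (D B)),
    preserves_lan (alg_ext g) (mon_cell D f)
}.
Arguments alg_ext p {B} f.
Arguments alg_cell p {B} f.
Arguments alg_lan p {B} f.
Arguments alg_preserves p {A B} g f.

Definition is_pseudomorphism (C X : PsAlgebra) (h : hom (alg_ob C) (alg_ob X)) : Prop :=
  forall (B : K) (f : hom B (alg_ob C)), preserves_lan h (alg_cell C f).

Definition pseudomorphism (C X : PsAlgebra) : Type :=
  {h : hom (alg_ob C) (alg_ob X) | is_pseudomorphism h}.

Lemma id_pseudomorphism (C : PsAlgebra) : is_pseudomorphism (id1 (alg_ob C)).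
Proof. move=> B f; exact (id_preserves_lan (alg_lan C f)). Qed.

Lemma comp_pseudomorphism (C X Z : PsAlgebra) (k : hom (alg_ob X) (alg_ob Z))
  (h : hom (alg_ob C) (alg_ob X)) :
  is_pseudomorphism k -> is_pseudomorphism h -> @is_pseudomorphism C Z (k ∘ h).
Proof.
move=> Hk Hh B f.
exact (comp_preserves_lan (alg_lan X (h ∘ f)) (Hh B f) (Hk B (h ∘ f))).
Qed.

Definition PsAlg_bicat : Bicat.
Proof.
refine {|
  ob := PsAlgebra;
  hom := pseudomorphism;
  cell := fun C X h k => proj1_sig h ⇒ proj1_sig k;
  id1 := fun C => exist _ (id1 (alg_ob C)) (@id_pseudomorphism C);
  comp1 := fun C X Z k h => exist _ (proj1_sig k ∘ proj1_sig h)
             (comp_pseudomorphism (proj2_sig k) (proj2_sig h));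
  id2 := fun C X h => id2 (proj1_sig h);
  vcomp := fun C X f g h α β => α ⨾ β;
  lwhisk := fun C X Z g f f' α => proj1_sig g ◁ α;
  rwhisk := fun C X Z g g' β f => β ▷ proj1_sig f;
  assoc := fun C X Z W h g f => assoc (proj1_sig h) (proj1_sig g) (proj1_sig f);
  ainv := fun C X Z W h g f => ainv (proj1_sig h) (proj1_sig g) (proj1_sig f);
  lunit := fun C X f => lunit (proj1_sig f);
  linv := fun C X f => linv (proj1_sig f);
  runit := fun C X f => runit (proj1_sig f);
  rinv := fun C X f => rinv (proj1_sig f) |}; intros; cbn.
- exact: vcomp_id_l.
- exact: vcomp_id_r.
- exact: vcomp_assoc.
- exact: lwhisk_id.
- exact: lwhisk_vcomp.
- exact: rwhisk_id.
- exact: rwhisk_vcomp.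
- exact: interchange.
- exact: assoc_ainv.
- exact: ainv_assoc.
- exact: lunit_linv.
- exact: linv_lunit.
- exact: runit_rinv.
- exact: rinv_runit.
- exact: lunit_nat.
- exact: runit_nat.
- exact: assoc_nat_r.
- exact: assoc_nat_m.
- exact: assoc_nat_l.
- exact: triangle.
- exact: pentagon.
Defined.

Lemma PsAlg_cell_of_eq (C X : PsAlg_bicat) (h k : hom C X)
  (e : proj1_sig h = proj1_sig k) :
  exists e' : h = k, cell_of_eq e = cell_of_eq e' :> (proj1_sig h ⇒ proj1_sig k).
Proof.
case: h k e => [h Hh] [k Hk] /= e; destruct e.
by rewrite (proof_irrelevance _ Hk Hh); exists (eq_refl _).
Qed.

Lemma PsAlg_strict : strict PsAlg_bicat.
Proof.
split; intros.
- case: (strict_lunit (twocat_strict K) (proj1_sig f)) => e Ee.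
  case: (@PsAlg_cell_of_eq _ _ (id1 B ∘ f) f e) => e' Ee'.
  by exists e'; rewrite -Ee'.
- case: (strict_runit (twocat_strict K) (proj1_sig f)) => e Ee.
  case: (@PsAlg_cell_of_eq _ _ (f ∘ id1 A) f e) => e' Ee'.
  by exists e'; rewrite -Ee'.
- case: (strict_assoc (twocat_strict K) (proj1_sig h) (proj1_sig g) (proj1_sig f)) => e Ee.
  case: (@PsAlg_cell_of_eq _ _ (h ∘ (g ∘ f)) ((h ∘ g) ∘ f) e) => e' Ee'.
  by exists e'; rewrite -Ee'.
Qed.

Definition PsAlg : TwoCat := {| twocat_strict := PsAlg_strict |}.

Definition free_alg (A : K) : PsAlg := {|
  alg_ob := D A;
  alg_ext := fun B f => mon_ext D f;
  alg_cell := fun B f => mon_cell D f;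
  alg_lan := fun B f => mon_lan D f;
  alg_preserves := fun B C g f => mon_preserves D g f |}.

(* The objects are the free algebras, each named by the object it is free on. *)
Definition Kleisli : TwoCat := full_sub free_alg.

Definition ext_mor (A B : K) (f : hom A (D B)) : @hom Kleisli A B :=
  exist (@is_pseudomorphism (free_alg A) (free_alg B)) (mon_ext D f)
    (fun C g => mon_preserves D f g).

End Algebras.

(* The pseudofunctor J_D.  Its action on 2-cells and its coherence cells are the
   unique 2-cells out of the left Kan extension (y_B f)^D that are compatible
   with the extension cells, as stated in [J_map2E], [J_gammaE], [J_iotaE]. *)
Section KleisliInclusion.
Variables (K : TwoCat) (D : LeftKanPseudomonad K).

Notation y := (mon_y D).

Definition J_map1 (A B : K) (f : hom A B) : hom (D A) (D B) := mon_ext D (y B ∘ f).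

Definition J_cell (A B : K) (f : hom A B) : invcell (y B ∘ f) (J_map1 f ∘ y A) :=
  mon_cell D (y B ∘ f).

Definition J_lan (A B : K) (f : hom A B) : is_lan (J_cell f) := mon_lan D (y B ∘ f).
Arguments J_lan {A B} f.

Definition J_map2 (A B : K) (f g : hom A B) (α : f ⇒ g) : J_map1 f ⇒ J_map1 g :=
  lan_desc (J_lan f) ((y B ◁ α) ⨾ J_cell g).

Lemma J_map2E (A B : K) (f g : hom A B) (α : f ⇒ g) :
  J_cell f ⨾ (J_map2 α ▷ y A) = (y B ◁ α) ⨾ J_cell g.
Proof. exact: lan_descE. Qed.

Definition J_id_lan (A : K) : is_lan (runit (y A) ⨾ linv (y A)) :=
  lan_precomp (Build_invcell (runit_rinv (y A)) (rinv_runit (y A)))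
    (mon_lan_y D A).
Arguments J_id_lan A : clear implicits.

Definition J_iota (A : K) : invcell (J_map1 (id1 A)) (id1 (D A)) :=
  lan_iso (J_lan (id1 A)) (J_id_lan A).

Lemma J_iotaE (A : K) :
  J_cell (id1 A) ⨾ (J_iota A ▷ y A) = runit (y A) ⨾ linv (y A).
Proof. exact: lan_descE. Qed.

Definition J_comp_iso (A B C : K) (g : hom B C) (f : hom A B) :
  invcell (y C ∘ (g ∘ f)) (J_map1 g ∘ (y B ∘ f)).
Proof.
refine {|
  fwd := assoc (y C) g f ⨾ (J_cell g ▷ f) ⨾ ainv (J_map1 g) (y B) f;
  bwd := assoc (J_map1 g) (y B) f ⨾ (bwd (J_cell g) ▷ f) ⨾ ainv (y C) g f |}.
- rewrite !vcomp_assoc (vcompE (ainv_assoc _ _ _)) vcomp_id_l.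
  rewrite (vcompE (eq_sym (rwhisk_vcomp _ _ _))) fwd_bwd rwhisk_id vcomp_id_l.
  exact: assoc_ainv.
- rewrite !vcomp_assoc (vcompE (ainv_assoc _ _ _)) vcomp_id_l.
  rewrite (vcompE (eq_sym (rwhisk_vcomp _ _ _))) bwd_fwd rwhisk_id vcomp_id_l.
  exact: assoc_ainv.
Defined.

Definition J_comp_cell (A B C : K) (g : hom B C) (f : hom A B) :
  y C ∘ (g ∘ f) ⇒ (J_map1 g ∘ J_map1 f) ∘ y A :=
  J_comp_iso g f ⨾ (J_map1 g ◁ J_cell f) ⨾ assoc (J_map1 g) (J_map1 f) (y A).

Definition J_comp_lan (A B C : K) (g : hom B C) (f : hom A B) :
  is_lan (J_comp_cell g f) :=
  lan_precomp (J_comp_iso g f) (mon_preserves D (y C ∘ g) (y B ∘ f)).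
Arguments J_comp_lan {A B C} g f.

Definition J_gamma (A B C : K) (g : hom B C) (f : hom A B) :
  invcell (J_map1 (g ∘ f)) (J_map1 g ∘ J_map1 f) :=
  lan_iso (J_lan (g ∘ f)) (J_comp_lan g f).

Lemma J_gammaE (A B C : K) (g : hom B C) (f : hom A B) :
  J_cell (g ∘ f) ⨾ (J_gamma g f ▷ y A)
  = assoc (y C) g f
    ⨾ (J_cell g ▷ f)
    ⨾ ainv (J_map1 g) (y B) f
    ⨾ (J_map1 g ◁ J_cell f)
    ⨾ assoc (J_map1 g) (J_map1 f) (y A).
Proof.
by rewrite [LHS]lan_descE /J_comp_cell /= !vcomp_assoc.
Qed.

Lemma J_map2_id (A B : K) (f : hom A B) : J_map2 (id2 f) = id2 (J_map1 f).
Proof.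
apply: (lan_eq (J_lan f)).
by rewrite J_map2E lwhisk_id rwhisk_id vcomp_id_l vcomp_id_r.
Qed.

Lemma J_map2_vcomp (A B : K) (f g h : hom A B) (α : f ⇒ g) (β : g ⇒ h) :
  J_map2 (α ⨾ β) = J_map2 α ⨾ J_map2 β.
Proof.
apply: (lan_eq (J_lan f)).
rewrite J_map2E lwhisk_vcomp rwhisk_vcomp (vcompE (J_map2E _)).
by rewrite !vcomp_assoc J_map2E.
Qed.

Lemma J_gamma_nat_l (A B C : K) (g g' : hom B C) (β : g ⇒ g') (f : hom A B) :
  J_map2 (β ▷ f) ⨾ J_gamma g' f = J_gamma g f ⨾ (J_map2 β ▷ J_map1 f).
Proof.
apply: (lan_eq (J_lan (g ∘ f))).
rewrite !rwhisk_vcomp (vcompE (J_map2E _)) (vcompE (J_gammaE _ _)) !vcomp_assoc J_gammaE.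
rewrite -assoc_nat_l (vcompE (eq_sym (interchange _ _))) !vcomp_assoc.
rewrite (vcompE (ainv_nat_l _ _ _)) !vcomp_assoc.
rewrite (vcompE (eq_sym (rwhisk_vcomp _ _ _))) J_map2E rwhisk_vcomp !vcomp_assoc.
by rewrite (vcompE (assoc_nat_m _ _ _)) !vcomp_assoc.
Qed.

Lemma J_gamma_nat_r (A B C : K) (g : hom B C) (f f' : hom A B) (α : f ⇒ f') :
  J_map2 (g ◁ α) ⨾ J_gamma g f' = J_gamma g f ⨾ (J_map1 g ◁ J_map2 α).
Proof.
apply: (lan_eq (J_lan (g ∘ f))).
rewrite !rwhisk_vcomp (vcompE (J_map2E _)) (vcompE (J_gammaE _ _)) !vcomp_assoc J_gammaE.
rewrite -assoc_nat_m (vcompE (eq_sym (lwhisk_vcomp _ _ _))) J_map2E lwhisk_vcomp.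
rewrite !vcomp_assoc (vcompE (ainv_nat_r _ _ _)) !vcomp_assoc.
rewrite (vcompE (interchange _ _)) !vcomp_assoc.
by rewrite (vcompE (assoc_nat_r _ _ _)) !vcomp_assoc.
Qed.

Lemma J_assoc (A B C E : K) (h : hom C E) (g : hom B C) (f : hom A B) :
  J_map2 (assoc h g f) ⨾ J_gamma (h ∘ g) f ⨾ (J_gamma h g ▷ J_map1 f)
  = J_gamma h (g ∘ f) ⨾ (J_map1 h ◁ J_gamma g f)
    ⨾ assoc (J_map1 h) (J_map1 g) (J_map1 f).
Proof.
apply: (lan_eq (J_lan (h ∘ (g ∘ f)))).
rewrite !rwhisk_vcomp (vcompE (J_map2E _)) !vcomp_assoc.
rewrite (vcompE (J_gammaE _ _)) (vcompE (J_gammaE h (g ∘ f))) !vcomp_assoc.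
rewrite -assoc_nat_l (vcompE (eq_sym (interchange _ _))) !vcomp_assoc.
rewrite (vcompE (ainv_nat_l _ _ _)) !vcomp_assoc.
rewrite (vcompE (eq_sym (rwhisk_vcomp _ _ _))) J_gammaE !rwhisk_vcomp !vcomp_assoc.
rewrite (vcompE (eq_sym (assoc_nat_m _ _ _))) !vcomp_assoc.
rewrite (vcompE (eq_sym (lwhisk_vcomp _ _ _))) J_gammaE !lwhisk_vcomp !vcomp_assoc.
rewrite -pentagon (vcompE (assoc_nat_r _ _ _)) !vcomp_assoc.
rewrite (vcompE3 (eq_sym (pentagon _ _ _ _))) !vcomp_assoc.
rewrite (vcompE (eq_sym (assoc_nat_l _ _ _))) !vcomp_assoc.
rewrite (vcompE (pentagon_ainv_rwhisk _ _ _ _)) !vcomp_assoc.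
rewrite (vcompE (eq_sym (assoc_nat_m _ _ _))) !vcomp_assoc.
by rewrite (vcompE3 (pentagon_ainv_lwhisk _ _ _ _)) !vcomp_assoc.
Qed.

Lemma J_lunit (A B : K) (f : hom A B) :
  J_map2 (lunit f)
  = J_gamma (id1 B) f ⨾ (J_iota B ▷ J_map1 f) ⨾ lunit (J_map1 f).
Proof.
apply: (lan_eq (J_lan (id1 B ∘ f))).
rewrite J_map2E !rwhisk_vcomp (vcompE (J_gammaE _ _)) !vcomp_assoc.
rewrite (vcompE (eq_sym (assoc_nat_l _ _ _))) !vcomp_assoc lunit_comp.
rewrite (vcompE (eq_sym (interchange _ _))) !vcomp_assoc lunit_nat.
rewrite (vcompE (ainv_nat_l _ _ _)) !vcomp_assoc.
rewrite (vcompE (eq_sym (rwhisk_vcomp _ _ _))) J_iotaE rwhisk_vcomp !vcomp_assoc.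
rewrite (vcompE (triangle _ _)); congr vcomp.
rewrite -lunit_comp !vcomp_assoc (vcompE (ainv_assoc _ _ _)) vcomp_id_l.
by rewrite (vcompE (eq_sym (rwhisk_vcomp _ _ _))) linv_lunit rwhisk_id vcomp_id_l.
Qed.

Lemma J_runit (A B : K) (f : hom A B) :
  J_map2 (runit f)
  = J_gamma f (id1 A) ⨾ (J_map1 f ◁ J_iota A) ⨾ runit (J_map1 f).
Proof.
apply: (lan_eq (J_lan (f ∘ id1 A))).
rewrite J_map2E !rwhisk_vcomp (vcompE (J_gammaE _ _)) !vcomp_assoc.
rewrite (vcompE (eq_sym (assoc_nat_m _ _ _))) !vcomp_assoc triangle.
rewrite (vcompE (eq_sym (lwhisk_vcomp _ _ _))) J_iotaE lwhisk_vcomp !vcomp_assoc.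
rewrite -lwhisk_vcomp linv_lunit lwhisk_id vcomp_id_r.
rewrite -(runit_comp (J_map1 f)) (vcompE (ainv_assoc _ _ _)) vcomp_id_l.
by rewrite runit_nat (vcompE (runit_comp _ _)).
Qed.

Definition Kleisli_incl : Pseudofunctor K (Kleisli D).
Proof.
refine (@Build_Pseudofunctor K (Kleisli D)
  {| map0 := fun A : K => A : Kleisli D;
     map1 := fun (A B : K) (f : hom A B) => ext_mor (y B ∘ f) |}
  (fun (A B : K) (f g : hom A B) (α : f ⇒ g) => J_map2 α)
  (fun (A B C : K) (g : hom B C) (f : hom A B) => @Build_invcell (Kleisli D) A C
     (ext_mor (y C ∘ (g ∘ f))) (ext_mor (y C ∘ g) ∘ ext_mor (y B ∘ f))
     (J_gamma g f) (bwd (J_gamma g f)) (fwd_bwd (J_gamma g f)) (bwd_fwd (J_gamma g f)))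
  (fun A : K => @Build_invcell (Kleisli D) A A (ext_mor (y A ∘ id1 A)) (id1 (A : Kleisli D))
     (J_iota A) (bwd (J_iota A)) (fwd_bwd (J_iota A)) (bwd_fwd (J_iota A)))
  _ _ _ _ _ _ _).
- exact J_map2_id.
- exact J_map2_vcomp.
- exact J_gamma_nat_l.
- exact J_gamma_nat_r.
- exact J_assoc.
- exact J_lunit.
- exact J_runit.
Defined.

End KleisliInclusion.

(* Main.v *)
From Corelib Require Import ssreflect.
From Stdlib Require Import ClassicalEpsilon.
Require Import Defs.

Set Implicit Arguments.
Unset Strict Implicit.
Unset Printing Implicit Defensive.

(** Write [J : K -> M] for the inclusion into the Kleisli 2-category, [U : M -> K]
    for the functor that forgets the algebra structure, [y] for the unit of the
    pseudomonad, [m_A : J U A -> A] for the extension of the identity of [U A], and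
    [(η, ε, Ψ, Φ)] for the given biadjunction between [G J] and [H].

    The new adjunction has the same counit [ε] and the same triangle cells [Ψ]; its
    unit at [J a] is [J η_a], and its other triangle cell is [J Φ].  Every axiom that
    mentions the unit only through its components and its cells at 1-cells [J f] is
    the image of an axiom of [(η, ε, Ψ, Φ)] under [J] and holds because a
    pseudofunctor preserves pasting equations (map_modification_square,
    map_swallowtail).  The axiom for [Φ] and both swallowtail identities are of that
    kind.  Two things remain: to extend the unit from the
    1-cells [J f] to all 1-cells of [M], and to show that [Ψ] is natural against the
    extension.

    The unit.  Transposing [m] along the adjunction gives the 1-cells
    [θ_A = H G m_A ∘ η_(U A) : U A -> H G A], and these form a colax transformation,
    being pasted from two colax transformations (transpose).  Since [m] is inverse to
    [J y] on one side, [θ y] is isomorphic to [η].  Now [J η_a] is the left Kan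
    extension of [y η_a] along [y_a], so that the isomorphism of [y θ y] with [y η]
    corresponds to a 2-cell [χ : J η => y θ] (comparison).  It becomes invertible
    after restriction along [y].  Every 1-cell of [M] out of [J a] is a left Kan
    extension along [y_a], whence 2-cells [h => k ∘ J η_a] of [M] correspond, by
    composition with [χ], to 2-cells [U h => U k ∘ y θ] of [K] (comparison_univ):
    [J η] is the coreflection of [y θ] into [M].  Everything in sight is determined
    by its composite with [χ], so the colax structure of [y θ] descends to one on
    [J η] (lift_colax).  On a 1-cell [J f] it is the image of the cell of [η] at [f]
    (lifted_unit_J).  The cell [χ] itself need not be invertible, which is why the
    result is only colax even though [η] is pseudonatural.

    Naturality of [Ψ].  It holds at [J f] by transport.  In [M] the 1-cell [J y_a] is
    left adjoint to [m] with invertible unit: this is lax idempotency (adj_triangle).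
    A modification that is natural at the left adjoint [J y] and at the composite
    [m ∘ J y], which is isomorphic to the identity, is natural at the right adjoint
    [m] (natural_right_adjoint).  Finally every 1-cell [f : J a -> C] is a retract of
    [m_C ∘ J (f y_a)] (restrict_retract), and naturality passes to composites and
    retracts (natural_from_J).

    Pasting equations are tested on generalized elements.  A 2-cell between
    composites of 1-cells is determined by its whiskerings with all [x] into the
    source, and such a whiskering can be written between composites that are nested
    to the right, where all associators and unitors become identities.  The same
    device, applied to the image of a pasting under a pseudofunctor, absorbs the
    structure isomorphisms of that pseudofunctor. *)

(** * Pasting diagrams in strict form *)

Section Syntax.
Variable X : Bicat.

(** Paths keep the bracketing and the identities of a composite, as 1-cells of the
    bicategory itself cannot be inspected; a 1-cell and its path are related by [ev]. *)
Inductive path : X -> X -> Type :=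
| pid A : path A A
| pat A B (f : hom A B) : path A B
| pco A B C (s : path B C) (t : path A B) : path A C.

Fixpoint ev A B (t : path A B) : hom A B :=
  match t with
  | pid A => id1 A
  | pat f => f
  | pco s t => ev s ∘ ev t
  end.

(** The last six constructors are the constraint cells: these are the ones that are
    interpreted by identities on elements. *)
Inductive pasting : forall A B, path A B -> path A B -> Type :=
| pst_cell A B (s t : path A B) (α : ev s ⇒ ev t) : pasting s t
| pst_id A B (s : path A B) : pasting s s
| pst_vcomp A B (s t r : path A B) : pasting s t -> pasting t r -> pasting s r
| pst_lwhisk A B C (r : path B C) (s t : path A B) : pasting s t -> pasting (pco r s) (pco r t)
| pst_rwhisk A B C (s t : path B C) : pasting s t -> forall r : path A B, pasting (pco s r) (pco t r)
| pst_assoc A B C E (r : path C E) (s : path B C) (t : path A B) :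
    pasting (pco r (pco s t)) (pco (pco r s) t)
| pst_ainv A B C E (r : path C E) (s : path B C) (t : path A B) :
    pasting (pco (pco r s) t) (pco r (pco s t))
| pst_lunit A B (s : path A B) : pasting (pco (pid B) s) s
| pst_linv A B (s : path A B) : pasting s (pco (pid B) s)
| pst_runit A B (s : path A B) : pasting (pco s (pid A)) s
| pst_rinv A B (s : path A B) : pasting s (pco s (pid A)).

Fixpoint ev2 A B (s t : path A B) (e : pasting s t) : ev s ⇒ ev t :=
  match e in @pasting A B s t return ev s ⇒ ev t with
  | pst_cell α => α
  | pst_id s => id2 (ev s)
  | pst_vcomp a b => ev2 a ⨾ ev2 b
  | pst_lwhisk r a => ev r ◁ ev2 a
  | pst_rwhisk a r => ev2 a ▷ ev r
  | pst_assoc r s t => assoc (ev r) (ev s) (ev t)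
  | pst_ainv r s t => ainv (ev r) (ev s) (ev t)
  | pst_lunit s => lunit (ev s)
  | pst_linv s => linv (ev s)
  | pst_runit s => runit (ev s)
  | pst_rinv s => rinv (ev s)
  end.
End Syntax.
Arguments pid {X} A.

Section BasicInv.
Variable K : Bicat.
Definition inv_lwhisk (A B C : K) (g : hom B C) (f f' : hom A B) (φ : invcell f f') :
  invcell (g ∘ f) (g ∘ f').
Proof.
refine {| fwd := g ◁ φ; bwd := g ◁ bwd φ |}.
- by rewrite -lwhisk_vcomp fwd_bwd lwhisk_id.
- by rewrite -lwhisk_vcomp bwd_fwd lwhisk_id.
Defined.
Definition inv_rwhisk (A B C : K) (g g' : hom B C) (φ : invcell g g') (f : hom A B) :
  invcell (g ∘ f) (g' ∘ f).
Proof.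
refine {| fwd := φ ▷ f; bwd := bwd φ ▷ f |}.
- by rewrite -rwhisk_vcomp fwd_bwd rwhisk_id.
- by rewrite -rwhisk_vcomp bwd_fwd rwhisk_id.
Defined.
Definition inv_ainv (A B C E : K) (h : hom C E) (g : hom B C) (f : hom A B) :
  invcell ((h ∘ g) ∘ f) (h ∘ (g ∘ f)) :=
  Build_invcell (ainv_assoc h g f) (assoc_ainv h g f).
Definition inv_lunit (A B : K) (f : hom A B) : invcell (id1 B ∘ f) f :=
  Build_invcell (lunit_linv f) (linv_lunit f).
Lemma fwdK (A B : K) (f g h : hom A B) (φ : invcell f g) (α : f ⇒ h) : fwd φ ⨾ bwd φ ⨾ α = α.
Proof. by rewrite (vcompE (fwd_bwd _)) vcomp_id_l. Qed.
Lemma fwd_inj (A B : K) (f g h : hom A B) (φ : invcell f g) (α β : g ⇒ h) :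
  fwd φ ⨾ α = fwd φ ⨾ β -> α = β.
Proof. exact: (inv_cancel_l (bwd_fwd φ)). Qed.
Lemma fwd_injr (A B : K) (f g h : hom A B) (φ : invcell g h) (α β : f ⇒ g) :
  α ⨾ fwd φ = β ⨾ fwd φ -> α = β.
Proof. exact: (inv_cancel_r (fwd_bwd φ)). Qed.
End BasicInv.

Section Semantics.
Variables (X Y : Bicat) (F : Pseudofunctor X Y).

(** The image of a path under [F], applied to an element [x] of [F A], nested to the
    right whatever the bracketing of the path is, with no identity 1-cell inserted. *)
Fixpoint act A B (t : path A B) Z : hom Z (F A) -> hom Z (F B) :=
  match t with
  | pid A => fun x => x
  | pat f => fun x => F ·₁ f ∘ x
  | pco s t => fun x => act s (act t x)
  end.

Fixpoint act2 A B (t : path A B) Z : forall x x' : hom Z (F A), x ⇒ x' -> act t x ⇒ act t x' :=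
  match t with
  | pid A => fun x x' ξ => ξ
  | pat f => fun x x' ξ => F ·₁ f ◁ ξ
  | pco s t => fun x x' ξ => act2 s (act2 t ξ)
  end.

(** The structure isomorphisms of [F] at an element, rebracketed so that their target
    is nested to the right. *)
Definition gamma_el (A B C : X) (g : hom B C) (f : hom A B) Z (x : hom Z (F A)) :
  invcell (F ·₁ (g ∘ f) ∘ x) (F ·₁ g ∘ (F ·₁ f ∘ x)) :=
  inv_comp (inv_rwhisk (pf_gamma F g f) x) (inv_ainv _ _ _).
Definition iota_el (A : X) Z (x : hom Z (F A)) : invcell (F ·₁ id1 A ∘ x) x :=
  inv_comp (inv_rwhisk (pf_iota F A) x) (inv_lunit _).

(** The coherence isomorphism from the image of the composite to the strict form
    [act]: conjugation by it removes all constraint cells. *)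
Fixpoint canon A B (t : path A B) Z : forall x : hom Z (F A), invcell (F ·₁ ev t ∘ x) (act t x) :=
  match t with
  | pid A => fun x => iota_el x
  | pat f => fun x => inv_id _
  | pco s t => fun x =>
      inv_comp (gamma_el (ev s) (ev t) x)
        (inv_comp (inv_lwhisk (F ·₁ ev s) (canon t x)) (canon s (act t x)))
  end.

(** The value of [α] at [x] is characterized by an equation and its body is kept
    opaque, so that values are compared as atoms and never by unfolding [canon]. *)
Lemma el_sealed A B (s t : path A B) (α : ev s ⇒ ev t) Z (x : hom Z (F A)) :
  {β : act s x ⇒ act t x | β = bwd (canon s x) ⨾ (F ·₂ α ▷ x) ⨾ canon t x}.
Proof. by eexists. Qed.

Definition el A B (s t : path A B) (α : ev s ⇒ ev t) Z (x : hom Z (F A)) :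
  act s x ⇒ act t x := proj1_sig (el_sealed α x).

Lemma elE A B (s t : path A B) (α : ev s ⇒ ev t) Z (x : hom Z (F A)) :
  el α x = bwd (canon s x) ⨾ (F ·₂ α ▷ x) ⨾ canon t x.
Proof. exact: (proj2_sig (el_sealed α x)). Qed.

Fixpoint sem A B (s t : path A B) (e : pasting s t) Z : forall x : hom Z (F A), act s x ⇒ act t x :=
  match e in @pasting _ A B s t return forall x : hom Z (F A), act s x ⇒ act t x with
  | pst_cell α => fun x => el α x
  | pst_id s => fun x => id2 _
  | pst_vcomp a b => fun x => sem a x ⨾ sem b x
  | pst_lwhisk r a => fun x => act2 r (sem a x)
  | pst_rwhisk a r => fun x => sem a (act r x)
  | pst_assoc r s t => fun x => id2 _
  | pst_ainv r s t => fun x => id2 _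
  | pst_lunit s => fun x => id2 _
  | pst_linv s => fun x => id2 _
  | pst_runit s => fun x => id2 _
  | pst_rinv s => fun x => id2 _
  end.

Lemma gamma_el_nat (A B C : X) (g : hom B C) (f : hom A B) Z (x x' : hom Z (F A)) (ξ : x ⇒ x') :
  (F ·₁ (g ∘ f) ◁ ξ) ⨾ gamma_el g f x' = gamma_el g f x ⨾ (F ·₁ g ◁ (F ·₁ f ◁ ξ)).
Proof.
rewrite /= !vcomp_assoc ainv_nat_r -!vcomp_assoc; congr vcomp; exact: (eq_sym (interchange _ _)).
Qed.

Lemma canon_nat A B (t : path A B) Z (x x' : hom Z (F A)) (ξ : x ⇒ x') :
  (F ·₁ ev t ◁ ξ) ⨾ canon t x' = canon t x ⨾ act2 t ξ.
Proof.
elim: t Z x x' ξ => [C|C E f|C E C' s IHs t IHt] Z x x' ξ.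
- by rewrite /= !vcomp_assoc (vcompE (eq_sym (interchange _ _))) ?vcomp_assoc lunit_nat.
- by rewrite /= vcomp_id_l vcomp_id_r.
- have e := gamma_el_nat (ev s) (ev t) ξ.
  rewrite -[fwd (canon _ x')]/(gamma_el (ev s) (ev t) x' ⨾ _) (vcompE e) !vcomp_assoc.
  by rewrite (vcompE (eq_sym (lwhisk_vcomp _ _ _))) IHt lwhisk_vcomp !vcomp_assoc IHs.
Qed.

Lemma el_nat A B (s t : path A B) (α : ev s ⇒ ev t) Z (x x' : hom Z (F A)) (ξ : x ⇒ x') :
  act2 s ξ ⨾ el α x' = el α x ⨾ act2 t ξ.
Proof.
apply: (fwd_inj (φ := canon s x)).
rewrite (vcompE (eq_sym (canon_nat s ξ))) !elE !vcomp_assoc !fwdK.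
rewrite -canon_nat (vcompE (interchange _ _)) !vcomp_assoc //.
Qed.

Lemma el_unique A B (s t : path A B) (α : ev s ⇒ ev t) Z (x : hom Z (F A)) (β : act s x ⇒ act t x) :
  canon s x ⨾ β = (F ·₂ α ▷ x) ⨾ canon t x -> β = el α x.
Proof. by move=> e; apply: (fwd_inj (φ := canon s x)); rewrite e elE fwdK. Qed.

Lemma el_canon A B (s t : path A B) (α : ev s ⇒ ev t) Z (x : hom Z (F A)) :
  canon s x ⨾ el α x = (F ·₂ α ▷ x) ⨾ canon t x.
Proof. by rewrite elE fwdK. Qed.

(** Read on elements, the associativity axiom of [F] has no associator left except
    under [F]: the others cancel by the pentagon. *)
Lemma gamma_el_assoc (A B C E : X) (h : hom C E) (g : hom B C) (f : hom A B) Z (x : hom Z (F A)) :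
  (F ·₂ assoc h g f ▷ x) ⨾ gamma_el (h ∘ g) f x ⨾ gamma_el h g (F ·₁ f ∘ x)
  = gamma_el h (g ∘ f) x ⨾ (F ·₁ h ◁ gamma_el g f x).
Proof.
rewrite /= !vcomp_assoc (vcompE (ainv_nat_l _ _ _)) !vcomp_assoc.
rewrite (vcompE3 (δ := (F ·₂ assoc h g f ⨾ pf_gamma F (h ∘ g) f ⨾ (pf_gamma F h g ▷ F ·₁ f)) ▷ x)).
  by rewrite !rwhisk_vcomp.
rewrite pf_assoc !rwhisk_vcomp !lwhisk_vcomp !vcomp_assoc.
congr vcomp; rewrite (vcompE (ainv_nat_m _ _ _)) !vcomp_assoc; congr vcomp.
apply: (inv_cancel_r (assoc_ainv _ _ _)); rewrite !vcomp_assoc ainv_assoc vcomp_id_r.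
apply: (inv_cancel_r (assoc_ainv _ _ _)); rewrite !vcomp_assoc ainv_assoc vcomp_id_r.
rewrite pentagon (vcompE (eq_sym (lwhisk_vcomp _ _ _))) ainv_assoc lwhisk_id vcomp_id_l.
by rewrite (vcompE (ainv_assoc _ _ _)) vcomp_id_l.
Qed.

Lemma gamma_el_lunit (A B : X) (f : hom A B) Z (x : hom Z (F A)) :
  F ·₂ lunit f ▷ x = gamma_el (id1 B) f x ⨾ iota_el (F ·₁ f ∘ x).
Proof.
rewrite pf_lunit /= !rwhisk_vcomp !vcomp_assoc; congr vcomp.
rewrite (vcompE (ainv_nat_l _ _ _)) !vcomp_assoc; congr vcomp.
by rewrite -lunit_comp (vcompE (ainv_assoc _ _ _)) vcomp_id_l.
Qed.

Lemma gamma_el_runit (A B : X) (f : hom A B) Z (x : hom Z (F A)) :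
  F ·₂ runit f ▷ x = gamma_el f (id1 A) x ⨾ (F ·₁ f ◁ iota_el x).
Proof.
rewrite pf_runit /= !rwhisk_vcomp !lwhisk_vcomp !vcomp_assoc; congr vcomp.
rewrite (vcompE (ainv_nat_m _ _ _)) !vcomp_assoc; congr vcomp.
by rewrite -triangle (vcompE (ainv_assoc _ _ _)) vcomp_id_l.
Qed.

Lemma el_vcomp A B (s t r : path A B) (α : ev s ⇒ ev t) (β : ev t ⇒ ev r) Z (x : hom Z (F A)) :
  el (s := s) (t := r) (α ⨾ β) x = el α x ⨾ el β x.
Proof.
apply: (eq_sym (el_unique _)).
by rewrite (vcompE (el_canon _ _)) vcomp_assoc el_canon map2_vcomp rwhisk_vcomp vcomp_assoc.
Qed.

Lemma el_id A B (s : path A B) Z (x : hom Z (F A)) : el (s := s) (t := s) (id2 (ev s)) x = id2 _.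
Proof.
apply: (eq_sym (el_unique _)).
by rewrite map2_id rwhisk_id vcomp_id_l vcomp_id_r.
Qed.

(** An associator has the identity as its value because the two bracketings have the
    same strict form and [canon] is compatible with the associativity axiom of [F]. *)
Lemma el_assoc A B C E (r : path C E) (s : path B C) (t : path A B) Z (x : hom Z (F A)) :
  el (s := pco r (pco s t)) (t := pco (pco r s) t) (assoc (ev r) (ev s) (ev t)) x = id2 _.
Proof.
apply: (eq_sym (el_unique _)).
have e := gamma_el_assoc (ev r) (ev s) (ev t) x.
have n := gamma_el_nat (ev r) (ev s) (canon t x).
move: e n; rewrite -[fwd (canon (pco r (pco s t)) x)]/(gamma_el (ev r) (ev s ∘ ev t) x ⨾
  (F ·₁ ev r ◁ (gamma_el (ev s) (ev t) x ⨾ (F ·₁ ev s ◁ canon t x) ⨾ canon s (act t x)))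
  ⨾ canon r (act s (act t x))).
rewrite -[fwd (canon (pco (pco r s) t) x)]/(gamma_el (ev r ∘ ev s) (ev t) x ⨾
  (F ·₁ (ev r ∘ ev s) ◁ canon t x) ⨾ gamma_el (ev r) (ev s) (act t x) ⨾
  (F ·₁ ev r ◁ canon s (act t x)) ⨾ canon r (act s (act t x))).
move: (fwd (gamma_el (ev r ∘ ev s) (ev t) x)) (fwd (gamma_el (ev r) (ev s) (F ·₁ ev t ∘ x))).
move: (fwd (gamma_el (ev r) (ev s) (act t x))) (fwd (gamma_el (ev s) (ev t) x)).
move: (fwd (gamma_el (ev r) (ev s ∘ ev t) x)) => a b c d f.
move=> e n; rewrite vcomp_id_r (vcompE n) !vcomp_assoc (vcompE3 e) !vcomp_assoc.
by rewrite !lwhisk_vcomp !vcomp_assoc.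
Qed.

Lemma el_lunit A B (s : path A B) Z (x : hom Z (F A)) :
  el (s := pco (pid B) s) (t := s) (lunit (ev s)) x = id2 _.
Proof.
apply: (eq_sym (el_unique _)); rewrite gamma_el_lunit vcomp_id_r vcomp_assoc.
rewrite -[fwd (canon (pco _ s) x)]/(gamma_el (id1 B) (ev s) x ⨾
  (F ·₁ id1 B ◁ canon s x) ⨾ iota_el (act s x)); congr vcomp.
exact: (canon_nat (pid B)).
Qed.

Lemma el_runit A B (s : path A B) Z (x : hom Z (F A)) :
  el (s := pco s (pid A)) (t := s) (runit (ev s)) x = id2 _.
Proof.
apply: (eq_sym (el_unique _)); rewrite gamma_el_runit vcomp_id_r.
exact: (eq_sym (vcomp_assoc _ _ _)).
Qed.

Lemma el_inv A B (s t : path A B) (α : ev s ⇒ ev t) (β : ev t ⇒ ev s) Z (x : hom Z (F A)) :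
  α ⨾ β = id2 _ -> el α x ⨾ el β x = id2 _.
Proof. by move=> e; rewrite -el_vcomp e el_id. Qed.

Lemma el_lwhisk A B C (r : path B C) (s t : path A B) (α : ev s ⇒ ev t) Z (x : hom Z (F A)) :
  el (s := pco r s) (t := pco r t) (ev r ◁ α) x = act2 r (el α x).
Proof.
apply: (eq_sym (el_unique _)).
rewrite -[fwd (canon (pco r s) x)]/(gamma_el (ev r) (ev s) x ⨾
  (F ·₁ ev r ◁ canon s x) ⨾ canon r (act s x)).
rewrite -[fwd (canon (pco r t) x)]/(gamma_el (ev r) (ev t) x ⨾
  (F ·₁ ev r ◁ canon t x) ⨾ canon r (act t x)).
rewrite !vcomp_assoc -canon_nat (vcompE (eq_sym (lwhisk_vcomp _ _ _))) el_canon.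
rewrite lwhisk_vcomp ?vcomp_assoc /= ?vcomp_assoc.
rewrite (vcompE (eq_sym (rwhisk_vcomp _ _ _))) pf_gamma_nat_r rwhisk_vcomp !vcomp_assoc.
by rewrite (vcompE (ainv_nat_m _ _ _)) ?vcomp_assoc.
Qed.

Lemma el_rwhisk A B C (s t : path B C) (α : ev s ⇒ ev t) (r : path A B) Z (x : hom Z (F A)) :
  el (s := pco s r) (t := pco t r) (α ▷ ev r) x = el α (act r x).
Proof.
apply: (eq_sym (el_unique _)).
rewrite -[fwd (canon (pco s r) x)]/(gamma_el (ev s) (ev r) x ⨾
  (F ·₁ ev s ◁ canon r x) ⨾ canon s (act r x)).
rewrite -[fwd (canon (pco t r) x)]/(gamma_el (ev t) (ev r) x ⨾
  (F ·₁ ev t ◁ canon r x) ⨾ canon t (act r x)).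
rewrite ?vcomp_assoc el_canon (vcompE (eq_sym (interchange _ _))) ?vcomp_assoc /= ?vcomp_assoc.
rewrite [RHS](vcompE (eq_sym (rwhisk_vcomp _ _ _))) pf_gamma_nat_l rwhisk_vcomp !vcomp_assoc.
by rewrite (vcompE (ainv_nat_l _ _ _)) ?vcomp_assoc.
Qed.

(** Evaluating a pasting in strict form, with every constraint cell replaced by an
    identity, gives the value of the 2-cell that it denotes.  This is the coherence
    theorem on which the whole calculus rests. *)
Lemma sem_el A B (s t : path A B) (e : pasting s t) Z (x : hom Z (F A)) :
  sem e x = el (ev2 e) x.
Proof.
elim: e Z x => /=.
- by [].
- by move=> *; rewrite el_id.
- by move=> C E s' t' r a IHa b IHb Z x; rewrite el_vcomp IHa IHb.
- by move=> C E C' r s' t' a IHa Z x; rewrite el_lwhisk IHa.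
- by move=> C E C' s' t' a IHa r Z x; rewrite el_rwhisk IHa.
- by move=> *; rewrite el_assoc.
- move=> C E C' E' r s' t' Z x.
  have h := el_inv (s := pco r (pco s' t')) (t := pco (pco r s') t') x (assoc_ainv _ _ _).
  by rewrite el_assoc vcomp_id_l in h; rewrite h.
- by move=> *; rewrite el_lunit.
- move=> C E s' Z x.
  have h := el_inv (s := pco (pid E) s') (t := s') x (lunit_linv _).
  by rewrite el_lunit vcomp_id_l in h; rewrite h.
- by move=> *; rewrite el_runit.
- move=> C E s' Z x.
  have h := el_inv (s := pco s' (pid C)) (t := s') x (runit_rinv _).
  by rewrite el_runit vcomp_id_l in h; rewrite h.
Qed.

(** Equal 2-cells may be presented by different pastings, so an equation of cells in
    the source of [F] becomes an equation of strict composites in its target. *)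
Lemma sem_eq A B (s t : path A B) (e e' : pasting s t) :
  ev2 e = ev2 e' -> forall Z (x : hom Z (F A)), sem e x = sem e' x.
Proof. by move=> E Z x; rewrite !sem_el E. Qed.

Lemma el_pat A B (f g : hom A B) (α : f ⇒ g) Z (x : hom Z (F A)) :
  el (s := pat f) (t := pat g) α x = F ·₂ α ▷ x.
Proof. by rewrite elE /= vcomp_id_l vcomp_id_r. Qed.
End Semantics.
Arguments act {X Y} F {A B} t {Z} x.
Arguments act2 {X Y} F {A B} t {Z x x'} ξ.
Arguments canon {X Y} F {A B} t {Z} x.
Arguments el {X Y} F {A B} s t α {Z} x.
Arguments sem {X Y} F {A B s t} e {Z} x.
Arguments gamma_el {X Y} F {A B C} g f {Z} x.
Arguments iota_el {X Y} F A {Z} x.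

(** The identity 1-cell is a sufficient test element: whiskering by it is injective,
    as it is conjugate by unitors to doing nothing. *)
Lemma cell_ext (X : Bicat) (A B : X) (s t : path A B) (e e' : pasting s t) :
  (forall Z (x : hom Z A), sem (pf_id X) e x = sem (pf_id X) e' x) -> ev2 e = ev2 e'.
Proof.
move=> E; have := E A (id1 A); rewrite !sem_el !elE => {}E.
apply: rwhisk_id1_inj; apply: (fwd_injr (φ := canon (pf_id X) t (id1 A))).
apply: (inv_cancel_l (fwd_bwd (canon (pf_id X) s (id1 A)))); exact: E.
Qed.

(** The case where the pseudofunctor is the identity.  It has its own [app] and [elems]
    because [act] along the identity would leave that pseudofunctor in every type. *)
Section Elements.
Variable X : Bicat.

Fixpoint app A B (t : path A B) (Z : X) : hom Z A -> hom Z B :=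
  match t with
  | pid A => fun x => x
  | pat f => fun x => f ∘ x
  | pco s t => fun x => app s (app t x)
  end.

Fixpoint app2 A B (t : path A B) (Z : X) : forall x x' : hom Z A, x ⇒ x' -> app t x ⇒ app t x' :=
  match t with
  | pid A => fun x x' ξ => ξ
  | pat f => fun x x' ξ => f ◁ ξ
  | pco s t => fun x x' ξ => app2 s (app2 t ξ)
  end.

Definition elem A B (s t : path A B) (α : ev s ⇒ ev t) (Z : X) (x : hom Z A) : app s x ⇒ app t x :=
  el (pf_id X) s t α x.

Fixpoint elems A B (s t : path A B) (e : pasting s t) (Z : X) : forall x : hom Z A, app s x ⇒ app t x :=
  match e in @pasting _ A B s t return forall x : hom Z A, app s x ⇒ app t x with
  | pst_cell α => fun x => elem α x
  | pst_id s => fun x => id2 _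
  | pst_vcomp a b => fun x => elems a x ⨾ elems b x
  | pst_lwhisk r a => fun x => app2 r (elems a x)
  | pst_rwhisk a r => fun x => elems a (app r x)
  | pst_assoc r s t => fun x => id2 _
  | pst_ainv r s t => fun x => id2 _
  | pst_lunit s => fun x => id2 _
  | pst_linv s => fun x => id2 _
  | pst_runit s => fun x => id2 _
  | pst_rinv s => fun x => id2 _
  end.

Lemma elem_ext (A B : X) (s t : path A B) (e e' : pasting s t) :
  (forall (Z : X) (x : hom Z A), elems e x = elems e' x) -> ev2 e = ev2 e'.
Proof. move=> E; apply: cell_ext => Z x; exact: E. Qed.

Lemma elems_eq (A B : X) (s t : path A B) (e e' : pasting s t) :
  ev2 e = ev2 e' -> (forall (Z : X) (x : hom Z A), elems e x = elems e' x).
Proof. move=> E Z x; exact: (sem_eq (F := pf_id X) E x). Qed.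

Lemma elem_nat A B (s t : path A B) (α : ev s ⇒ ev t) (Z : X) (x x' : hom Z A) (ξ : x ⇒ x') :
  app2 s ξ ⨾ elem α x' = elem α x ⨾ app2 t ξ.
Proof. exact: (el_nat (F := pf_id X)). Qed.

Lemma elem_pat A B (f g : hom A B) (α : f ⇒ g) (Z : X) (x : hom Z A) :
  elem (s := pat f) (t := pat g) α x = α ▷ x.
Proof. exact: (el_pat (F := pf_id X)). Qed.

Lemma elem_inv A B (s t : path A B) (α : ev s ⇒ ev t) (β : ev t ⇒ ev s) (Z : X) (x : hom Z A) :
  α ⨾ β = id2 _ -> elem α x ⨾ elem β x = id2 _.
Proof. exact: (el_inv (F := pf_id X)). Qed.

Lemma elem_vcomp A B (s t r : path A B) (α : ev s ⇒ ev t) (β : ev t ⇒ ev r) (Z : X) (x : hom Z A) :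
  elem (s := s) (t := r) (α ⨾ β) x = elem α x ⨾ elem β x.
Proof. exact: (el_vcomp (F := pf_id X)). Qed.

Section Invcell.
Variables (A B : X) (s t : path A B) (φ : invcell (ev s) (ev t)) (Z : X) (x : hom Z A).
Lemma elem_fwd_bwd : elem (s := s) (t := t) φ x ⨾ elem (s := t) (t := s) (bwd φ) x = id2 _.
Proof. exact: elem_inv (fwd_bwd φ). Qed.
Lemma elem_bwd_fwd : elem (s := t) (t := s) (bwd φ) x ⨾ elem (s := s) (t := t) φ x = id2 _.
Proof. exact: elem_inv (bwd_fwd φ). Qed.
Lemma elem_bwdK (k : hom Z B) (δ : app t x ⇒ k) :
  elem (s := t) (t := s) (bwd φ) x ⨾ elem (s := s) (t := t) φ x ⨾ δ = δ.
Proof. by rewrite (vcompE elem_bwd_fwd) vcomp_id_l. Qed.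
End Invcell.

End Elements.
Arguments elem {X A B} s t α {Z} x.
Arguments app2 {X A B} t {Z x x'} ξ.

(** Reification: the syntax tree of a 1-cell, then of a 2-cell, built from its shape;
    what is not an operation of a bicategory becomes an atom. *)
Ltac rpath X A B f :=
  lazymatch f with
  | id1 ?a => constr:(@pid X a)
  | @comp1 _ _ ?C _ ?g ?h =>
      let s := rpath X C B g in let t := rpath X A C h in constr:(@pco X A C B s t)
  | _ => constr:(@pat X A B f)
  end.

Ltac rcell X A B f g α :=
  lazymatch α with
  | id2 ?k => let s := rpath X A B k in constr:(@pst_id X A B s)
  | @vcomp _ _ _ _ ?m _ ?a ?b =>
      let a' := rcell X A B f m a in let b' := rcell X A B m g b in
      constr:(pst_vcomp a' b')
  | @lwhisk _ _ ?C _ ?k ?h ?h' ?a =>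
      let r := rpath X C B k in let a' := rcell X A C h h' a in constr:(pst_lwhisk r a')
  | @rwhisk _ _ ?C _ ?h ?h' ?a ?k =>
      let r := rpath X A C k in let a' := rcell X C B h h' a in constr:(pst_rwhisk a' r)
  | @assoc _ _ ?C ?E _ ?h ?k ?l =>
      let r := rpath X E B h in let s := rpath X C E k in let t := rpath X A C l in
      constr:(pst_assoc r s t)
  | @ainv _ _ ?C ?E _ ?h ?k ?l =>
      let r := rpath X E B h in let s := rpath X C E k in let t := rpath X A C l in
      constr:(pst_ainv r s t)
  | lunit ?k => let s := rpath X A B k in constr:(pst_lunit s)
  | linv ?k => let s := rpath X A B k in constr:(pst_linv s)
  | runit ?k => let s := rpath X A B k in constr:(pst_runit s)
  | rinv ?k => let s := rpath X A B k in constr:(pst_rinv s)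
  | _ => let s := rpath X A B f in let t := rpath X A B g in constr:(@pst_cell X A B s t α)
  end.

(** * Tactics for pastings of elements *)

Notation "α @[ x ]" := (elem _ _ α x) (at level 43, x at level 200, format "α @[ x ]") : bicat_scope.

(** The normal form of strict composites: whiskerings are distributed over vertical
    composition, which is bracketed to the right. *)
Ltac clean := rewrite ?elem_pat ?lwhisk_id ?rwhisk_id ?vcomp_id_l ?vcomp_id_r ?lwhisk_vcomp
  ?rwhisk_vcomp ?vcomp_assoc.
Tactic Notation "clean" "in" hyp(h) :=
  rewrite ?elem_pat ?lwhisk_id ?rwhisk_id ?vcomp_id_l ?vcomp_id_r ?lwhisk_vcomp ?rwhisk_vcomp
    ?vcomp_assoc in h.

Ltac strict_goal :=
  lazymatch goal with
  | |- @eq (@cell ?X ?A ?B ?f ?g) ?a ?b =>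
      let ea := rcell X A B f g a in let eb := rcell X A B f g b in
      refine (@elem_ext X A B _ _ ea eb _)
  end.

(** [strict Z x] replaces an equation of 2-cells by the equation of their values at an
    arbitrary element [x : Z -> A]. *)
Tactic Notation "strict" simple_intropattern(Z) simple_intropattern(x) :=
  strict_goal; intros Z x; cbn [elems app app2]; clean.

Ltac elements_of X A B s t e :=
  let h := fresh in let h1 := fresh in let Z := fresh "Z" in let x := fresh "x" in
  eassert (h : forall (Z : X) (x : hom Z A), @eq (@cell X Z B (@app X A B s Z x) (@app X A B t Z x))
    _ _);
  [ intros Z x; pose proof (e Z x) as h1; cbn [elems app app2] in h1; clean in h1; exact h1
  | cbn [elems app app2] in h; revert h ].

(** [elements e as H] is the converse for an equation [e] at hand: [H] is the equation
    of values, for all [Z] and [x]. *)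
Tactic Notation "elements" constr(e) "as" simple_intropattern(H) :=
  lazymatch type of e with
  | @eq (@cell ?X ?A ?B ?f ?g) ?a ?b =>
      let ea := rcell X A B f g a in let eb := rcell X A B f g b in
      lazymatch type of ea with @pasting _ _ _ ?s ?t =>
      elements_of X A B s t (@elems_eq X A B s t ea eb e); intros H end
  end.

(** [chain e] rewrites with [e] inside a composite in normal form.  The left side of [e]
    is a segment of that composite and not a subterm of it, so [e] is generalized to
    an equation with an arbitrary continuation. *)
Ltac chain_core e :=
  let e0 := fresh in pose proof e as e0; cbn beta in e0; clean in e0;
  lazymatch type of e0 with
  | @eq (@cell ?X ?A ?B ?f ?g) ?a ?b =>
      let h := fresh in let k := fresh in let d := fresh in let e1 := fresh in
      eassert (h : forall k (d : g ⇒ k), @eq (@cell X A B f k) _ _);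
      [ intros k d; pose proof (f_equal (fun c : @cell X A B f g => vcomp c d) e0)
      as e1; cbn beta in e1; clean in e1; exact e1
      | first [rewrite h; clear h e0 | rewrite e0; clear h e0 ]; clean ]
  end.
Tactic Notation "chain" constr(e) := chain_core e.
Tactic Notation "chain" "<-" constr(e) := chain_core (eq_sym e).
Tactic Notation "chain" constr(e) "under" constr(g) := chain_core (f_equal (lwhisk g) e).
Tactic Notation "chain" "<-" constr(e) "under" constr(g) := chain_core (f_equal (lwhisk g) (eq_sym e)).

(** [slide α] moves the cell that precedes [α] in a composite to the other side of
    [α]: on elements, naturality of [α] in its argument is the interchange law.  The
    second version of the law is for values along a pseudofunctor. *)
Ltac slide_law X A B s t α k :=
  let h := fresh in let h' := fresh in
  let Z := fresh "Z" in let x := fresh "x" in let x' := fresh "x'" in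
  let ξ := fresh "ξ" in let m := fresh in let d := fresh in let e := fresh in
  eassert (h : forall (Z : X) (x x' : hom Z A) (ξ : x ⇒ x'),
    @eq (@cell X Z B (@app X A B s Z x) (@app X A B t Z x')) _ _);
  [ intros Z x x' ξ; pose proof (@elem_nat X A B s t α Z x x' ξ) as e;
    cbn [app2 app] in e; rewrite ?elem_pat in e; exact e |];
  eassert (h' : forall (Z : X) (x x' : hom Z A) (ξ : x ⇒ x') m (d : @app X A B t Z x' ⇒ m),
    @eq (@cell X Z B (@app X A B s Z x) m) _ _);
  [ intros Z x x' ξ m d;
    pose proof (f_equal (fun c => @vcomp X _ _ _ _ _ c d) (@elem_nat X A B s t α Z x x' ξ)) as e;
    cbn [app2 app] in e; rewrite ?elem_pat ?vcomp_assoc in e; exact e |];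
  cbn [app] in h, h'; k h h'; clear h h'.

Ltac fslide_law X Y F A B s t α k :=
  let h := fresh in let h' := fresh in
  let Z := fresh "Z" in let x := fresh "x" in let x' := fresh "x'" in
  let ξ := fresh "ξ" in let m := fresh in let d := fresh in let e := fresh in
  eassert (h : forall (Z : Y) (x x' : hom Z (F A)) (ξ : x ⇒ x'),
    @eq (@cell Y Z (F B) (@act X Y F A B s Z x) (@act X Y F A B t Z x')) _ _);
  [ intros Z x x' ξ; pose proof (@el_nat X Y F A B s t α Z x x' ξ) as e;
    cbn [act2 act] in e; rewrite ?el_pat in e; exact e |];
  eassert (h' : forall (Z : Y) (x x' : hom Z (F A)) (ξ : x ⇒ x') m (d : @act X Y F A B t Z x' ⇒ m),
    @eq (@cell Y Z (F B) (@act X Y F A B s Z x) m) _ _);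
  [ intros Z x x' ξ m d;
    pose proof (f_equal (fun c => @vcomp Y _ _ _ _ _ c d) (@el_nat X Y F A B s t α Z x x' ξ)) as e;
    cbn [act2 act] in e; rewrite ?el_pat ?vcomp_assoc in e; exact e |];
  cbn [act] in h, h'; k h h'; clear h h'.

Ltac slide_with α k :=
  lazymatch goal with
  | |- context[@elem ?X ?A ?B ?s ?t α _ _] => slide_law X A B s t α k
  | |- context[@el ?X ?Y ?F ?A ?B ?s ?t α _ _] => fslide_law X Y F A B s t α k
  | |- context[@rwhisk ?X _ ?A ?B ?f ?g α _] =>
      slide_law X A B constr:(@pat X A B f) constr:(@pat X A B g) α k
  end.
Tactic Notation "slide" constr(α) :=
  slide_with α ltac:(fun h h' => first [rewrite h' | rewrite h]; clean).
Tactic Notation "slide" "<-" constr(α) :=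
  slide_with α ltac:(fun h h' => first [rewrite -h' | rewrite -h]; clean).
Tactic Notation "slide" constr(α) "at" constr(x) :=
  slide_with α ltac:(fun h h' => first [rewrite (h' _ _ x) | rewrite (h _ _ x)]; clean).
Tactic Notation "slide" "<-" constr(α) "at" constr(x) :=
  slide_with α ltac:(fun h h' => first [rewrite -(h' _ x) | rewrite -(h _ x)]; clean).

(** * Elements along a pseudofunctor *)

Notation gammaF F g f x := (elem (pat (F ·₁ (g ∘ f))) (pco (pat (F ·₁ g)) (pat (F ·₁ f)))
  (fwd (pf_gamma F g f)) x) (only parsing).
Notation gammaB F g f x := (elem (pco (pat (F ·₁ g)) (pat (F ·₁ f))) (pat (F ·₁ (g ∘ f)))
  (bwd (pf_gamma F g f)) x) (only parsing).
Notation iotaF F A x := (elem (pat (F ·₁ id1 A)) (pid (F A)) (fwd (pf_iota F A)) x) (only parsing).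
Notation iotaB F A x := (elem (pid (F A)) (pat (F ·₁ id1 A)) (bwd (pf_iota F A)) x) (only parsing).

Section FunctorElements.
Variables (X Y : Bicat) (F : Pseudofunctor X Y).

Lemma elem_gamma (A B C : X) (g : hom B C) (f : hom A B) (Z : Y) (x : hom Z (F A)) :
  elem (pat (F ·₁ (g ∘ f))) (pco (pat (F ·₁ g)) (pat (F ·₁ f))) (pf_gamma F g f) x
  = gamma_el F g f x.
Proof. by rewrite /elem elE /= ?rwhisk_id ?lwhisk_id ?vcomp_id_r ?vcomp_id_l ?vcomp_assoc ?vcomp_id_r
  ?vcomp_id_l. Qed.

Lemma elem_gammaV (A B C : X) (g : hom B C) (f : hom A B) (Z : Y) (x : hom Z (F A)) :
  elem (pco (pat (F ·₁ g)) (pat (F ·₁ f))) (pat (F ·₁ (g ∘ f))) (bwd (pf_gamma F g f)) x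
  = bwd (gamma_el F g f x).
Proof. by rewrite /elem elE /= ?rwhisk_id ?lwhisk_id ?vcomp_id_r ?vcomp_id_l ?vcomp_assoc ?vcomp_id_r
  ?vcomp_id_l. Qed.

Lemma elem_iota (A : X) (Z : Y) (x : hom Z (F A)) :
  elem (pat (F ·₁ id1 A)) (pid (F A)) (pf_iota F A) x = iota_el F A x.
Proof. by rewrite /elem elE /= ?rwhisk_id ?lwhisk_id ?vcomp_id_r ?vcomp_id_l ?vcomp_assoc ?vcomp_id_r
  ?vcomp_id_l. Qed.

Lemma elem_iotaV (A : X) (Z : Y) (x : hom Z (F A)) :
  elem (pid (F A)) (pat (F ·₁ id1 A)) (bwd (pf_iota F A)) x = bwd (iota_el F A x).
Proof. by rewrite /elem elE /= ?rwhisk_id ?lwhisk_id ?vcomp_id_r ?vcomp_id_l ?vcomp_assoc ?vcomp_id_r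
  ?vcomp_id_l. Qed.

(** For paths of length at most two the strict value of [α] along [F] is [F α]
    conjugated by the structure isomorphisms.  These translations are needed where a
    structure isomorphism is itself part of the equation. *)
Lemma el_co_co (A B B' C : X) (g : hom B C) (f : hom A B) (g' : hom B' C) (f' : hom A B')
  (α : g ∘ f ⇒ g' ∘ f') (Z : Y) (x : hom Z (F A)) :
  el F (pco (pat g) (pat f)) (pco (pat g') (pat f')) α x
  = gammaB F g f x ⨾ (F ·₂ α ▷ x) ⨾ gammaF F g' f' x.
Proof. by rewrite elem_gamma elem_gammaV elE /= ?rwhisk_id ?lwhisk_id ?vcomp_id_r ?vcomp_id_l
  ?vcomp_assoc ?vcomp_id_r ?vcomp_id_l. Qed.

Lemma el_pat_co (A B C : X) (g : hom B C) (f : hom A B) (h : hom A C)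
  (α : h ⇒ g ∘ f) (Z : Y) (x : hom Z (F A)) :
  el F (pat h) (pco (pat g) (pat f)) α x = (F ·₂ α ▷ x) ⨾ gammaF F g f x.
Proof. by rewrite elem_gamma elE /= ?rwhisk_id ?lwhisk_id ?vcomp_id_r ?vcomp_id_l ?vcomp_assoc
  ?vcomp_id_r ?vcomp_id_l. Qed.

Lemma el_pat_id (A : X) (h : hom A A) (α : h ⇒ id1 A) (Z : Y) (x : hom Z (F A)) :
  el F (pat h) (pid A) α x = (F ·₂ α ▷ x) ⨾ iotaF F A x.
Proof. by rewrite elem_iota elE /= ?rwhisk_id ?lwhisk_id ?vcomp_id_r ?vcomp_id_l ?vcomp_assoc
  ?vcomp_id_r ?vcomp_id_l. Qed.

Lemma el_co_id (A B : X) (g : hom B A) (f : hom A B) (α : g ∘ f ⇒ id1 A) (Z : Y) (x : hom Z (F A)) :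
  el F (pco (pat g) (pat f)) (pid A) α x
  = gammaB F g f x ⨾ (F ·₂ α ▷ x) ⨾ iotaF F A x.
Proof. by rewrite elem_gammaV elem_iota elE /= ?rwhisk_id ?lwhisk_id ?vcomp_id_r ?vcomp_id_l
  ?vcomp_assoc ?vcomp_id_r ?vcomp_id_l. Qed.

Lemma el_id_co (A B : X) (g : hom B A) (f : hom A B) (α : id1 A ⇒ g ∘ f) (Z : Y) (x : hom Z (F A)) :
  el F (pid A) (pco (pat g) (pat f)) α x
  = iotaB F A x ⨾ (F ·₂ α ▷ x) ⨾ gammaF F g f x.
Proof. by rewrite elem_gamma elem_iotaV elE /= ?rwhisk_id ?lwhisk_id ?vcomp_id_r ?vcomp_id_l
  ?vcomp_assoc ?vcomp_id_r ?vcomp_id_l. Qed.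

End FunctorElements.

Ltac felements_of F X Y A B s t e :=
  let h := fresh in let h1 := fresh in let Z := fresh "Z" in let x := fresh "x" in
  eassert (h : forall (Z : Y) (x : hom Z (F A)),
    @eq (@cell Y Z (F B) (@act X Y F A B s Z x) (@act X Y F A B t Z x)) _ _);
  [ intros Z x; pose proof (e Z x) as h1; cbn [sem act act2] in h1; rewrite ?el_pat in h1;
    clean in h1; exact h1
  | cbn [sem act act2] in h; revert h ].

(** [elements e along F as H] applies [F] to the equation [e]: in strict form the image
    of a pasting has the same shape as the pasting. *)
Tactic Notation "elements" constr(e) "along" constr(F) "as" simple_intropattern(H) :=
  lazymatch type of F with Pseudofunctor ?X0 ?Y =>
  lazymatch type of e with
  | @eq (@cell ?X ?A ?B ?f ?g) ?a ?b =>
      let ea := rcell X A B f g a in let eb := rcell X A B f g b in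
      lazymatch type of ea with @pasting _ _ _ ?s ?t =>
      felements_of F X Y A B s t (@sem_eq X Y F A B s t ea eb e); intros H end
  end end.

(** * Colax transformations *)

(** The axioms of a colax transformation as a predicate on its data.  The data only see
    objects and 1-cells, so that one and the same data can be read between composites
    of pseudofunctors with different bracketings, while the axioms have to be moved
    from one bracketing to the other. *)
Record is_colax (X Y : Bicat) (K K' : Pseudofunctor X Y) (α : ColaxData K K') : Prop := {
  colax_nat : forall (A B : X) (f g : hom A B) (σ : f ⇒ g),
    (α B ◁ K ·₂ σ) ⨾ cx_cell α g = cx_cell α f ⨾ (K' ·₂ σ ▷ α A);
  colax_unit : forall A : X,
    cx_cell α (id1 A) ⨾ (pf_iota K' A ▷ α A)
    = (α A ◁ pf_iota K A) ⨾ runit (α A) ⨾ linv (α A);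
  colax_comp : forall (A B C : X) (g : hom B C) (f : hom A B),
    cx_cell α (g ∘ f) ⨾ (pf_gamma K' g f ▷ α A)
    = (α C ◁ pf_gamma K g f)
      ⨾ assoc (α C) (K ·₁ g) (K ·₁ f)
      ⨾ (cx_cell α g ▷ K ·₁ f)
      ⨾ ainv (K' ·₁ g) (α B) (K ·₁ f)
      ⨾ (K' ·₁ g ◁ cx_cell α f)
      ⨾ assoc (K' ·₁ g) (K' ·₁ f) (α A)
}.

Section GammaCancel.
Variables (X Y : Bicat) (F : Pseudofunctor X Y) (A B C : X) (g : hom B C) (f : hom A B)
  (Z : Y) (x : hom Z (F A)).
Lemma gamma_bwdK k (δ : F ·₁ g ∘ (F ·₁ f ∘ x) ⇒ k) : gammaB F g f x ⨾ gammaF F g f x ⨾ δ = δ.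
Proof. exact: elem_bwdK. Qed.
Lemma gamma_bf : gammaB F g f x ⨾ gammaF F g f x = id2 _.
Proof. exact: elem_bwd_fwd. Qed.
Lemma gamma_fb : gammaF F g f x ⨾ gammaB F g f x = id2 _.
Proof. exact: elem_fwd_bwd. Qed.
End GammaCancel.

Section IotaCancel.
Variables (X Y : Bicat) (F : Pseudofunctor X Y) (A : X) (Z : Y) (x : hom Z (F A)).
Lemma iota_bwdK k (δ : x ⇒ k) : iotaB F A x ⨾ iotaF F A x ⨾ δ = δ.
Proof. by rewrite -vcomp_assoc (elem_bwd_fwd (s := pat _) (t := pid _)) vcomp_id_l. Qed.
Lemma iota_bf : iotaB F A x ⨾ iotaF F A x = id2 _.
Proof. exact: (elem_bwd_fwd (s := pat _) (t := pid _)). Qed.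
Lemma iota_fb : iotaF F A x ⨾ iotaB F A x = id2 _.
Proof. exact: (elem_fwd_bwd (s := pat _) (t := pid _)). Qed.
End IotaCancel.

Section Vcomp.
Variables (X Y : Bicat) (K K' K'' : Pseudofunctor X Y)
  (β : ColaxData K' K'') (α : ColaxData K K').
(** For the composition axiom the cells of [α] at [f] and of [β] at [g] act on
    different sides and have to be exchanged. *)
Lemma colax_vcomp : is_colax (K:=K') (K':=K'') β -> is_colax (K:=K) (K':=K') α ->
  is_colax (K:=K) (K':=K'') (cx_vcomp β α).
Proof.
move=> Hb Ha; split.
- move=> A B f g σ; cbn [cx_vcomp cx cx_cell].
  elements (colax_nat Ha σ) as u.
  elements (colax_nat Hb σ) as v.
  strict Z x.
  chain (u Z x) under (β B).
  by chain (v Z (α A ∘ x)).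
- move=> A; cbn [cx_vcomp cx cx_cell].
  elements (colax_unit Ha A) as u.
  elements (colax_unit Hb A) as v.
  strict Z x.
  chain (v Z (α A ∘ x)).
  by chain (u Z x) under (β A).
- move=> A B C g f; cbn [cx_vcomp cx cx_cell].
  elements (colax_comp Ha g f) as u. elements (colax_comp Hb g f) as v.
  strict Z x.
  chain (v Z (α A ∘ x)).
  chain (u Z x) under (β C).
  by slide (cx_cell β g).
Qed.
End Vcomp.

Section Lwhisk.
Variables (X Y W : Bicat) (F : Pseudofunctor Y W) (K K' : Pseudofunctor X Y)
  (α : ColaxData K K').
Lemma colax_lwhisk : is_colax (K:=K) (K':=K') α ->
  is_colax (K:=pf_comp F K) (K':=pf_comp F K') (cx_lwhisk F α).
Proof.
move=> Ha; split.
- move=> A B f g σ; cbn [cx_lwhisk cx cx_cell pf_comp map2].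
  elements (colax_nat Ha σ) along F as u.
  strict Z x.
  by have := u Z x; rewrite !el_co_co; clean.
- move=> A; cbn [cx_lwhisk cx cx_cell pf_comp pf_iota fwd inv_comp inv_map].
  elements (colax_unit Ha A) along F as u.
  strict Z x.
  by have := u Z x; rewrite !el_co_co !el_pat_id; clean.
- move=> A B C g f; cbn [cx_lwhisk cx cx_cell pf_comp pf_gamma fwd inv_comp inv_map].
  elements (colax_comp Ha g f) along F as u.
  strict Z x.
  by have := u Z x; rewrite !el_co_co !el_pat_co; clean.
Qed.
End Lwhisk.

Section Rwhisk.
Variables (W X Y : Bicat) (F : Pseudofunctor W X) (K K' : Pseudofunctor X Y)
  (α : ColaxData K K').
Lemma colax_rwhisk : is_colax (K:=K) (K':=K') α ->
  is_colax (K:=pf_comp K F) (K':=pf_comp K' F) (cx_rwhisk α F).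
Proof.
move=> Ha; split.
- move=> A B f g σ; exact: (colax_nat Ha).
- move=> A; cbn [cx_rwhisk cx cx_cell pf_comp pf_iota fwd inv_comp inv_map].
  rewrite rwhisk_vcomp lwhisk_vcomp -vcomp_assoc -(colax_nat Ha) !vcomp_assoc.
  by rewrite (colax_unit Ha).
- move=> A B C g f; cbn [cx_rwhisk cx cx_cell pf_comp pf_gamma fwd inv_comp inv_map].
  rewrite rwhisk_vcomp lwhisk_vcomp -vcomp_assoc -(colax_nat Ha) !vcomp_assoc.
  by rewrite (colax_comp Ha).
Qed.
End Rwhisk.

(** * Transport of a colax transformation along a coreflection *)

Section Coreflection.
Variables (M K : Bicat) (U : Pseudofunctor M K) (R : Pseudofunctor M M).
Variable μ : ColaxData U (pre_comp U R).
Hypothesis Hμ : is_colax (K := U) (K' := pf_comp U R) μ.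
Variables (n : forall A : M, hom A (R A)) (χ : forall A : M, U ·₁ n A ⇒ μ A).

(** The correspondence under which [n] is to be the coreflection of [μ]: a 2-cell into
    [k ∘ n] is composed with [χ].  The 1-cells [U h] are only a part of those of [K],
    and this is what makes it a coreflection. *)
Definition push (A C : M) (h : hom A C) (k : hom (R A) C) (σ : h ⇒ k ∘ n A) :
  U ·₁ h ⇒ U ·₁ k ∘ μ A :=
  U ·₂ σ ⨾ pf_gamma U k (n A) ⨾ (U ·₁ k ◁ χ A).

Hypothesis univ : forall (A C : M) (h : hom A C) (k : hom (R A) C) (ρ : U ·₁ h ⇒ U ·₁ k ∘ μ A),
  exists! σ : h ⇒ k ∘ n A, push σ = ρ.

Definition lift (A C : M) (h : hom A C) (k : hom (R A) C) (ρ : U ·₁ h ⇒ U ·₁ k ∘ μ A) : h ⇒ k ∘ n A :=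
  proj1_sig (constructive_indefinite_description _ (univ ρ)).

Lemma push_lift (A C : M) (h : hom A C) (k : hom (R A) C) (ρ : U ·₁ h ⇒ U ·₁ k ∘ μ A) :
  push (lift ρ) = ρ.
Proof. by rewrite /lift; case: constructive_indefinite_description => σ []. Qed.

Lemma push_inj (A C : M) (h : hom A C) (k : hom (R A) C) (σ τ : h ⇒ k ∘ n A) :
  push σ = push τ -> σ = τ.
Proof. by move=> e; case: (univ (push τ)) => ρ [_ u]; rewrite -(u σ e) -(u τ). Qed.

(** The cells are forced: the colax cell of [μ] must be their composite with [χ]. *)
Definition lift_data : ColaxData (pre_id M) R :=
  {| cx := n : forall A, hom (pre_id M A) (R A);
     cx_cell := fun A B f => lift (h := n B ∘ f) (k := R ·₁ f)
       (pf_gamma U (n B) f ⨾ (χ B ▷ U ·₁ f) ⨾ cx_cell μ f) |}.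

(** The uniqueness of lifts in strict form; here [r] may be any path, so that the test applies with the
    composition and unit constraints of [R] present. *)
Lemma push_ext (A C : M) (s : path A C) (r : path (R A) C) (e e' : pasting s (pco r (pat (n A)))) :
  (forall Z (x : hom Z (U A)), sem U e x ⨾ act2 U r (χ A ▷ x) = sem U e' x ⨾ act2 U r (χ A ▷ x)) ->
  ev2 e = ev2 e'.
Proof.
move=> E; apply: push_inj; rewrite /push; strict Z x.
have h (d : pasting s (pco r (pat (n A)))) : sem U d x ⨾ act2 U r (χ A ▷ x)
  = bwd (canon U s x) ⨾ (U ·₂ ev2 d ▷ x) ⨾ (gammaF U (ev r) (n A) x)
    ⨾ (U ·₁ ev r ◁ (χ A ▷ x)) ⨾ canon U r (μ A ∘ x).
  rewrite sem_el elE elem_gamma canon_nat; cbn [canon fwd inv_comp inv_lwhisk inv_id].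
  by clean.
have := E Z x; rewrite !h => /(inv_cancel_l (fwd_bwd (canon U s x))) h'.
apply: (fwd_injr (φ := canon U r (μ A ∘ x))).
by rewrite !vcomp_assoc.
Qed.

Lemma lift_dataE (A B : M) (f : hom A B) Z (x : hom Z (U A)) :
  el U (pco (pat (n B)) (pat f)) (pco (pat (R ·₁ f)) (pat (n A))) (cx_cell lift_data f) x
   ⨾ (U ·₁ (R ·₁ f) ◁ (χ A ▷ x))
  = (χ B ▷ (U ·₁ f ∘ x)) ⨾ elem (pco (pat (μ B)) (pat (U ·₁ f))) (pco (pat (U ·₁ (R ·₁ f))) (pat (μ A)))
    (cx_cell μ f) x.
Proof.
have e := push_lift (h := n B ∘ f) (k := R ·₁ f) (pf_gamma U (n B) f ⨾ (χ B ▷ U ·₁ f) ⨾ cx_cell μ f).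
rewrite /push in e.
elements e as e'.
rewrite el_co_co !vcomp_assoc.
chain (e' Z x).
exact: gamma_bwdK.
Qed.

Ltac push_goal :=
  lazymatch goal with
  | |- @eq (@cell ?X ?A ?B ?f ?g) ?a ?b =>
      let ea := rcell X A B f g a in let eb := rcell X A B f g b in
      lazymatch type of ea with
      | @pasting _ _ _ ?s (pco ?r _) => refine (@push_ext A B s r ea eb _)
      end
  end; intros Z x; cbn [sem act act2]; rewrite ?el_pat; clean.

Notation ν f x := (el U (pco (pat (n _)) (pat f)) (pco (pat (R ·₁ f)) (pat (n _))) (cx_cell lift_data f)
  x).

(** Each axiom is an equation between 2-cells into a composite with [n].  After
    composition with [χ] it becomes the corresponding axiom of [μ], the cells of
    the lift being exchanged for those of [μ] one at a time (lift_dataE). *)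
Lemma lift_colax : is_colax (K := pf_id M) (K' := R) lift_data.
Proof.
split.
- move=> A B f g σ.
  elements (colax_nat Hμ σ) as u.
  push_goal.
  suff: (U ·₁ n B ◁ (U ·₂ σ ▷ x)) ⨾ ν g x ⨾ (U ·₁ (R ·₁ g) ◁ (χ A ▷ x))
    = ν f x ⨾ (U ·₂ (R ·₂ σ) ▷ (U ·₁ n A ∘ x)) ⨾ (U ·₁ (R ·₁ g) ◁ (χ A ▷ x)) by [].
  chain (lift_dataE g x).
  chain (interchange (U ·₂ (R ·₂ σ)) (χ A ▷ x)).
  chain (lift_dataE f x).
  slide (χ B).
  by chain (u Z x).
- move=> A.
  have u := colax_unit Hμ A; cbn [pf_comp pf_iota fwd inv_comp inv_map] in u.
  elements u as u'.
  push_goal.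
  suff: ν (id1 A) x ⨾ el U (pat (R ·₁ id1 A)) (pid (R A)) (pf_iota R A) (U ·₁ n A ∘ x) ⨾ (χ A ▷ x)
    = (U ·₁ n A ◁ el U (pat (id1 A)) (pid A) (id2 (id1 A)) x) ⨾ (χ A ▷ x) by [].
  have e := el_nat (F := U) (s := pat (R ·₁ id1 A)) (t := pid (R A)) (pf_iota R A) (χ A ▷ x).
  cbn [act act2] in e.
  chain <- e.
  chain (lift_dataE (id1 A) x).
  rewrite !el_pat_id.
  rewrite map2_id rwhisk_id vcomp_id_l.
  chain (u' Z x).
  by slide (χ A).
- move=> A B C g f.
  have u := colax_comp Hμ g f; cbn [pf_comp pf_gamma fwd inv_comp inv_map] in u.
  elements u as u'.
  push_goal.
  suff: ν (g ∘ f) x ⨾ el U (pat (R ·₁ (g ∘ f))) (pco (pat (R ·₁ g)) (pat (R ·₁ f))) (pf_gamma R g f)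
    (U ·₁ n A ∘ x)
    ⨾ (U ·₁ (R ·₁ g) ◁ (U ·₁ (R ·₁ f) ◁ (χ A ▷ x)))
    = (U ·₁ n C ◁ el U (pat (g ∘ f)) (pco (pat g) (pat f)) (id2 (g ∘ f)) x)
    ⨾ ν g (U ·₁ f ∘ x) ⨾ (U ·₁ (R ·₁ g) ◁ ν f x)
    ⨾ (U ·₁ (R ·₁ g) ◁ (U ·₁ (R ·₁ f) ◁ (χ A ▷ x))) by [].
  have e := el_nat (F := U) (s := pat (R ·₁ (g ∘ f))) (t := pco (pat (R ·₁ g)) (pat (R ·₁ f)))
    (pf_gamma R g f) (χ A ▷ x).
  cbn [act act2] in e.
  chain <- e.
  chain (lift_dataE (g ∘ f) x).
  rewrite !el_pat_co.
  rewrite map2_id rwhisk_id vcomp_id_l.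
  chain (u' Z x).
  chain (lift_dataE f x) under (U ·₁ (R ·₁ g)).
  chain (lift_dataE g (U ·₁ f ∘ x)).
  by slide (χ C).
Qed.
End Coreflection.

(** * Naturality along paths, images of squares, and naturality of a modification *)

Section ColaxPath.
Variables (X Y : Bicat) (K K' : Pseudofunctor X Y) (α : ColaxData K K').
Hypothesis Hα : is_colax (K := K) (K' := K') α.

Definition colel (A B : X) (f : hom A B) (Z : Y) (x : hom Z (K A)) :
  α B ∘ (K ·₁ f ∘ x) ⇒ K' ·₁ f ∘ (α A ∘ x) :=
  elem (pco (pat (α B)) (pat (K ·₁ f))) (pco (pat (K' ·₁ f)) (pat (α A))) (cx_cell α f) x.

(** The colax cell at a composite, pasted from the cells at its factors. *)
Fixpoint colax_path (A B : X) (t : path A B) (Z : Y) : forall x : hom Z (K A),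
    α B ∘ act K t x ⇒ act K' t (α A ∘ x) :=
  match t with
  | pid A => fun x => id2 _
  | pat f => fun x => colel f x
  | pco s t => fun x => colax_path s (act K t x) ⨾ act2 K' s (colax_path t x)
  end.

(** The unit and composition axioms say that the pasted cell is the cell at the
    composite. *)
Lemma colax_canon (A B : X) (t : path A B) (Z : Y) (x : hom Z (K A)) :
  (α B ◁ canon K t x) ⨾ colax_path t x = colel (ev t) x ⨾ canon K' t (α A ∘ x).
Proof.
elim: t Z x => [C|C E f|C E C' s IHs t IHt] Z x.
- elements (colax_unit Hα C) as u.
  have := u Z x; rewrite !elem_iota /colel => e.
  cbn [colax_path canon]; rewrite vcomp_id_r; exact: (eq_sym e).
- by cbn [colax_path canon inv_id fwd]; rewrite lwhisk_id vcomp_id_l vcomp_id_r.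
- elements (colax_comp Hα (ev s) (ev t)) as u.
  have := u Z x; rewrite !elem_gamma => {}u.
  have ck (F : Pseudofunctor X Y) (z : hom Z (F C)) : fwd (canon F (pco s t) z)
    = gamma_el F (ev s) (ev t) z ⨾ (F ·₁ ev s ◁ canon F t z) ⨾ canon F s (act F t z) by [].
  cbn [colax_path]; rewrite !ck.
  move: (fwd (gamma_el K (ev s) (ev t) x)) (fwd (gamma_el K' (ev s) (ev t) (α C ∘ x))) u => a b u.
  rewrite -/(colel (ev s ∘ ev t) x) -/(colel (ev t) x) -/(colel (ev s) _) in u.
  clean.
  chain (IHs Z (act K t x)).
  rewrite -canon_nat.
  have n : (α C' ◁ (K ·₁ ev s ◁ canon K t x)) ⨾ colel (ev s) (act K t x)
    = colel (ev s) (K ·₁ ev t ∘ x) ⨾ (K' ·₁ ev s ◁ (α E ◁ canon K t x)).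
    rewrite /colel; slide (cx_cell α (ev s)); by [].
  chain n.
  chain (IHt Z x) under (K' ·₁ ev s).
  cbn [ev]. chain u.
  by [].
Qed.

(** Naturality of [α] against a 2-cell between composites, with no structure
    isomorphism of [K] or [K'] left.  This is the form in which colax naturality is
    used for squares. *)
Lemma colax_path_nat (A B : X) (s t : path A B) (σ : ev s ⇒ ev t) (Z : Y) (x : hom Z (K A)) :
  (α B ◁ el K s t σ x) ⨾ colax_path t x = colax_path s x ⨾ el K' s t σ (α A ∘ x).
Proof.
apply: (fwd_inj (φ := inv_lwhisk (α B) (canon K s x))); cbn [inv_lwhisk fwd].
rewrite -[RHS]vcomp_assoc colax_canon vcomp_assoc el_canon.
rewrite -[LHS]vcomp_assoc -lwhisk_vcomp el_canon lwhisk_vcomp vcomp_assoc colax_canon.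
elements (colax_nat Hα σ) as u.
chain (u Z x).
by rewrite /colel; clean.
Qed.
End ColaxPath.

(** Splitting an atom [g ∘ f] or [id1 B] at the end of a path changes the value by a
    structure isomorphism. *)
Section Refine.
Variables (X Y : Bicat) (F : Pseudofunctor X Y).

Lemma el_target_comp (A B C E : X) (s : path A E) (g : hom C E) (f : hom B C) (r : path A B)
  (α : ev s ⇒ (g ∘ f) ∘ ev r) (Z : Y) (x : hom Z (F A)) :
  el F s (pco (pco (pat g) (pat f)) r) α x
  = el F s (pco (pat (g ∘ f)) r) α x ⨾ gammaF F g f (act F r x).
Proof.
rewrite !elE elem_gamma; cbn [canon fwd inv_comp inv_lwhisk inv_id ev act].
by rewrite ?lwhisk_id ?vcomp_id_r ?vcomp_id_l ?vcomp_assoc ?vcomp_id_r ?vcomp_id_l.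
Qed.

Lemma el_target_id (A B : X) (s r : path A B) (α : ev s ⇒ id1 B ∘ ev r) (Z : Y) (x : hom Z (F A)) :
  el F s (pco (pid B) r) α x
  = el F s (pco (pat (id1 B)) r) α x ⨾ iotaF F B (act F r x).
Proof.
rewrite !elE elem_iota; cbn [canon fwd inv_comp inv_lwhisk inv_id ev act].
by rewrite ?vcomp_id_r !vcomp_assoc.
Qed.
End Refine.

Definition inv_sym (K : Bicat) (A B : K) (f g : hom A B) (φ : invcell f g) : invcell g f :=
  Build_invcell (bwd_fwd φ) (fwd_bwd φ).

Definition inv_of (K : Bicat) (A B : K) (f g : hom A B) (α : f ⇒ g) (h : is_invertible α) :
  invcell f g :=
  let s := constructive_indefinite_description _ h in
  Build_invcell (proj1 (proj2_sig s)) (proj2 (proj2_sig s)).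

Ltac norm := cbn [pf_comp pre_comp pre_id pf_id pf_pre map0 map1 map2 pf_gamma pf_iota fwd bwd inv_comp
  inv_map inv_id inv_sym inv_lwhisk inv_rwhisk inv_ainv inv_lunit inv_of cx cx_cell cx_vcomp cx_lwhisk
    cx_rwhisk cx_id].
Tactic Notation "norm" "in" hyp(h) :=
  cbn [pf_comp pre_comp pre_id pf_id pf_pre map0 map1 map2
    pf_gamma pf_iota fwd bwd inv_comp inv_map inv_id inv_sym inv_lwhisk inv_rwhisk
    inv_ainv inv_lunit inv_of cx cx_cell cx_vcomp cx_lwhisk cx_rwhisk cx_id] in h.

Section PfComp.
Variables (X Y Z : Bicat) (G : Pseudofunctor Y Z) (F : Pseudofunctor X Y).

Lemma pf_comp_gamma (A B C : X) (g : hom B C) (f : hom A B) :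
  fwd (pf_gamma (pf_comp G F) g f) = G ·₂ pf_gamma F g f ⨾ pf_gamma G (F ·₁ g) (F ·₁ f).
Proof. exact: eq_refl. Qed.
Lemma pf_comp_gammaV (A B C : X) (g : hom B C) (f : hom A B) :
  bwd (pf_gamma (pf_comp G F) g f) = bwd (pf_gamma G (F ·₁ g) (F ·₁ f)) ⨾ G ·₂ bwd (pf_gamma F g f).
Proof. exact: eq_refl. Qed.
Lemma pf_comp_iota (A : X) : fwd (pf_iota (pf_comp G F) A) = G ·₂ pf_iota F A ⨾ pf_iota G (F A).
Proof. exact: eq_refl. Qed.
Lemma pf_comp_iotaV (A : X) : bwd (pf_iota (pf_comp G F) A) = bwd (pf_iota G (F A))
  ⨾ G ·₂ bwd (pf_iota F A).
Proof. exact: eq_refl. Qed.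
Lemma pf_id_gamma (A B C : X) (g : hom B C) (f : hom A B) : fwd (pf_gamma (pf_id X) g f) = id2 (g ∘ f).
Proof. exact: eq_refl. Qed.
Lemma pf_id_iota (A : X) : fwd (pf_iota (pf_id X) A) = id2 (id1 A).
Proof. exact: eq_refl. Qed.
End PfComp.

(** The structure isomorphisms of [(F3 F2) F1] and of [F3 (F2 F1)] agree only up to
    functoriality of [F3] on 2-cells; rewriting with these equations removes the
    difference. *)
Definition pf_compE := (pf_comp_gamma, pf_comp_gammaV, pf_comp_iota, pf_comp_iotaV, pf_id_gamma,
  pf_id_iota).

Ltac reassoc H :=
  let e := fresh in
  split;
  [ intros; exact (colax_nat H _)
  | intros A; have e := colax_unit H A;
    rewrite ?pf_compE ?map2_vcomp ?map2_id ?vcomp_id_l ?vcomp_id_r ?vcomp_assoc in e *; exact e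
  | intros A B C g f; have e := colax_comp H g f;
    rewrite ?pf_compE ?map2_vcomp ?map2_id ?vcomp_id_l ?vcomp_id_r ?vcomp_assoc in e *; exact e ].

(** Rebracketing and unit laws for the composite pseudofunctors between which a colax
    transformation is read. *)
Section Associativity.
Variables (X Y Z W : Bicat) (F3 : Pseudofunctor Z W) (F2 : Pseudofunctor Y Z) (F1 : Pseudofunctor X Y).
Variable F : Pseudofunctor X W.

Lemma target_assoc (α : ColaxData F (pre_comp F3 (pre_comp F2 F1))) :
  is_colax (K := F) (K' := pf_comp F3 (pf_comp F2 F1)) α ->
  is_colax (K := F) (K' := pf_comp (pf_comp F3 F2) F1) α.
Proof. move=> h; reassoc h. Qed.

Lemma target_assocV (α : ColaxData F (pre_comp F3 (pre_comp F2 F1))) :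
  is_colax (K := F) (K' := pf_comp (pf_comp F3 F2) F1) α ->
  is_colax (K := F) (K' := pf_comp F3 (pf_comp F2 F1)) α.
Proof. move=> h; reassoc h. Qed.

Lemma source_assocV (α : ColaxData (pre_comp F3 (pre_comp F2 F1)) F) :
  is_colax (K := pf_comp (pf_comp F3 F2) F1) (K' := F) α ->
  is_colax (K := pf_comp F3 (pf_comp F2 F1)) (K' := F) α.
Proof. move=> h; reassoc h. Qed.
End Associativity.

Section Identity.
Variables (X Y : Bicat) (F F' : Pseudofunctor X Y).

Lemma source_idl (α : ColaxData F F') :
  is_colax (K := pf_comp (pf_id Y) F) (K' := F') α -> is_colax (K := F) (K' := F') α.
Proof. move=> h; reassoc h. Qed.

Lemma source_idr (α : ColaxData F F') :
  is_colax (K := pf_comp F (pf_id X)) (K' := F') α -> is_colax (K := F) (K' := F') α.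
Proof. move=> h; reassoc h. Qed.

Lemma target_idl (α : ColaxData F F') :
  is_colax (K := F) (K' := pf_comp (pf_id Y) F') α -> is_colax (K := F) (K' := F') α.
Proof. move=> h; reassoc h. Qed.

Lemma target_idr (α : ColaxData F F') :
  is_colax (K := F) (K' := pf_comp F' (pf_id X)) α -> is_colax (K := F) (K' := F') α.
Proof. move=> h; reassoc h. Qed.
End Identity.

Section MapSquare.
Variables (X Y : Bicat) (F : Pseudofunctor X Y) (A B B' C : X).
Variables (g : hom B C) (f : hom A B) (g' : hom B' C) (f' : hom A B').

(** A square in [X] is a 2-cell between composites, and its image should again be one:
    hence the conjugation by the structure isomorphisms. *)
Definition map_sq (α : g ∘ f ⇒ g' ∘ f') : F ·₁ g ∘ F ·₁ f ⇒ F ·₁ g' ∘ F ·₁ f' :=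
  bwd (pf_gamma F g f) ⨾ F ·₂ α ⨾ pf_gamma F g' f'.

Lemma elem_map_sq (α : g ∘ f ⇒ g' ∘ f') (Z : Y) (x : hom Z (F A)) :
  elem (pco (pat (F ·₁ g)) (pat (F ·₁ f))) (pco (pat (F ·₁ g')) (pat (F ·₁ f'))) (map_sq α) x
  = el F (pco (pat g) (pat f)) (pco (pat g') (pat f')) α x.
Proof.
rewrite el_co_co /map_sq (elem_vcomp (s := pco _ _) (t := pat _) (r := pco _ _)).
by rewrite (elem_vcomp (s := pat _) (t := pat _) (r := pco _ _)) elem_pat.
Qed.
End MapSquare.
Arguments map_sq {X Y} F {A B B' C g f g' f'} α.

Section ElComp.
Variables (X Y W : Bicat) (F : Pseudofunctor Y W) (J : Pseudofunctor X Y).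
Lemma el_comp_co_co (A B B' C : X) (g : hom B C) (f : hom A B) (g' : hom B' C) (f' : hom A B')
  (α : g ∘ f ⇒ g' ∘ f') (Z : W) (x : hom Z (F (J A))) :
  el (pf_comp F J) (pco (pat g) (pat f)) (pco (pat g') (pat f')) α x
  = el F (pco (pat (J ·₁ g)) (pat (J ·₁ f))) (pco (pat (J ·₁ g')) (pat (J ·₁ f')))
     (map_sq J α) x.
Proof.
rewrite !el_co_co !map2_vcomp !rwhisk_vcomp !vcomp_assoc.
cbn [pf_comp pf_gamma inv_comp inv_map fwd bwd map2].
rewrite (elem_vcomp (s := pat _) (t := pat _) (r := pco (pat _) (pat _))).
rewrite (elem_vcomp (s := pco (pat _) (pat _)) (t := pat _) (r := pat _)) !elem_pat !vcomp_assoc.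
by [].
Qed.
End ElComp.

(** A modification from [α] to the identity transformation is studied one 1-cell at a
    time: the class of 1-cells at which the family [Ψ] is natural is closed under the
    operations that follow. *)
Section ModNat.
Variables (X Y : Bicat) (G : Pseudofunctor X Y) (α : ColaxData G G).
Hypothesis Hα : is_colax (K := G) (K' := G) α.
Variable Ψ : forall A : X, α A ⇒ id1 (G A).

Definition natural_at (A B : X) (f : hom A B) : Prop :=
  cx_cell α f ⨾ (G ·₁ f ◁ Ψ A) = (Ψ B ▷ G ·₁ f) ⨾ lunit (G ·₁ f) ⨾ rinv (G ·₁ f).

Lemma natural_elem (A B : X) (f : hom A B) : natural_at f ->
  forall Z (x : hom Z (G A)),
  elem (pco (pat (α B)) (pat (G ·₁ f))) (pco (pat (G ·₁ f)) (pat (α A))) (cx_cell α f) x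
  ⨾ (G ·₁ f ◁ elem (pat (α A)) (pid _) (Ψ A) x) = elem (pat (α B)) (pid _) (Ψ B) (G ·₁ f ∘ x).
Proof. by rewrite /natural_at => e; elements e as u; exact: u. Qed.

Lemma elem_natural (A B : X) (f : hom A B) :
  (forall Z (x : hom Z (G A)),
  elem (pco (pat (α B)) (pat (G ·₁ f))) (pco (pat (G ·₁ f)) (pat (α A))) (cx_cell α f) x
  ⨾ (G ·₁ f ◁ elem (pat (α A)) (pid _) (Ψ A) x) = elem (pat (α B)) (pid _) (Ψ B) (G ·₁ f ∘ x)) ->
  natural_at f.
Proof. by move=> e; rewrite /natural_at; strict Z x; exact: e. Qed.

Lemma natural_id (A : X) : natural_at (id1 A).
Proof.
apply: elem_natural => Z x.
elements (colax_unit Hα A) as u.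
have e := elem_nat (s := pat (G ·₁ id1 A)) (t := pid (G A)) (pf_iota G A)
  (elem (pat (α A)) (pid _) (Ψ A) x).
cbn [app app2] in e.
have i : forall a b : α A ∘ (G ·₁ id1 A ∘ x) ⇒ G ·₁ id1 A ∘ x,
   a ⨾ iotaF G A x = b ⨾ iotaF G A x -> a = b.
  by move=> a b; apply: (inv_cancel_r (elem_fwd_bwd (s := pat _) (t := pid _) (pf_iota G A) x)).
apply: i; rewrite vcomp_assoc e.
chain (u Z x).
have e2 := elem_nat (s := pat (α A)) (t := pid (G A)) (Ψ A) (iotaF G A x).
exact: e2.
Qed.

(** Compose with the split monomorphism [G i]: naturality of [α] in [r] reduces the
    claim at [g] to the one at [f]. *)
Lemma natural_retract (A B : X) (f g : hom A B) (i : g ⇒ f) (r : f ⇒ g) :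
  i ⨾ r = id2 g -> natural_at f -> natural_at g.
Proof.
move=> ir nf; apply: elem_natural => Z x.
elements (colax_nat Hα r) as u.
have e : (α B ◁ (G ·₂ i ▷ x)) ⨾ (α B ◁ (G ·₂ r ▷ x)) = id2 _.
  by rewrite -lwhisk_vcomp -rwhisk_vcomp -map2_vcomp ir map2_id rwhisk_id lwhisk_id.
rewrite -[LHS]vcomp_id_l -e !vcomp_assoc.
chain (u Z x).
chain (interchange (G ·₂ r) (elem (pat (α A)) (pid _) (Ψ A) x)).
chain (natural_elem nf x).
slide <- (Ψ B).
by rewrite (vcompE e) vcomp_id_l.
Qed.

(** The naturality square at [g ∘ f] is that at [g], restricted along [G f], pasted to
    that at [f].  If [f] is already known, the squares at [g ∘ f] and at [g] after
    restriction along [G f] determine each other. *)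
Lemma natural_comp_eq (A B C : X) (g : hom B C) (f : hom A B) : natural_at f ->
  forall Z (x : hom Z (G A)),
  (α C ◁ gammaF G g f x) ⨾ elem (pco (pat (α C)) (pat (G ·₁ g))) (pco (pat (G ·₁ g)) (pat (α B)))
    (cx_cell α g) (G ·₁ f ∘ x)
  ⨾ (G ·₁ g ◁ elem (pat (α B)) (pid _) (Ψ B) (G ·₁ f ∘ x))
  = elem (pco (pat (α C)) (pat (G ·₁ (g ∘ f)))) (pco (pat (G ·₁ (g ∘ f))) (pat (α A)))
    (cx_cell α (g ∘ f)) x
  ⨾ (G ·₁ (g ∘ f) ◁ elem (pat (α A)) (pid _) (Ψ A) x) ⨾ gammaF G g f x.
Proof.
move=> nf Z x.
elements (colax_comp Hα g f) as u.
slide (fwd (pf_gamma G g f)).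
chain (u Z x).
by chain (natural_elem nf x) under (G ·₁ g).
Qed.

Lemma natural_comp (A B C : X) (g : hom B C) (f : hom A B) :
  natural_at g -> natural_at f -> natural_at (g ∘ f).
Proof.
move=> ng nf; apply: elem_natural => Z x.
have := natural_comp_eq g nf x.
rewrite (natural_elem ng).
slide (Ψ C).
rewrite -[in RHS]vcomp_assoc.
move/(inv_cancel_r (elem_fwd_bwd (s := pat _) (t := pco (pat _) (pat _)) (pf_gamma G g f) x)).
exact: eq_sym.
Qed.

(** By the preceding lemma naturality holds at [r] after restriction along [G l].  By
    the triangle identity [G r ∘ x] is a retract of [G r ∘ G l ∘ G r ∘ x], with
    retraction induced by the counit.  Both sides of the naturality equation are
    natural in [x], so it is enough to know them at [G l ∘ G r ∘ x]. *)
Lemma natural_right_adjoint (A B : X) (l : hom A B) (r : hom B A)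
  (u : id1 A ⇒ r ∘ l) (c : l ∘ r ⇒ id1 B) :
  linv r ⨾ (u ▷ r) ⨾ ainv r l r ⨾ (r ◁ c) ⨾ runit r = id2 r ->
  natural_at l -> natural_at (r ∘ l) -> natural_at r.
Proof.
move=> zigzag nl nrl; apply: elem_natural => Z x.
elements zigzag along G as t.
have key W (z : hom W (G A)) :
  elem (pco (pat (α A)) (pat (G ·₁ r))) (pco (pat (G ·₁ r)) (pat (α B))) (cx_cell α r) (G ·₁ l ∘ z)
  ⨾ (G ·₁ r ◁ elem (pat (α B)) (pid _) (Ψ B) (G ·₁ l ∘ z))
  = elem (pat (α A)) (pid _) (Ψ A) (G ·₁ r ∘ (G ·₁ l ∘ z)).
  have := natural_comp_eq r nl z.
  chain (natural_elem nrl z).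
  slide <- (Ψ A).
  have e : (α A ◁ gammaB G r l z) ⨾ (α A ◁ gammaF G r l z) = id2 _.
    by rewrite -lwhisk_vcomp gamma_bf lwhisk_id.
  by move/(inv_cancel_l e).
have := t Z x.
move: (el G (pid A) (pco (pat r) (pat l)) u _) (el G (pco (pat l) (pat r)) (pid B) c x) => a b tab.
have e : (α A ◁ a) ⨾ (α A ◁ (G ·₁ r ◁ b)) = id2 _ by rewrite -lwhisk_vcomp tab lwhisk_id.
rewrite -[LHS]vcomp_id_l -[RHS]vcomp_id_l -e !vcomp_assoc.
slide (cx_cell α r).
chain (elem_nat (s := pat (α B)) (t := pid (G B)) (Ψ B) b) under (G ·₁ r).
cbn [app app2].
chain (key Z (G ·₁ r ∘ x)).
slide (Ψ A).
by rewrite tab vcomp_id_r (vcompE e) vcomp_id_l.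
Qed.
End ModNat.

(** * Kan adjunctions *)

Definition unit_data (M K : Bicat) (J : Pseudofunctor K M) (U : Pseudofunctor M K)
  (y : forall a : K, hom a (U (J a)))
  (unit_cell : forall (a b : K) (f : hom a b), invcell (y b ∘ f) (U ·₁ (J ·₁ f) ∘ y a)) :
  ColaxData (pre_id K) (pre_comp U J) :=
  {| cx := y : forall A : K, hom (pre_id K A) (pre_comp U J A);
     cx_cell := fun A B f => unit_cell A B f |}.

(** What is used of the adjunction between a 2-category and its Kleisli 2-category
    for a lax-idempotent pseudomonad.  The 1-cells of [M] out of [J a] are left Kan
    extensions along the unit ([ka_dense]), 2-cells of [M] are those of [K] ([ka_full]), and
    identities extend along the unit ([ka_mult]).  The counit is a consequence: its
    naturality cells and triangle cells are 2-cells out of Kan extensions. *)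
Record KanAdjunction (M K : Bicat) (J : Pseudofunctor K M) (U : Pseudofunctor M K) := {
  ka_unit : forall a : K, hom a (U (J a));
  ka_cell : forall (a b : K) (f : hom a b), invcell (ka_unit b ∘ f) (U ·₁ (J ·₁ f) ∘ ka_unit a);
  ka_colax : is_colax (K := pf_id K) (K' := pf_comp U J) (unit_data ka_cell);
  ka_dense : forall (a : K) (C : M) (f : hom (J a) C) (k : hom (U (J a)) (U C))
    (θ : U ·₁ f ∘ ka_unit a ⇒ k ∘ ka_unit a), exists! σ : U ·₁ f ⇒ k, σ ▷ ka_unit a = θ;
  ka_full : forall (A B : M) (f g : hom A B) (σ : U ·₁ f ⇒ U ·₁ g),
    exists! τ : f ⇒ g, U ·₂ τ = σ;
  ka_mult : forall C : M, hom (J (U C)) C;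
  ka_mult_cell : forall C : M, invcell (id1 (U C)) (U ·₁ ka_mult C ∘ ka_unit (U C))
}.
Arguments ka_unit {M K J U} _ a.
Arguments ka_cell {M K J U} _ {a b} f.
Arguments ka_mult {M K J U} _ C.
Arguments ka_mult_cell {M K J U} _ C.

Section LaxIdempotent.
Variables (M K : Bicat) (J : Pseudofunctor K M) (U : Pseudofunctor M K).
Variable E : KanAdjunction J U.
Notation y := (ka_unit E).
Notation unit_cell := (ka_cell E).
Notation unit_colax := (ka_colax E).
Notation mult := (ka_mult E).
Notation mult_cell := (ka_mult_cell E).

Notation un f x := (elem (pco (pat (y _)) (pat f)) (pco (pat (U ·₁ (J ·₁ f))) (pat (y _)))
  (fwd (unit_cell f)) x).
Notation unV f x := (elem (pco (pat (U ·₁ (J ·₁ f))) (pat (y _))) (pco (pat (y _)) (pat f))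
  (bwd (unit_cell f)) x).
Notation mu A x := (elem (pid (U A)) (pco (pat (U ·₁ mult A)) (pat (y (U A)))) (fwd (mult_cell A)) x).
Notation muV A x := (elem (pco (pat (U ·₁ mult A)) (pat (y (U A)))) (pid (U A)) (bwd (mult_cell A)) x).

Lemma sig_of_unique (T : Type) (P : T -> Prop) : (exists! t, P t) -> {t | P t}.
Proof.
move=> h; apply: constructive_indefinite_description.
by case: h => t []; exists t.
Qed.

Definition dense_desc (a : K) (C : M) (f : hom (J a) C) (k : hom (U (J a)) (U C))
  (θ : U ·₁ f ∘ y a ⇒ k ∘ y a) : U ·₁ f ⇒ k := proj1_sig (sig_of_unique (ka_dense θ)).

Lemma dense_descE (a : K) (C : M) (f : hom (J a) C) (k : hom (U (J a)) (U C))
  (θ : U ·₁ f ∘ y a ⇒ k ∘ y a) : dense_desc θ ▷ y a = θ.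
Proof. exact: (proj2_sig (sig_of_unique (ka_dense θ))). Qed.

Lemma dense_eq (a : K) (C : M) (f : hom (J a) C) (k : hom (U (J a)) (U C)) (σ τ : U ·₁ f ⇒ k) :
  σ ▷ y a = τ ▷ y a -> σ = τ.
Proof. by move=> e; case: (ka_dense (τ ▷ y a)) => ρ [_ u]; rewrite -(u σ e) -(u τ). Qed.

Lemma full_eq (A B : M) (f g : hom A B) (σ τ : f ⇒ g) : U ·₂ σ = U ·₂ τ -> σ = τ.
Proof. by move=> e; case: (ka_full E (U ·₂ τ)) => ρ [_ u]; rewrite -(u σ e) -(u τ). Qed.

(** A 2-cell between 1-cells out of [J a] is the same as one between their
    restrictions along [y].  All cells of [M] below are made in this way. *)
Definition ext2 (a : K) (C : M) (f g : hom (J a) C) (θ : U ·₁ f ∘ y a ⇒ U ·₁ g ∘ y a) : f ⇒ g :=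
  proj1_sig (sig_of_unique (ka_full E (dense_desc θ))).

Lemma ext2E (a : K) (C : M) (f g : hom (J a) C) (θ : U ·₁ f ∘ y a ⇒ U ·₁ g ∘ y a) :
  U ·₂ ext2 θ ▷ y a = θ.
Proof. by rewrite /ext2; case: sig_of_unique => τ /= ->; exact: dense_descE. Qed.

(** Fullness takes the equation to [K], and density to its restriction along [y]; in
    strict form this restriction is the evaluation at [y ∘ x]. *)
Lemma ext2_eq (a : K) (C : M) (s t : path (J a) C) (e e' : pasting s t) :
  (forall Z (x : hom Z a), sem U e (y a ∘ x) = sem U e' (y a ∘ x)) -> ev2 e = ev2 e'.
Proof.
move=> eq_on_y; apply: full_eq; apply: dense_eq.
strict Z x.
have := eq_on_y Z x; rewrite !sem_el !elE => /(inv_cancel_l (fwd_bwd (canon U s (y a ∘ x)))) h.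
exact: (fwd_injr (φ := canon U t (y a ∘ x)) h).
Qed.

Ltac ext2 Z x :=
  lazymatch goal with
  | |- @eq (@cell ?X ?A ?B ?f ?g) ?a ?b =>
      let ea := rcell X A B f g a in let eb := rcell X A B f g b in
      lazymatch type of ea with
      | @pasting _ _ _ ?s ?t => refine (@ext2_eq _ _ s t ea eb _)
      end
  end; intros Z x; cbn [sem act act2]; rewrite ?el_pat; clean.

Lemma unit_cell_nat (A B : K) (f g : hom A B) (σ : f ⇒ g) (Z : K) (x : hom Z A) :
  (y B ◁ (σ ▷ x)) ⨾ un g x = un f x ⨾ (U ·₂ (J ·₂ σ) ▷ (y A ∘ x)).
Proof. have e := colax_nat unit_colax σ. elements e as u. exact: u. Qed.

(** The composition axiom of the unit, combined with naturality in a 2-cell [σ]: with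
    [σ] a structure isomorphism of [U] it gives the compatibility of the unit with
    the composite [J U]. *)
Lemma unit_cell_nat_comp (A B C : K) (h : hom A C) (g : hom B C) (f : hom A B) (σ : h ⇒ g ∘ f) (Z : K)
  (x : hom Z A) :
  (y C ◁ elem (pat h) (pco (pat g) (pat f)) σ x) ⨾ un g (f ∘ x) ⨾ (U ·₁ (J ·₁ g) ◁ un f x)
  = un h x ⨾ (U ·₂ (J ·₂ σ) ▷ (y A ∘ x))
    ⨾ el U (pat (J ·₁ (g ∘ f))) (pco (pat (J ·₁ g)) (pat (J ·₁ f))) (pf_gamma J g f) (y A ∘ x).
Proof.
have e := colax_path_nat unit_colax (s := pat h) (t := pco (pat g) (pat f)) σ x.
rewrite (el_pat_co (F := pf_comp U J)) in e; norm in e.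
rewrite (elem_vcomp (s := pat _) (t := pat _) (r := pco (pat _) (pat _))) elem_pat in e.
cbn [colax_path act act2] in e; rewrite ?vcomp_assoc in e; rewrite el_pat_co; exact: e.
Qed.

Lemma unit_cell_nat_id (A : K) (h : hom A A) (σ : h ⇒ id1 A) (Z : K) (x : hom Z A) :
  y A ◁ elem (pat h) (pid A) σ x
  = un h x ⨾ (U ·₂ (J ·₂ σ) ▷ (y A ∘ x)) ⨾ el U (pat (J ·₁ id1 A)) (pid (J A)) (pf_iota J A) (y A ∘ x).
Proof.
have e := colax_path_nat unit_colax (s := pat h) (t := pid A) σ x.
rewrite (el_pat_id (F := pf_comp U J)) in e; norm in e.
rewrite (elem_vcomp (s := pat _) (t := pat _) (r := pid _)) elem_pat in e.
cbn [colax_path] in e. rewrite vcomp_id_r in e.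
rewrite el_pat_id; exact: e.
Qed.

Lemma un_unV (A B : K) (f : hom A B) (Z : K) (x : hom Z A) : un f x ⨾ unV f x = id2 _.
Proof. exact: elem_inv (fwd_bwd _). Qed.
Lemma unV_un (A B : K) (f : hom A B) (Z : K) (x : hom Z A) : unV f x ⨾ un f x = id2 _.
Proof. exact: elem_inv (bwd_fwd _). Qed.
Lemma mu_muV (A : M) (Z : K) (x : hom Z (U A)) : mu A x ⨾ muV A x = id2 _.
Proof. exact: elem_inv (fwd_bwd _). Qed.
Lemma muV_mu (A : M) (Z : K) (x : hom Z (U A)) : muV A x ⨾ mu A x = id2 _.
Proof. exact: elem_inv (bwd_fwd _). Qed.

(** Elements [J f ∘ y] are the same as elements [y ∘ f], on which cells made by
    extension can be computed. *)
Lemma unit_cell_inj (A B C : K) (h : hom (U (J B)) C) (f : hom A B) (Z : K) (x : hom Z A) k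
  (a b : h ∘ (U ·₁ (J ·₁ f) ∘ (y A ∘ x)) ⇒ k) :
  (h ◁ un f x) ⨾ a = (h ◁ un f x) ⨾ b -> a = b.
Proof.
apply: (inv_cancel_l (ψ := h ◁ unV f x)).
by rewrite -lwhisk_vcomp elem_bwd_fwd lwhisk_id.
Qed.

(** Restricted along [y], both sides of the naturality square of the multiplication are
    isomorphic to [U f], since the multiplication extends the identity. *)
Definition mult_nat_y (A B : M) (f : hom A B) :
  U ·₁ (mult B ∘ J ·₁ (U ·₁ f)) ∘ y (U A) ⇒ U ·₁ (f ∘ mult A) ∘ y (U A) :=
  (pf_gamma U (mult B) (J ·₁ (U ·₁ f)) ▷ y (U A))
  ⨾ ainv (U ·₁ mult B) (U ·₁ (J ·₁ (U ·₁ f))) (y (U A))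
  ⨾ (U ·₁ mult B ◁ bwd (unit_cell (U ·₁ f)))
  ⨾ assoc (U ·₁ mult B) (y (U B)) (U ·₁ f)
  ⨾ (bwd (mult_cell B) ▷ U ·₁ f)
  ⨾ lunit (U ·₁ f) ⨾ rinv (U ·₁ f)
  ⨾ (U ·₁ f ◁ mult_cell A)
  ⨾ assoc (U ·₁ f) (U ·₁ mult A) (y (U A))
  ⨾ (bwd (pf_gamma U f (mult A)) ▷ y (U A)).

Definition mult_nat (A B : M) (f : hom A B) : mult B ∘ J ·₁ (U ·₁ f) ⇒ f ∘ mult A :=
  ext2 (mult_nat_y f).

Definition mult_data : ColaxData (pre_comp J U) (pre_id M) :=
  {| cx := mult : forall A : M, hom (pre_comp J U A) (pre_id M A);
     cx_cell := fun A B f => mult_nat f |}.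

Notation mul f x := (el U (pco (pat (mult _)) (pat (J ·₁ (U ·₁ f)))) (pco (pat f) (pat (mult _)))
  (mult_nat f) x).

Lemma mult_natE (A B : M) (f : hom A B) (Z : K) (x : hom Z (U A)) :
  (U ·₁ mult B ◁ un (U ·₁ f) x) ⨾ mul f (y (U A) ∘ x)
  = muV B (U ·₁ f ∘ x) ⨾ (U ·₁ f ◁ mu A x).
Proof.
have e := ext2E (mult_nat_y f); rewrite -/(mult_nat f) /mult_nat_y in e.
elements e as u.
rewrite el_co_co; clean.
chain (u Z x).
rewrite gamma_bwdK gamma_bf vcomp_id_r.
by rewrite -[LHS]vcomp_assoc -lwhisk_vcomp elem_fwd_bwd lwhisk_id vcomp_id_l.
Qed.

(** Two cells out of [J U A] are compared on elements [y ∘ x], where the cell at [f] is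
    trivial (mult_natE); the structure isomorphisms of [U] are carried past the unit
    by its naturality. *)
Lemma mult_colax : is_colax (K := pf_comp J U) (K' := pf_id M) mult_data.
Proof.
split; unfold mult_data.
- move=> A B f g σ; norm; ext2 Z x.
  apply: (unit_cell_inj (f := U ·₁ f)).
  chain <- (unit_cell_nat (U ·₂ σ) x) under (U ·₁ mult B).
  chain (mult_natE g x).
  chain (mult_natE f x).
  slide (bwd (mult_cell B)).
  by slide (U ·₂ σ).
- move=> A. norm; ext2 Z x.
  rewrite el_target_id.
  apply: (unit_cell_inj (f := U ·₁ id1 A)).
  chain (mult_natE (id1 A) x).
  cbn [act].
  chain <- (unit_cell_nat_id (pf_iota U A) x) under (U ·₁ mult A).
  slide (fwd (pf_iota U A)) at (U ·₁ mult A ∘ (y (U A) ∘ x)).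
  slide <- (bwd (mult_cell A)).
  by rewrite muV_mu vcomp_id_r.
- move=> A B C g f. norm; ext2 Z x.
  rewrite el_target_comp; clean.
  apply: (unit_cell_inj (f := U ·₁ (g ∘ f))).
  chain (mult_natE (g ∘ f) x).
  cbn [act].
  chain <- (unit_cell_nat_comp (pf_gamma U g f) x) under (U ·₁ mult C).
  slide (mult_nat g).
  chain (mult_natE f x) under (U ·₁ g).
  chain (mult_natE g (U ·₁ f ∘ x)).
  chain (mu_muV (A := B) (U ·₁ f ∘ x)) under (U ·₁ g).
  slide (fwd (pf_gamma U g f)) at (U ·₁ mult A ∘ (y (U A) ∘ x)).
  slide <- (bwd (mult_cell C)).
  by [].
Qed.

(** Restricted along [y], the composite [m ∘ J y] is [m ∘ y ∘ y], which is [y].  Both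
    directions of the isomorphism are extended and shown to be inverse. *)
Definition triangle_y (a : K) : U ·₁ (mult (J a) ∘ J ·₁ y a) ∘ y a ⇒ U ·₁ id1 (J a) ∘ y a :=
  (pf_gamma U (mult (J a)) (J ·₁ y a) ▷ y a)
  ⨾ ainv (U ·₁ mult (J a)) (U ·₁ (J ·₁ y a)) (y a)
  ⨾ (U ·₁ mult (J a) ◁ bwd (unit_cell (y a)))
  ⨾ assoc (U ·₁ mult (J a)) (y (U (J a))) (y a)
  ⨾ (bwd (mult_cell (J a)) ▷ y a)
  ⨾ (bwd (pf_iota U (J a)) ▷ y a).

Definition triangleV_y (a : K) : U ·₁ id1 (J a) ∘ y a ⇒ U ·₁ (mult (J a) ∘ J ·₁ y a) ∘ y a :=
  (pf_iota U (J a) ▷ y a)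
  ⨾ (mult_cell (J a) ▷ y a)
  ⨾ ainv (U ·₁ mult (J a)) (y (U (J a))) (y a)
  ⨾ (U ·₁ mult (J a) ◁ unit_cell (y a))
  ⨾ assoc (U ·₁ mult (J a)) (U ·₁ (J ·₁ y a)) (y a)
  ⨾ (bwd (pf_gamma U (mult (J a)) (J ·₁ y a)) ▷ y a).

Definition kan_triangle (a : K) : mult (J a) ∘ J ·₁ y a ⇒ id1 (J a) := ext2 (triangle_y a).
Definition kan_triangleV (a : K) : id1 (J a) ⇒ mult (J a) ∘ J ·₁ y a := ext2 (triangleV_y a).

Notation tr a x := (el U (pco (pat (mult (J a))) (pat (J ·₁ y a))) (pid (J a)) (kan_triangle a) x).
Notation trV a x := (el U (pid (J a)) (pco (pat (mult (J a))) (pat (J ·₁ y a))) (kan_triangleV a) x).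

Lemma kan_triangleE (a : K) (Z : K) (x : hom Z a) :
  (U ·₁ mult (J a) ◁ un (y a) x) ⨾ tr a (y a ∘ x) = muV (J a) (y a ∘ x).
Proof.
have e := ext2E (triangle_y a); rewrite -/(kan_triangle a) /triangle_y in e.
elements e as u.
rewrite el_co_id.
chain (u Z x).
rewrite gamma_bwdK iota_bf vcomp_id_r.
by rewrite -[LHS]vcomp_assoc -lwhisk_vcomp un_unV lwhisk_id vcomp_id_l.
Qed.

Lemma kan_triangleVE (a : K) (Z : K) (x : hom Z a) :
  trV a (y a ∘ x) = mu (J a) (y a ∘ x) ⨾ (U ·₁ mult (J a) ◁ un (y a) x).
Proof.
have e := ext2E (triangleV_y a); rewrite -/(kan_triangleV a) /triangleV_y in e.
elements e as u.
rewrite el_id_co.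
chain (u Z x).
by rewrite gamma_bf iota_bwdK vcomp_id_r.
Qed.

Lemma kan_triangle_bwd_fwd (a : K) : kan_triangleV a ⨾ kan_triangle a = id2 _.
Proof.
ext2 Z x.
rewrite kan_triangleVE; clean.
chain (kan_triangleE x).
exact: mu_muV.
Qed.

Lemma kan_triangle_fwd_bwd (a : K) : kan_triangle a ⨾ kan_triangleV a = id2 _.
Proof.
ext2 Z x.
apply: (unit_cell_inj (f := y a)).
rewrite kan_triangleVE; clean.
chain (kan_triangleE x).
by rewrite (vcompE (muV_mu _)) ?vcomp_id_l ?vcomp_id_r.
Qed.

Definition kan_triangle_inv (a : K) : invcell (mult (J a) ∘ J ·₁ y a) (id1 (J a)) :=
  Build_invcell (kan_triangle_fwd_bwd a) (kan_triangle_bwd_fwd a).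

Lemma unit_cell_square (a b b' c : K) (g : hom b c) (f : hom a b) (g' : hom b' c) (f' : hom a b')
  (σ : g ∘ f ⇒ g' ∘ f') (Z : K) (x : hom Z a) :
  (y c ◁ elem (pco (pat g) (pat f)) (pco (pat g') (pat f')) σ x) ⨾ un g' (f' ∘ x)
    ⨾ (U ·₁ (J ·₁ g') ◁ un f' x)
  = un g (f ∘ x) ⨾ (U ·₁ (J ·₁ g) ◁ un f x)
    ⨾ el U (pco (pat (J ·₁ g)) (pat (J ·₁ f))) (pco (pat (J ·₁ g')) (pat (J ·₁ f'))) (map_sq J σ)
    (y a ∘ x).
Proof.
have n := colax_path_nat unit_colax (s := pco (pat g) (pat f)) (t := pco (pat g') (pat f')) σ x.
rewrite el_comp_co_co in n. cbn [colax_path act act2] in n. rewrite vcomp_assoc in n.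
exact: n.
Qed.

(** The triangle cells form a modification.  On elements [y ∘ x] all four faces are
    made of the cells of the unit and of [m ∘ y = 1]. *)
Lemma kan_triangle_nat (a b : K) (f : hom a b) :
  (mult (J b) ◁ map_sq J (unit_cell f)) ⨾ assoc (mult (J b)) (J ·₁ (U ·₁ (J ·₁ f))) (J ·₁ y a)
  ⨾ (mult_nat (J ·₁ f) ▷ J ·₁ y a) ⨾ ainv (J ·₁ f) (mult (J a)) (J ·₁ y a) ⨾ (J ·₁ f ◁ kan_triangle a)
  = assoc (mult (J b)) (J ·₁ y b) (J ·₁ f) ⨾ (kan_triangle b ▷ J ·₁ f) ⨾ lunit (J ·₁ f) ⨾ rinv (J ·₁ f).
Proof.
ext2 Z x.
have q : (U ·₁ mult (J b) ◁ (U ·₁ (J ·₁ y b) ◁ unV f x))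
  ⨾ (U ·₁ mult (J b) ◁ (U ·₁ (J ·₁ y b) ◁ un f x)) = id2 _.
  by rewrite -!lwhisk_vcomp unV_un !lwhisk_id.
apply: (inv_cancel_l q).
apply: (unit_cell_inj (f := y b)).
chain <- (unit_cell_square (unit_cell f) x) under (U ·₁ mult (J b)).
slide (mult_nat (J ·₁ f)).
chain (kan_triangleE x) under (U ·₁ (J ·₁ f)).
chain (mult_natE (J ·₁ f) (y a ∘ x)).
chain (mu_muV (A := J a) (y a ∘ x)) under (U ·₁ (J ·₁ f)).
slide (kan_triangle b).
chain (kan_triangleE (f ∘ x)).
by slide (bwd (mult_cell (J b))).
Qed.

(** For [D = U J], the canonical comparison of [D y] with [y D], which agree on [y]; [D y] is a left
    Kan extension along [y], and so it maps to [y D].  Its existence is what makes the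
    pseudomonad lax idempotent. *)
Definition lax_cell (a : K) : U ·₁ (J ·₁ y a) ⇒ y (U (J a)) :=
  dense_desc (f := J ·₁ y a) (bwd (unit_cell (y a))).

Lemma lax_cellE (a : K) (Z : K) (x : hom Z a) : lax_cell a ▷ (y a ∘ x) = unV (y a) x.
Proof.
have e := dense_descE (f := J ·₁ y a) (bwd (unit_cell (y a))).
rewrite -/(lax_cell a) in e.
elements e as u; exact: u.
Qed.

(** Restricted along [y], the composite [J y ∘ m] is [D y], and the identity is [y D]:
    the counit is the extension of the comparison between them. *)
Definition adj_counit_y (a : K) : U ·₁ (J ·₁ y a ∘ mult (J a)) ∘ y (U (J a)) ⇒
  U ·₁ id1 (J (U (J a))) ∘ y (U (J a)) :=
  (pf_gamma U (J ·₁ y a) (mult (J a)) ▷ y (U (J a)))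
  ⨾ ainv (U ·₁ (J ·₁ y a)) (U ·₁ mult (J a)) (y (U (J a)))
  ⨾ (U ·₁ (J ·₁ y a) ◁ bwd (mult_cell (J a)))
  ⨾ runit (U ·₁ (J ·₁ y a))
  ⨾ lax_cell a ⨾ linv (y (U (J a)))
  ⨾ (bwd (pf_iota U (J (U (J a)))) ▷ y (U (J a))).

Definition adj_counit (a : K) : J ·₁ y a ∘ mult (J a) ⇒ id1 (J (U (J a))) := ext2 (adj_counit_y a).

Lemma adj_counitE (a : K) (Z : K) (x : hom Z (U (J a))) :
  el U (pco (pat (J ·₁ y a)) (pat (mult (J a)))) (pid _) (adj_counit a) (y (U (J a)) ∘ x)
  = (U ·₁ (J ·₁ y a) ◁ muV (J a) x) ⨾ (lax_cell a ▷ x).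
Proof.
have e := ext2E (adj_counit_y a); rewrite -/(adj_counit a) /adj_counit_y in e.
elements e as u.
rewrite el_co_id.
chain (u Z x).
by rewrite gamma_bwdK iota_bf vcomp_id_r.
Qed.

(** The composites [m ∘ D y] and [m ∘ y D] are both isomorphic to the identity, and
    the comparison of [D y] with [y D] respects these isomorphisms.  Both sides are
    2-cells out of the identity of [D a], a Kan extension along [y], so that they may
    be compared on [y], where the comparison is the inverse of a unit cell. *)
Lemma kan_triangleV_lax (a : K) (Z : K) (x : hom Z (U (J a))) :
  trV a x ⨾ (U ·₁ mult (J a) ◁ (lax_cell a ▷ x)) = mu (J a) x.
Proof.
have e : U ·₂ kan_triangleV a ⨾ pf_gamma U (mult (J a)) (J ·₁ y a) ⨾ (U ·₁ mult (J a) ◁ lax_cell a)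
  = pf_iota U (J a) ⨾ mult_cell (J a).
  apply: dense_eq; strict W z.
  apply: (inv_cancel_l (iota_fb (F := U) (A := J a) (y a ∘ z))).
  have t := kan_triangleVE z; rewrite el_id_co in t.
  chain t.
  rewrite lax_cellE iota_bwdK.
  by rewrite -lwhisk_vcomp un_unV lwhisk_id vcomp_id_r.
elements e as u.
rewrite el_id_co; clean.
chain (u Z x).
by rewrite iota_bwdK.
Qed.

(** The triangle identity of the adjunction of [J y] with [m] that lives at [m]. *)
Lemma adj_triangle (a : K) :
  linv (mult (J a)) ⨾ (kan_triangleV a ▷ mult (J a)) ⨾ ainv (mult (J a)) (J ·₁ y a) (mult (J a))
  ⨾ (mult (J a) ◁ adj_counit a) ⨾ runit (mult (J a)) = id2 (mult (J a)).
Proof.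
ext2 Z x.
rewrite adj_counitE; clean.
slide <- (kan_triangleV a).
chain (kan_triangleV_lax x).
exact: muV_mu.
Qed.

(** A 1-cell out of [J a] is the extension of its restriction, and [m ∘ J g] is an
    extension of [g].  Both agree on [y]. *)
Definition restrict_y (a : K) (C : M) (f : hom (J a) C) : U ·₁ f ∘ y a ⇒
  U ·₁ (mult C ∘ J ·₁ (U ·₁ f ∘ y a)) ∘ y a :=
  linv (U ·₁ f ∘ y a) ⨾ (mult_cell C ▷ (U ·₁ f ∘ y a))
  ⨾ ainv (U ·₁ mult C) (y (U C)) (U ·₁ f ∘ y a)
  ⨾ (U ·₁ mult C ◁ unit_cell (U ·₁ f ∘ y a))
  ⨾ assoc (U ·₁ mult C) (U ·₁ (J ·₁ (U ·₁ f ∘ y a))) (y a)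
  ⨾ (bwd (pf_gamma U (mult C) (J ·₁ (U ·₁ f ∘ y a))) ▷ y a).
Definition restrictV_y (a : K) (C : M) (f : hom (J a) C) : U ·₁ (mult C ∘ J ·₁ (U ·₁ f ∘ y a)) ∘ y a ⇒
  U ·₁ f ∘ y a :=
  (pf_gamma U (mult C) (J ·₁ (U ·₁ f ∘ y a)) ▷ y a)
  ⨾ ainv (U ·₁ mult C) (U ·₁ (J ·₁ (U ·₁ f ∘ y a))) (y a)
  ⨾ (U ·₁ mult C ◁ bwd (unit_cell (U ·₁ f ∘ y a)))
  ⨾ assoc (U ·₁ mult C) (y (U C)) (U ·₁ f ∘ y a)
  ⨾ (bwd (mult_cell C) ▷ (U ·₁ f ∘ y a)) ⨾ lunit (U ·₁ f ∘ y a).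

Lemma restrict_retract (a : K) (C : M) (f : hom (J a) C) :
  ext2 (restrict_y f) ⨾ ext2 (restrictV_y f) = id2 f.
Proof.
apply: full_eq; apply: dense_eq.
rewrite map2_vcomp map2_id rwhisk_vcomp rwhisk_id !ext2E.
rewrite /restrict_y /restrictV_y.
strict Z x.
rewrite gamma_bwdK.
chain (elem_inv (s := pco (pat (y _)) (pco (pat _) (pat (y a)))) (t := pco (pat _) (pat (y a))) x
  (fwd_bwd (unit_cell (U ·₁ f ∘ y a)))) under (U ·₁ mult C).
exact: mu_muV.
Qed.

Lemma natural_from_J (L : Bicat) (G : Pseudofunctor M L) (α : ColaxData G G)
  (Ψ : forall A : M, α A ⇒ id1 (G A)) :
  is_colax (K := G) (K' := G) α ->
  (forall (a b : K) (f : hom a b), natural_at Ψ (J ·₁ f)) ->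
  forall (a b : K) (f : hom (J a) (J b)), natural_at Ψ f.
Proof.
move=> Hα HJ a b f.
have Hm : natural_at Ψ (mult (J b)).
  apply: (natural_right_adjoint Hα (adj_triangle b) (HJ _ _ (y b))).
  exact: (natural_retract Hα (kan_triangle_fwd_bwd b) (natural_id Hα Ψ (J b))).
exact: (natural_retract Hα (restrict_retract f) (natural_comp Hα Hm (HJ _ _ _))).
Qed.

(** * The transpose of the multiplication and the comparison *)

Section Transpose.
Variables (P : Pseudofunctor M K) (η : ColaxData (pre_id K) (pre_comp P J)).
Hypothesis η_colax : is_colax (K := pf_id K) (K' := pf_comp P J) η.
Hypothesis η_inv : forall a : K, is_invertible (cx_cell η (y a)).

(** For [P = H G] this is the transpose [P m_A ∘ η_(U A)] of [G m_A]. *)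
Definition transpose : ColaxData U P := cx_vcomp (cx_lwhisk P mult_data) (cx_rwhisk η U).

Lemma transpose_colax : is_colax (K := U) (K' := P) transpose.
Proof.
apply: (colax_vcomp (K' := pf_comp P (pf_comp J U))).
- apply: target_idr; exact: (colax_lwhisk P mult_colax).
- apply: source_idl; apply: target_assocV; exact: (colax_rwhisk U η_colax).
Qed.

Definition transposeY : ColaxData U (pre_comp U (pre_comp J P)) :=
  cx_vcomp (cx_rwhisk (unit_data (@ka_cell _ _ _ _ E)) P) transpose.

Lemma transposeY_colax : is_colax (K := U) (K' := pf_comp U (pf_comp J P)) transposeY.
Proof.
apply: (colax_vcomp (K' := P)); last exact: transpose_colax.
apply: source_idl; apply: target_assocV; exact: (colax_rwhisk P unit_colax).
Qed.

(** The invertible cell of [η] at [y] takes [P m ∘ η ∘ y] to [P m ∘ P J y ∘ η], which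
    the triangle isomorphism identifies with [η]. *)
Definition transpose_unit (a : K) : invcell ((P ·₁ mult (J a) ∘ η (U (J a))) ∘ y a) (η a) :=
  inv_comp (inv_ainv (P ·₁ mult (J a)) (η (U (J a))) (y a))
  (inv_comp (inv_lwhisk (P ·₁ mult (J a)) (inv_of (η_inv a)))
  (inv_comp (inv_sym (inv_ainv (P ·₁ mult (J a)) (P ·₁ (J ·₁ y a)) (η a)))
  (inv_comp (inv_rwhisk (inv_comp (inv_sym (pf_gamma P (mult (J a)) (J ·₁ y a)))
     (inv_comp (inv_map P (kan_triangle_inv a)) (pf_iota P (J a)))) (η a)) (inv_lunit (η a))))).

Notation ηe f x := (elem (pco (pat (η _)) (pat f)) (pco (pat (P ·₁ (J ·₁ f))) (pat (η _))) (cx_cell η f)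
  x).
Notation κ a x := (elem (pco (pco (pat (P ·₁ mult (J a))) (pat (η (U (J a))))) (pat (y a))) (pat (η a))
  (fwd (transpose_unit a)) x).
Notation κV a x := (elem (pat (η a)) (pco (pco (pat (P ·₁ mult (J a))) (pat (η (U (J a))))) (pat (y a)))
  (bwd (transpose_unit a)) x).

Lemma transpose_unitE (a Z : K) (x : hom Z a) :
  κ a x = (P ·₁ mult (J a) ◁ ηe (y a) x) ⨾ el P (pco (pat (mult (J a))) (pat (J ·₁ y a))) (pid (J a))
    (kan_triangle a) (η a ∘ x).
Proof.
rewrite el_co_id.
have e : fwd (transpose_unit a) =
  ainv (P ·₁ mult (J a)) (η (U (J a))) (y a) ⨾ (P ·₁ mult (J a) ◁ cx_cell η (y a))
  ⨾ assoc (P ·₁ mult (J a)) (P ·₁ (J ·₁ y a)) (η a)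
  ⨾ ((bwd (pf_gamma P (mult (J a)) (J ·₁ y a)) ⨾ P ·₂ kan_triangle a ⨾ pf_iota P (J a)) ▷ η a)
  ⨾ lunit (η a) by [].
elements e as u.
exact: u.
Qed.

(** Compatibility of the isomorphism of [θ y] with [η] with the two colax structures:
    naturality of [η] against the square of the unit at [f], followed by the image under
    [P] of the modification axiom of the triangle. *)
Lemma transpose_unit_nat (a b : K) (f : hom a b) (Z : K) (x : hom Z a) :
  (P ·₁ mult (J b) ◁ (η (U (J b)) ◁ un f x))
  ⨾ (P ·₁ mult (J b) ◁ ηe (U ·₁ (J ·₁ f)) (y a ∘ x))
  ⨾ el P (pco (pat (mult (J b))) (pat (J ·₁ (U ·₁ (J ·₁ f))))) (pco (pat (J ·₁ f)) (pat (mult (J a))))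
    (mult_nat (J ·₁ f)) (η _ ∘ (y a ∘ x))
  ⨾ (P ·₁ (J ·₁ f) ◁ κ a x)
  = κ b (f ∘ x) ⨾ ηe f x.
Proof.
have n := colax_path_nat η_colax (s := pco (pat (y b)) (pat f))
  (t := pco (pat (U ·₁ (J ·₁ f))) (pat (y a))) (unit_cell f) x.
rewrite el_comp_co_co in n. cbn [colax_path act act2] in n. rewrite vcomp_assoc in n.
have {}n : (η (U (J b)) ◁ un f x) ⨾ ηe (U ·₁ (J ·₁ f)) (y a ∘ x)
  ⨾ (P ·₁ (J ·₁ (U ·₁ (J ·₁ f))) ◁ ηe (y a) x)
  = ηe (y b) (f ∘ x) ⨾ (P ·₁ (J ·₁ y b) ◁ ηe f x)
   ⨾ el P (pco (pat (J ·₁ y b)) (pat (J ·₁ f))) (pco (pat (J ·₁ (U ·₁ (J ·₁ f)))) (pat (J ·₁ y a)))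
     (map_sq J (unit_cell f)) (η a ∘ x) by [].
elements (kan_triangle_nat f) along P as t.
rewrite !transpose_unitE; clean.
slide <- (mult_nat (J ·₁ f)).
chain n under (P ·₁ mult (J b)).
cbn [app].
chain (t Z (η a ∘ x)).
by slide (kan_triangle b).
Qed.

Definition comparison_inv (a : K) :
  invcell (U ·₁ (J ·₁ η a) ∘ y a) ((y (P (J a)) ∘ (P ·₁ mult (J a) ∘ η (U (J a)))) ∘ y a) :=
  inv_comp (inv_sym (unit_cell (η a)))
   (inv_comp (inv_lwhisk (y (P (J a))) (inv_sym (transpose_unit a)))
     (inv_sym (inv_ainv (y (P (J a))) (P ·₁ mult (J a) ∘ η (U (J a))) (y a)))).

(** The isomorphism [J η ∘ y = y ∘ η = y ∘ θ ∘ y], extended along [y].  It extends in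
    this direction only, because [J η] is a Kan extension and [y ∘ θ] need not be one. *)
Definition comparison (a : K) : U ·₁ (J ·₁ η a) ⇒ y (P (J a)) ∘ (P ·₁ mult (J a) ∘ η (U (J a))) :=
  dense_desc (f := J ·₁ η a) (comparison_inv a).

Lemma comparison_y (a : K) : comparison a ▷ y a = comparison_inv a.
Proof. exact: dense_descE. Qed.

(** Restrict along [y]: since [h] is a Kan extension, 2-cells out of it are their
    restrictions, and on restrictions the composition with the comparison is
    composition with an isomorphism. *)
Lemma comparison_univ (a : K) (C : M) (h : hom (J a) C) (k : hom (J (P (J a))) C)
  (ρ : U ·₁ h ⇒ U ·₁ k ∘ (y (P (J a)) ∘ (P ·₁ mult (J a) ∘ η (U (J a))))) :
  exists! σ : h ⇒ k ∘ J ·₁ η a,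
    U ·₂ σ ⨾ pf_gamma U k (J ·₁ η a) ⨾ (U ·₁ k ◁ comparison a) = ρ.
Proof.
set t := y (P (J a)) ∘ _ in ρ *.
pose φ : invcell (U ·₁ (k ∘ J ·₁ η a) ∘ y a) ((U ·₁ k ∘ t) ∘ y a) :=
  inv_comp (inv_rwhisk (pf_gamma U k (J ·₁ η a)) (y a))
  (inv_comp (inv_ainv (U ·₁ k) (U ·₁ (J ·₁ η a)) (y a))
  (inv_comp (inv_lwhisk (U ·₁ k) (comparison_inv a))
   (inv_sym (inv_ainv (U ·₁ k) t (y a))))).
have e (σ : h ⇒ k ∘ J ·₁ η a) :
  (U ·₂ σ ⨾ pf_gamma U k (J ·₁ η a) ⨾ (U ·₁ k ◁ comparison a)) ▷ y a = (U ·₂ σ ▷ y a) ⨾ φ.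
  rewrite !rwhisk_vcomp; congr vcomp; rewrite -[fwd φ]/((pf_gamma U k (J ·₁ η a) ▷ y a) ⨾ ainv _ _ _
    ⨾ (U ·₁ k ◁ comparison_inv a) ⨾ assoc _ _ _).
  congr vcomp.
  rewrite -comparison_y (vcompE (ainv_nat_m _ _ _)) vcomp_assoc ainv_assoc vcomp_id_r.
  by [].
exists (ext2 ((ρ ▷ y a) ⨾ bwd φ)); split.
- apply: dense_eq; rewrite e ext2E vcomp_assoc bwd_fwd vcomp_id_r. by [].
- move=> τ eτ; apply: full_eq; apply: dense_eq; apply: (fwd_injr (φ := φ)).
  by rewrite ext2E vcomp_assoc bwd_fwd vcomp_id_r -eτ e.
Qed.

Notation cmp a x := (elem (pat (U ·₁ (J ·₁ η a))) (pco (pat (y (P (J a))))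
  (pco (pat (P ·₁ mult (J a))) (pat (η (U (J a)))))) (comparison a) x).

Lemma comparison_elem (a Z : K) (x : hom Z a) :
  un (η a) x ⨾ cmp a (y a ∘ x) = y (P (J a)) ◁ κV a x.
Proof.
have e : comparison a ▷ y a = bwd (unit_cell (η a)) ⨾ (y (P (J a)) ◁ bwd (transpose_unit a))
  ⨾ assoc (y (P (J a))) (P ·₁ mult (J a) ∘ η (U (J a))) (y a) := comparison_y a.
elements e as u.
by rewrite u (vcompE (un_unV _ _)) vcomp_id_l.
Qed.

Lemma transpose_unit_fwd_bwd (a Z : K) (x : hom Z a) : κ a x ⨾ κV a x = id2 _.
Proof. exact: elem_inv (fwd_bwd _). Qed.
Lemma transpose_unit_bwd_fwd (a Z : K) (x : hom Z a) : κV a x ⨾ κ a x = id2 _.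
Proof. exact: elem_inv (bwd_fwd _). Qed.

(** The image of the colax cell of [η] at [f] solves the equation that defines the cell of
    the lifted unit at [J f].  Both sides start at a Kan extension along [y], and on [y]
    the claim is the compatibility of [θ y] with [η]. *)
Lemma comparison_nat (a b : K) (f : hom a b) :
  U ·₂ map_sq J (cx_cell η f) ⨾ pf_gamma U (J ·₁ (P ·₁ (J ·₁ f))) (J ·₁ η a)
    ⨾ (U ·₁ (J ·₁ (P ·₁ (J ·₁ f))) ◁ comparison a)
  = pf_gamma U (J ·₁ η b) (J ·₁ f) ⨾ (comparison b ▷ U ·₁ (J ·₁ f)) ⨾ cx_cell transposeY (J ·₁ f).
Proof.
apply: (dense_eq (f := J ·₁ η b ∘ J ·₁ f)).
cbn [transposeY transpose cx_vcomp cx_rwhisk cx_lwhisk cx cx_cell mult_data unit_data pre_comp map0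
  map1].
strict Z x.
have e := el_co_co (F := P) (mult_nat (J ·₁ f)) (η (U (J a)) ∘ (y a ∘ x)).
chain <- e under (y (P (J b))); clear e.
apply: (inv_cancel_l (gamma_fb (F := U) (J ·₁ η b) (J ·₁ f) (y a ∘ x))).
have e := el_co_co (F := U) (map_sq J (cx_cell η f)) (y a ∘ x).
chain <- e; clear e.
rewrite gamma_bwdK.
have q : (U ·₁ (J ·₁ η b) ◁ unV f x) ⨾ (U ·₁ (J ·₁ η b) ◁ un f x) = id2 _.
  by rewrite -!lwhisk_vcomp unV_un !lwhisk_id.
apply: (inv_cancel_l q).
apply: (inv_cancel_l (unV_un (η b) (f ∘ x))).
chain <- (unit_cell_square (cx_cell η f) x).
chain (comparison_elem x) under (U ·₁ (J ·₁ (P ·₁ (J ·₁ f)))).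
slide (comparison b).
chain (comparison_elem (f ∘ x)).
have t : (P ·₁ mult (J b) ◁ (η (U (J b)) ◁ un f x))
  ⨾ (P ·₁ mult (J b) ◁ ηe (U ·₁ (J ·₁ f)) (y a ∘ x))
  ⨾ el P (pco (pat (mult (J b))) (pat (J ·₁ (U ·₁ (J ·₁ f))))) (pco (pat (J ·₁ f)) (pat (mult (J a))))
    (mult_nat (J ·₁ f)) (η _ ∘ (y a ∘ x))
  = κ b (f ∘ x) ⨾ ηe f x ⨾ (P ·₁ (J ·₁ f) ◁ κV a x).
  have k1 : (P ·₁ (J ·₁ f) ◁ κ a x) ⨾ (P ·₁ (J ·₁ f) ◁ κV a x) = id2 _.
    by rewrite -lwhisk_vcomp transpose_unit_fwd_bwd lwhisk_id.
  apply: (inv_cancel_r k1); rewrite !vcomp_assoc transpose_unit_nat.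
  by rewrite -lwhisk_vcomp transpose_unit_bwd_fwd lwhisk_id vcomp_id_r.
chain t under (y (P (J b))).
chain (transpose_unit_bwd_fwd (f ∘ x)) under (y (P (J b))).
cbn [pre_comp map0 map1].
slide <- (fwd (unit_cell (P ·₁ (J ·₁ f)))).
by [].
Qed.
End Transpose.
End LaxIdempotent.

(** * Images of the adjunction data *)

Section Images.
Variables (K M : Bicat) (J : Pseudofunctor K M).

(** As for squares, the images of the 2-cells that start or end at an identity are
    conjugated so that they do so again. *)
Definition map_unit (A B : K) (p : hom B A) (q : hom A B) (Φ : id1 A ⇒ p ∘ q) :
  id1 (J A) ⇒ J ·₁ p ∘ J ·₁ q := bwd (pf_iota J A) ⨾ J ·₂ Φ ⨾ pf_gamma J p q.

Definition map_counit (A B : K) (p : hom B A) (q : hom A B) (Ψ : p ∘ q ⇒ id1 A) :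
  J ·₁ p ∘ J ·₁ q ⇒ id1 (J A) := bwd (pf_gamma J p q) ⨾ J ·₂ Ψ ⨾ pf_iota J A.

Lemma elem_map_unit (A B : K) (p : hom B A) (q : hom A B) (Φ : id1 A ⇒ p ∘ q) (Z : M) (x : hom Z (J A))
  :
  elem (pid (J A)) (pco (pat (J ·₁ p)) (pat (J ·₁ q))) (map_unit Φ) x
  = el J (pid A) (pco (pat p) (pat q)) Φ x.
Proof.
rewrite el_id_co /map_unit (elem_vcomp (s := pid _) (t := pat _) (r := pco _ _)).
by rewrite (elem_vcomp (s := pat _) (t := pat _) (r := pco _ _)) elem_pat.
Qed.

Lemma elem_map_counit (A B : K) (p : hom B A) (q : hom A B) (Ψ : p ∘ q ⇒ id1 A) (Z : M)
  (x : hom Z (J A)) :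
  elem (pco (pat (J ·₁ p)) (pat (J ·₁ q))) (pid (J A)) (map_counit Ψ) x
  = el J (pco (pat p) (pat q)) (pid A) Ψ x.
Proof.
rewrite el_co_id /map_counit (elem_vcomp (s := pco _ _) (t := pat _) (r := pid _)).
by rewrite (elem_vcomp (s := pat _) (t := pat _) (r := pid _)) elem_pat.
Qed.

(** The shape of the modification axiom for a family [1 => p ∘ q], with cells [s] and [t]
    of colax transformations. *)
Lemma map_modification_square (X X' W W' : K) (f : hom X X') (p : hom W X) (q : hom X W)
  (p' : hom W' X') (q' : hom X' W') (k : hom W W') (s : p' ∘ k ⇒ f ∘ p) (t : q' ∘ f ⇒ k ∘ q)
  (Φ : id1 X ⇒ p ∘ q) (Φ' : id1 X' ⇒ p' ∘ q') :
  (lunit f ⨾ rinv f) ⨾ (f ◁ Φ)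
  = (Φ' ▷ f) ⨾ (ainv p' q' f ⨾ (p' ◁ t) ⨾ assoc p' k q ⨾ (s ▷ q) ⨾ ainv f p q) ->
  (lunit (J ·₁ f) ⨾ rinv (J ·₁ f)) ⨾ (J ·₁ f ◁ map_unit Φ)
  = (map_unit Φ' ▷ J ·₁ f) ⨾ (ainv (J ·₁ p') (J ·₁ q') (J ·₁ f) ⨾ (J ·₁ p' ◁ map_sq J t)
    ⨾ assoc (J ·₁ p') (J ·₁ k) (J ·₁ q) ⨾ (map_sq J s ▷ J ·₁ q) ⨾ ainv (J ·₁ f) (J ·₁ p) (J ·₁ q)).
Proof.
move=> e; elements e along J as u.
strict Z x.
rewrite !elem_map_sq !elem_map_unit.
exact: u.
Qed.

Lemma map_swallowtail (X Y W : K) (h : hom X Y) (p : hom W Y) (q k : hom Y W)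
  (Φ : id1 Y ⇒ p ∘ q) (t : q ∘ h ⇒ k ∘ h) (Ψ : p ∘ k ⇒ id1 Y) :
  linv h ⨾ (Φ ▷ h) ⨾ ainv p q h ⨾ (p ◁ t) ⨾ assoc p k h ⨾ (Ψ ▷ h) ⨾ lunit h = id2 h ->
  linv (J ·₁ h) ⨾ (map_unit Φ ▷ J ·₁ h) ⨾ ainv (J ·₁ p) (J ·₁ q) (J ·₁ h) ⨾ (J ·₁ p ◁ map_sq J t)
    ⨾ assoc (J ·₁ p) (J ·₁ k) (J ·₁ h) ⨾ (map_counit Ψ ▷ J ·₁ h) ⨾ lunit (J ·₁ h) = id2 (J ·₁ h).
Proof.
move=> e; elements e along J as u.
strict Z x.
rewrite elem_map_sq elem_map_unit elem_map_counit.
exact: u.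
Qed.
End Images.
Arguments map_unit {K M} J {A B p q} Φ.
Arguments map_counit {K M} J {A B p q} Ψ.

Section ImagesComp.
Variables (X Y Z : Bicat) (G : Pseudofunctor Y Z) (F : Pseudofunctor X Y).

Lemma map_sq_comp (A B B' C : X) (g : hom B C) (f : hom A B) (g' : hom B' C) (f' : hom A B')
  (α : g ∘ f ⇒ g' ∘ f') : map_sq G (map_sq F α) = map_sq (pf_comp G F) α.
Proof.
rewrite /map_sq pf_comp_gamma pf_comp_gammaV !map2_vcomp !vcomp_assoc. by [].
Qed.

Lemma map_unit_comp (A B : X) (p : hom B A) (q : hom A B) (Φ : id1 A ⇒ p ∘ q) :
  map_unit G (map_unit F Φ) = map_unit (pf_comp G F) Φ.
Proof.
rewrite /map_unit pf_comp_gamma pf_comp_iotaV !map2_vcomp !vcomp_assoc. by [].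
Qed.

Lemma map_counit_comp (A B : X) (p : hom B A) (q : hom A B) (Ψ : p ∘ q ⇒ id1 A) :
  map_counit G (map_counit F Ψ) = map_counit (pf_comp G F) Ψ.
Proof.
rewrite /map_counit pf_comp_gammaV pf_comp_iota !map2_vcomp !vcomp_assoc. by [].
Qed.
End ImagesComp.

Section AdjunctionImage.
Variables (K M L : Bicat) (J : Pseudofunctor K M) (G : Pseudofunctor M L) (H : Pseudofunctor L K).
Variable adj : ColaxAdjunction (pf_comp G J) H.
(** The unit of the given adjunction, read as a transformation into [(H G) J], so that
    [H G] takes the place of [P]. *)
Definition adj_unit : ColaxData (pre_id K) (pre_comp (pf_comp H G) J) := ca_unit adj.
Notation η := adj_unit.
Notation ε := (ca_counit adj).

(** The cell at [f] of the composite of [ε G] and [G n], for a transformation [n] with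
    cell [s] at [f].  With [s] as a variable it serves for the given adjunction and for
    the lifted one. *)
Definition counit_square (A B : M) (f : hom A B) (nA : hom A (J (H (G A)))) (nB : hom B (J (H (G B))))
  (s : nB ∘ f ⇒ J ·₁ (H ·₁ (G ·₁ f)) ∘ nA) :
  (ε (G B) ∘ G ·₁ nB) ∘ G ·₁ f ⇒ G ·₁ f ∘ (ε (G A) ∘ G ·₁ nA) :=
  ainv (ε (G B)) (G ·₁ nB) (G ·₁ f)
  ⨾ (ε (G B) ◁ map_sq G s)
  ⨾ assoc (ε (G B)) (G ·₁ (J ·₁ (H ·₁ (G ·₁ f)))) (G ·₁ nA)
  ⨾ (cx_cell ε (G ·₁ f) ▷ G ·₁ nA)
  ⨾ ainv (G ·₁ f) (ε (G A)) (G ·₁ nA).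

Definition Psi_cell (a : K) : ε (G (J a)) ∘ G ·₁ (J ·₁ η a) ⇒ id1 (G (J a)) := ca_Psi adj a.

(** The axioms for [Ψ] and [Φ] and the swallowtail identities are rewritten so that the
    unit occurs through [map_sq J] of its cells, which is what the cells of the lifted
    unit are at 1-cells [J f]. *)
Lemma Psi_square (a b : K) (f : hom a b) :
  counit_square (map_sq J (cx_cell η f)) ⨾ (G ·₁ (J ·₁ f) ◁ Psi_cell a)
  = (Psi_cell b ▷ G ·₁ (J ·₁ f)) ⨾ lunit (G ·₁ (J ·₁ f)) ⨾ rinv (G ·₁ (J ·₁ f)).
Proof. rewrite /counit_square map_sq_comp; exact: (md_nat (ca_Psi adj) f). Qed.

Definition Phi_cell (C : L) : id1 (J (H C)) ⇒ J ·₁ (H ·₁ ε C) ∘ J ·₁ η (H C) :=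
  map_unit J (ca_Phi adj C).

Lemma Phi_square (C C' : L) (g : hom C C') :
  (lunit (J ·₁ (H ·₁ g)) ⨾ rinv (J ·₁ (H ·₁ g))) ⨾ (J ·₁ (H ·₁ g) ◁ Phi_cell C)
  = (Phi_cell C' ▷ J ·₁ (H ·₁ g))
    ⨾ (ainv (J ·₁ (H ·₁ ε C')) (J ·₁ η (H C')) (J ·₁ (H ·₁ g))
       ⨾ (J ·₁ (H ·₁ ε C') ◁ map_sq J (cx_cell η (H ·₁ g)))
       ⨾ assoc (J ·₁ (H ·₁ ε C')) (J ·₁ (H ·₁ (G ·₁ (J ·₁ (H ·₁ g))))) (J ·₁ η (H C))
       ⨾ (map_sq (pf_comp J H) (cx_cell ε g) ▷ J ·₁ η (H C))
       ⨾ ainv (J ·₁ (H ·₁ g)) (J ·₁ (H ·₁ ε C)) (J ·₁ η (H C))).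
Proof.
rewrite -map_sq_comp; apply: map_modification_square.
exact: (md_nat (ca_Phi adj) g).
Qed.

Lemma swallowtail_unit_image (a : K) :
  linv (J ·₁ η a)
  ⨾ (Phi_cell (G (J a)) ▷ J ·₁ η a)
  ⨾ ainv (J ·₁ (H ·₁ ε (G (J a)))) (J ·₁ η (H (G (J a)))) (J ·₁ η a)
  ⨾ (J ·₁ (H ·₁ ε (G (J a))) ◁ map_sq J (cx_cell η (η a)))
  ⨾ assoc (J ·₁ (H ·₁ ε (G (J a)))) (J ·₁ (H ·₁ (G ·₁ (J ·₁ η a)))) (J ·₁ η a)
  ⨾ (map_counit (pf_comp J H) (Psi_cell a) ▷ J ·₁ η a)
  ⨾ lunit (J ·₁ η a)
  = id2 (J ·₁ η a).
Proof.
rewrite -map_counit_comp; apply: map_swallowtail.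
exact: (ca_swallowtail_unit adj a).
Qed.

Lemma swallowtail_counit_image (C : L) :
  rinv (ε C)
  ⨾ (ε C ◁ map_unit G (Phi_cell C))
  ⨾ assoc (ε C) (G ·₁ (J ·₁ (H ·₁ ε C))) (G ·₁ (J ·₁ η (H C)))
  ⨾ (cx_cell ε (ε C) ▷ G ·₁ (J ·₁ η (H C)))
  ⨾ ainv (ε C) (ε (G (J (H C)))) (G ·₁ (J ·₁ η (H C)))
  ⨾ (ε C ◁ Psi_cell (H C))
  ⨾ runit (ε C)
  = id2 (ε C).
Proof. rewrite map_unit_comp; exact: (ca_swallowtail_counit adj C). Qed.
End AdjunctionImage.

(** * The Kleisli 2-category *)

Section KleisliForget.
Variables (K : TwoCat) (D : LeftKanPseudomonad K).
Notation M := (Kleisli D).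
Notation J := (Kleisli_incl D).
Notation y := (mon_y D).

(** Composition and identities of the Kleisli 2-category are those of the underlying
    1-cells, so the structure isomorphisms are identities. *)
Definition Kleisli_forget : Pseudofunctor M K.
Proof.
refine (@Build_Pseudofunctor M K
  {| map0 := fun A : M => D A : K; map1 := fun (A B : M) (f : hom A B) => proj1_sig f |}
  (fun (A B : M) (f g : hom A B) (σ : f ⇒ g) => σ)
  (fun (A B C : M) (g : hom B C) (f : hom A B) => inv_id (proj1_sig g ∘ proj1_sig f))
  (fun A : M => inv_id (id1 (D A))) _ _ _ _ _ _ _); intros; cbn.
- by [].
- by [].
- by rewrite vcomp_id_l vcomp_id_r.
- by rewrite vcomp_id_l vcomp_id_r.
- by rewrite rwhisk_id lwhisk_id !vcomp_id_l vcomp_id_r.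
- by rewrite rwhisk_id !vcomp_id_l.
- by rewrite lwhisk_id !vcomp_id_l.
Defined.
Notation U := Kleisli_forget.

Definition Kleisli_unit (a : K) : hom a (U (J a)) := y a.

(** A 1-cell of the Kleisli 2-category preserves the extension of [y] along [y], which is
    the identity.  So it is the left Kan extension of its restriction, with identity
    extension cell. *)
Lemma Kleisli_dense (A : K) (B : M) (f : hom (J A) B) (k : hom (U (J A)) (U B))
  (θ : U ·₁ f ∘ Kleisli_unit A ⇒ k ∘ Kleisli_unit A) : exists! σ : U ·₁ f ⇒ k, σ ▷ Kleisli_unit A = θ.
Proof.
(* The extension of [y] in the structure of a free algebra is [y^D]; it is the identity
   up to the isomorphism ρ, since both are extensions of [y]. *)
pose ρ := lan_iso (mon_lan D (y A)) (mon_lan_y D A).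
have eρ : mon_cell D (y A) ⨾ (ρ ▷ y A) = linv (y A) by exact: lan_descE.
pose ψ : invcell (U ·₁ f ∘ mon_ext D (y A)) (U ·₁ f) :=
  inv_comp (inv_lwhisk (U ·₁ f) ρ) (Build_invcell (runit_rinv (U ·₁ f)) (rinv_runit (U ·₁ f))).
have L := lan_postcomp ψ (proj2_sig f A (y A)).
have e : ((U ·₁ f ◁ mon_cell D (y A)) ⨾ assoc (U ·₁ f) (mon_ext D (y A)) (y A)) ⨾ (ψ ▷ y A) = id2 _.
  elements eρ as u.
  cbn [ψ inv_comp inv_lwhisk fwd]; strict Z x.
  rewrite -lwhisk_vcomp u. by rewrite lwhisk_id.
move: L; rewrite /free_alg /alg_cell e => L.
case: (L k θ) => σ [h1 h2]; exists σ; split.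
- by rewrite -h1 vcomp_id_l.
- by move=> τ h; apply: h2; rewrite vcomp_id_l.
Qed.

Lemma Kleisli_full (A B : M) (f g : hom A B) (σ : U ·₁ f ⇒ U ·₁ g) : exists! τ : f ⇒ g, U ·₂ τ = σ.
Proof. by exists σ; split. Qed.

Definition Kleisli_unit_cell (A B : K) (f : hom A B) :
  invcell (Kleisli_unit B ∘ f) (U ·₁ (J ·₁ f) ∘ Kleisli_unit A) := J_cell D f.

Lemma Kleisli_unit_colax : is_colax (K := pf_id K) (K' := pf_comp U J) (unit_data Kleisli_unit_cell).
Proof.
split.
- move=> A B f g σ; exact: (eq_sym (J_map2E D σ)).
- move=> A; cbn [pf_comp pf_iota fwd inv_comp inv_map pf_id inv_id].
  have := J_iotaE D A; rewrite lwhisk_id vcomp_id_l => <-.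
  rewrite rwhisk_vcomp; congr vcomp.
  by rewrite -[RHS]vcomp_id_r -(rwhisk_id).
- move=> A B C g f; cbn [pf_comp pf_gamma fwd inv_comp inv_map pf_id inv_id].
  have := J_gammaE D g f; rewrite lwhisk_id vcomp_id_l => <-.
  rewrite rwhisk_vcomp; congr vcomp.
  by rewrite -[RHS]vcomp_id_r -(rwhisk_id).
Qed.

Definition Kleisli_mult (C : M) : hom (J (U C)) C := ext_mor (id1 (D C)).
Definition Kleisli_mult_cell (C : M) : invcell (id1 (U C)) (U ·₁ Kleisli_mult C ∘ Kleisli_unit (U C)) :=
  mon_cell D (id1 (D C)).

Definition Kleisli_adjunction : KanAdjunction J U := {|
  ka_unit := Kleisli_unit;
  ka_cell := Kleisli_unit_cell;
  ka_colax := Kleisli_unit_colax;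
  ka_dense := Kleisli_dense;
  ka_full := Kleisli_full;
  ka_mult := Kleisli_mult;
  ka_mult_cell := Kleisli_mult_cell |}.
Notation E := Kleisli_adjunction.

Section Adjunction.
Variables (L : TwoCat) (G : Pseudofunctor M L) (H : Pseudofunctor L K).
Variable adj : Biadjunction (pf_comp G J) H.

Notation ε := (ca_counit adj).
Notation P := (pf_comp H G).
Notation R := (pf_comp J P).

Lemma is_colax_trans (X Y : Bicat) (F F' : Pseudofunctor X Y) (α : ColaxTrans F F') :
  is_colax (K := F) (K' := F') α.
Proof. by case: α => d h1 h2 h3; split. Qed.

Notation η := (adj_unit adj).

Lemma adj_unit_colax : is_colax (K := pf_id K) (K' := pf_comp P J) η.
Proof. apply: target_assoc; exact: (is_colax_trans (ca_unit adj)). Qed.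

Lemma adj_unit_inv (a : K) : is_invertible (cx_cell η (ka_unit E a)).
Proof. exact (@ba_unit_pseudo _ _ _ _ adj _ _ (Kleisli_unit a)). Qed.

(** An object of the Kleisli 2-category is a free algebra, named by an object of the
    base; hence the comparison, made for [J a], is there for every object. *)
Definition Kleisli_comparison (A : M) : U ·₁ (J ·₁ η A) ⇒ transposeY E η A :=
  comparison (E := E) (η := η) adj_unit_inv A.

Lemma Kleisli_comparison_univ (A C : M) (h : hom A C) (k : hom (R A) C)
  (ρ : U ·₁ h ⇒ U ·₁ k ∘ transposeY E η A) :
  exists! σ : h ⇒ k ∘ J ·₁ η A, push (U := U) (R := R) (μ := transposeY E η)
    (n := fun A : M => J ·₁ η A) Kleisli_comparison σ = ρ.
Proof. exact: (comparison_univ (E := E) (η := η) adj_unit_inv (a := A) ρ). Qed.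

Definition lifted_unit : ColaxData (pre_id M) R := lift_data Kleisli_comparison_univ.

Lemma lifted_unit_colax : is_colax (K := pf_id M) (K' := R) lifted_unit.
Proof.
apply: lift_colax.
exact: (transposeY_colax E adj_unit_colax).
Qed.

(** Uniqueness of lifts along the comparison. *)
Lemma lifted_unit_J (A B : K) (f : hom A B) :
  cx_cell lifted_unit (J ·₁ f) = map_sq J (cx_cell η f).
Proof.
apply: (push_inj Kleisli_comparison_univ).
rewrite [LHS]push_lift.
have e := comparison_nat (E := E) adj_unit_colax adj_unit_inv f.
exact: (eq_sym e).
Qed.

Definition lifted_triangle : ColaxData G G := cx_vcomp (cx_rwhisk ε G) (cx_lwhisk G lifted_unit).

Lemma lifted_triangle_colax : is_colax (K := G) (K' := G) lifted_triangle.
Proof.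
apply: (colax_vcomp (K' := pf_comp G R)).
- apply: source_assocV; apply: source_assocV; apply: target_idl.
  exact: (colax_rwhisk G (is_colax_trans ε)).
- apply: source_idr; exact: (colax_lwhisk G lifted_unit_colax).
Qed.

Definition lifted_Psi (A : M) : lifted_triangle A ⇒ id1 (G A) := Psi_cell adj A.

Lemma lifted_Psi_J (a b : K) (f : hom a b) : natural_at lifted_Psi (J ·₁ f).
Proof.
have e := Psi_square adj f.
rewrite /natural_at.
have -> : cx_cell lifted_triangle (J ·₁ f) = counit_square adj (cx_cell lifted_unit (J ·₁ f))
  by exact: eq_refl.
rewrite lifted_unit_J.
exact e.
Qed.

(** Every 1-cell of the Kleisli 2-category has a free algebra as source and target, so
    that the 1-cells [J f] suffice. *)
Lemma lifted_Psi_nat (A B : M) (f : hom A B) : natural_at lifted_Psi f.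
Proof. exact: (natural_from_J E lifted_triangle_colax lifted_Psi_J (a := A) (b := B) f). Qed.

Definition colax_trans (X Y : Bicat) (F F' : Pseudofunctor X Y) (α : ColaxData F F')
  (h : is_colax (K := F) (K' := F') α) : ColaxTrans F F' :=
  Build_ColaxTrans (colax_nat h) (colax_unit h) (colax_comp h).

Definition lifted_unit_trans : ColaxTrans (pf_id M) (pf_comp (pf_comp J H) G) :=
  colax_trans (target_assoc lifted_unit_colax).

Definition lifted_counit_trans : ColaxTrans (pf_comp G (pf_comp J H)) (pf_id L) :=
  colax_trans (source_assocV (is_colax_trans ε)).

Definition lifted_Psi_mod : @Modification M L G G
  (cx_vcomp (cx_rwhisk lifted_counit_trans G) (cx_lwhisk G lifted_unit_trans)) (cx_id G) :=
  @Build_Modification M L G G (cx_vcomp (cx_rwhisk lifted_counit_trans G)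
    (cx_lwhisk G lifted_unit_trans)) (cx_id G)
    lifted_Psi lifted_Psi_nat.

Lemma lifted_Phi_nat (C C' : L) (g : hom C C') :
  cx_cell (cx_id (pf_comp J H)) g ⨾ (J ·₁ (H ·₁ g) ◁ Phi_cell adj C)
  = (Phi_cell adj C' ▷ J ·₁ (H ·₁ g))
    ⨾ cx_cell (cx_vcomp (cx_lwhisk (pf_comp J H) lifted_counit_trans)
    (cx_rwhisk lifted_unit_trans (pf_comp J H))) g.
Proof.
have e := Phi_square adj g.
have e1 := lifted_unit_J (H ·₁ g).
cbn [cx_vcomp cx_rwhisk cx_lwhisk cx cx_cell].
have -> : cx_cell lifted_unit_trans (pf_comp J H ·₁ g) = map_sq J (cx_cell η (H ·₁ g)) by exact: e1.
exact e.
Qed.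

Definition lifted_Phi_mod : @Modification L M (pf_comp J H) (pf_comp J H) (cx_id (pf_comp J H))
  (cx_vcomp (cx_lwhisk (pf_comp J H) lifted_counit_trans)
    (cx_rwhisk lifted_unit_trans (pf_comp J H))) :=
  @Build_Modification L M (pf_comp J H) (pf_comp J H) (cx_id (pf_comp J H))
    (cx_vcomp (cx_lwhisk (pf_comp J H) lifted_counit_trans) (cx_rwhisk lifted_unit_trans (pf_comp J H)))
    (Phi_cell adj) lifted_Phi_nat.

Lemma swallowtail_unit_Kleisli (A : M) :
  linv (J ·₁ η A)
  ⨾ (Phi_cell adj (G A) ▷ J ·₁ η A)
  ⨾ ainv (J ·₁ (H ·₁ ε (G A))) (J ·₁ η (H (G A))) (J ·₁ η A)
  ⨾ (J ·₁ (H ·₁ ε (G A)) ◁ map_sq J (cx_cell η (η A)))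
  ⨾ assoc (J ·₁ (H ·₁ ε (G A))) (J ·₁ (H ·₁ (G ·₁ (J ·₁ η A)))) (J ·₁ η A)
  ⨾ (map_counit (pf_comp J H) (lifted_Psi A) ▷ J ·₁ η A)
  ⨾ lunit (J ·₁ η A)
  = id2 (J ·₁ η A).
Proof. exact: (swallowtail_unit_image adj A). Qed.

(** The swallowtail identities contain cells of the unit only at the 1-cells [J η_a],
    so they are the images of those of the given adjunction. *)
Definition lifted_adjunction : ColaxAdjunction G (pf_comp J H).
Proof.
refine (@Build_ColaxAdjunction M L G (pf_comp J H)
  lifted_unit_trans lifted_counit_trans lifted_Psi_mod lifted_Phi_mod _ _).
- move=> A; cbv zeta.
  have -> : cx_cell lifted_unit_trans (lifted_unit_trans A) =
    map_sq J (cx_cell η (η A)) by exact: (lifted_unit_J (η A)).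
  cbn [lifted_unit_trans lifted_counit_trans colax_trans cx_data lifted_unit lift_data cx md
    lifted_Psi_mod lifted_Phi_mod].
  exact (swallowtail_unit_Kleisli A).
- move=> C; cbv zeta.
  cbn [lifted_unit_trans lifted_counit_trans colax_trans cx_data lifted_unit lift_data cx md
    lifted_Psi_mod lifted_Phi_mod].
  exact (swallowtail_counit_image adj C).
Defined.

End Adjunction.
End KleisliForget.

Theorem theorem4p15
  (K : TwoCat) (D : LeftKanPseudomonad K)
  (L : TwoCat)
  (G : Pseudofunctor (Kleisli D) L) (H : Pseudofunctor L K)
  (adj : Biadjunction (pf_comp G (Kleisli_incl D)) H) :
  inhabited (ColaxAdjunction G (pf_comp (Kleisli_incl D) H)).
Proof. exact: (inhabits (lifted_adjunction adj)). Qed.
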